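(* Let $G=[g_1,\ldots,g_n]$ be a finitely generated abelian transcendental semigroup in which each generator is of bounded type. Suppose that for all $i,j$ with $1\le i,j\le n$ and $i\neq j$, $g_i(\mathrm{Sing}(g_j^{-1}))\subset\mathrm{Sing}(g_j^{-1})$. If the generators $g_1,\ldots,g_n$ of $G$ are hyperbolic, then so is $G$.
   Context: A transcendental semigroup $G=[g_1,\ldots,g_n]$ is the semigroup, under functional composition, generated by transcendental entire functions $g_1,\ldots,g_n:\mathbb{C}\to\mathbb{C}$. It is called abelian if $g_i\circ g_j=g_j\circ g_i$ for all $i,j$. For a transcendental entire function $f$, $\mathrm{Sing}(f^{-1})$ is the set of critical values and (finite) asymptotic values of $f$ and their finite limit points; $f$ is of bounded type if $\mathrm{Sing}(f^{-1})$ is bounded. The postsingular set of $f$ is $\mathcal{P}(f)=\overline{\bigcup_{m\ge 0}f^m(\mathrm{Sing}(f^{-1}))}$ (closure in $\mathbb{C}$), where $f^m$ is the $m$-th iterate and $f^0$ is the identity. The Fatou set $F(f)$ is the set of points of $\mathbb{C}$ having a neighborhood on which the family of iterates $\{f^m\}_{m\in\mathbb{N}}$ is normal (local uniform convergence to $\infty$ being allowed). An entire function $f$ is hyperbolic if $\mathcal{P}(f)$ is a compact subset of $F(f)$. A transcendental semigroup $G$ is hyperbolic if each $g\in G$ is hyperbolic. *)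

(* Defs.v *)
From Stdlib Require Import Reals List.
From Coquelicot Require Import Coquelicot.

Open Scope R_scope.

Definition entire (f : C -> C) : Prop := forall z : C, ex_derive f z.

Definition polynomial_function (f : C -> C) : Prop :=
  exists (d : nat) (c : nat -> C),
    forall z : C, f z = sum_n (fun k => (c k * z ^ k)%C) d.

Definition transcendental_entire (f : C -> C) : Prop :=
  entire f /\ ~ polynomial_function f.

(* Coquelicot provides [open] and [closed] but not the next three notions. *)

Definition limit_point (S : C -> Prop) (w : C) : Prop :=
  forall V : C -> Prop, locally w V -> exists v : C, v <> w /\ S v /\ V v.

Definition closure (S : C -> Prop) (w : C) : Prop :=
  forall V : C -> Prop, locally w V -> exists v : C, S v /\ V v.

Definition compact_set (K : C -> Prop) : Prop :=
  forall cover : (C -> Prop) -> Prop,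
    (forall U, cover U -> open U) ->
    (forall z, K z -> exists U, cover U /\ U z) ->
    exists l : list (C -> Prop),
      (forall U, In U l -> cover U) /\
      (forall z, K z -> exists U, In U l /\ U z).

Definition critical_value (f : C -> C) (w : C) : Prop :=
  exists z : C, is_derive f z (RtoC 0) /\ f z = w.

(* Only the end of the curve at +oo matters, so curves are parametrised by the
   whole real line rather than by a half-line. *)
Definition asymptotic_value (f : C -> C) (w : C) : Prop :=
  exists gamma : R -> C,
    (forall t : R, continuous gamma t) /\
    filterlim (fun t => Cmod (gamma t))
      (Rbar_locally p_infty) (Rbar_locally p_infty) /\
    filterlim (fun t => f (gamma t)) (Rbar_locally p_infty) (locally w).

(* Sing(f^{-1}) *)
Definition Sing (f : C -> C) (w : C) : Prop :=
  let S := fun v => critical_value f v \/ asymptotic_value f v in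
  S w \/ limit_point S w.

Definition bounded_type (f : C -> C) : Prop :=
  exists M : R, forall w : C, Sing f w -> Cmod w <= M.

Definition postsingular (f : C -> C) : C -> Prop :=
  closure (fun z => exists (m : nat) (w : C), Sing f w /\ z = Nat.iter m f w).

Definition locally_uniform_lim (U : C -> Prop) (u : nat -> C -> C)
    (l : C -> C) : Prop :=
  forall z : C, U z ->
    exists V : C -> Prop, locally z V /\
      forall eps : R, 0 < eps ->
        eventually (fun k => forall w, U w -> V w -> Cmod (u k w - l w)%C < eps).

Definition locally_uniform_lim_infty (U : C -> Prop) (u : nat -> C -> C) : Prop :=
  forall z : C, U z ->
    exists V : C -> Prop, locally z V /\
      forall M : R,
        eventually (fun k => forall w, U w -> V w -> M < Cmod (u k w)).

(* [s] is an arbitrary sequence of members of the family [F], possibly with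
   repetitions. *)
Definition normal_family {I : Type} (U : C -> Prop) (F : I -> C -> C) : Prop :=
  forall s : nat -> I,
    exists phi : nat -> nat,
      (forall k, (phi k < phi (S k))%nat) /\
      ((exists l : C -> C, locally_uniform_lim U (fun k => F (s (phi k))) l) \/
       locally_uniform_lim_infty U (fun k => F (s (phi k)))).

(* [normal_family] lets a limit be infinite only on the whole of [U].  This is
   the usual notion for connected [U]; in general it does not affect the Fatou
   set, because [U] may be shrunk to a disc around [z]. *)
Definition Fatou (f : C -> C) (z : C) : Prop :=
  exists U : C -> Prop,
    open U /\ U z /\ normal_family U (fun (m : nat) => Nat.iter m f).

Definition hyperbolic (f : C -> C) : Prop :=
  compact_set (postsingular f) /\
  (forall z : C, postsingular f z -> Fatou f z).

(* The semigroup [g_0, ..., g_{n-1}]: all compositions of at least one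
   generator. *)
Inductive semigroup (n : nat) (g : nat -> C -> C) : (C -> C) -> Prop :=
| semigroup_gen (i : nat) : (i < n)%nat -> semigroup n g (g i)
| semigroup_comp (u v : C -> C) :
    semigroup n g u -> semigroup n g v -> semigroup n g (fun z => u (v z)).

Definition hyperbolic_semigroup (G : (C -> C) -> Prop) : Prop :=
  forall f : C -> C, G f -> hyperbolic f.

(* Main.v *)
(* Every singular value of a composition u o v is a singular value of u or the
   u-image of one of v.  By commutation and the hypothesis on the sets Sing, the
   union E of the sets P(g_j) is therefore a closed invariant set containing
   P(f), for every f in the semigroup; compactness of P(f) follows.

   For the Fatou part, fix z in P(g_j) and an element f of the semigroup.  The set of
   points at which all iterates of g_j are bounded by a fixed constant is
   mapped by f^m into a set of the same kind, and it contains a disc of fixed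
   radius around f^m(z).  Such sets have no holes: if h is entire and
   a closed curve in {|h| <= M} winds around a, then |h(a)| <= M.  Hence a branch s of
   sqrt(f^m - a), with a outside the set, omits a disc around -s(z), and the
   Cauchy estimate for 1/(s + s(z)) bounds f^m near z uniformly in m.  Points a
   exist within a fixed disc because the iterates of a transcendental g_j are not
   locally bounded everywhere: by the same square root argument the hull of
   g_j({|z| < r}) contains {|z| <= 2r} for large r, since otherwise g_j would
   grow at most linearly. *)

Require Import Defs.
From Stdlib Require Import Reals.
From Coquelicot Require Import Coquelicot.
From Stdlib Require Import Lra Lia Psatz ClassicalEpsilon List Wf_nat.

Open Scope R_scope.

(** What commutation transfers from g_j to f is boundedness rather than normality: |g_j^k(f^m(y))| =
    |f^m(g_j^k(y))| is bounded in k as soon as the g_j-orbit of y is bounded. This bound depends on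
    m, which is harmless: the distortion estimate for f^m involves only the distance from f^m(z) to
    a point a outside the set and the radius of a disc around f^m(z) inside it. Both are controlled
    independently of m. The radius is, because P(g_j) is compact, mapped into itself by f and
    contained in F(g_j). The point a is, because for every bound M some iterate of g_j exceeds M
    inside one fixed disc. Since the iterate may be chosen after m and M, the sets in question can
    be taken of the simple form {|P| <= M} with the single entire function P = g_j^k. Cauchy's
    theory is needed on discs only and is built up from Goursat's theorem. *)

(** * Moduli and algebra of complex numbers *)

Lemma Cmod_sym (x y : C) : Cmod (x - y) = Cmod (y - x).
Proof. rewrite <- Cmod_opp; f_equal; ring. Qed.

Lemma Cmod_le_sum (x y z : C) : x = (y + z)%C -> Cmod x <= Cmod y + Cmod z.
Proof. intros ->; apply Cmod_triangle. Qed.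

Lemma Cmod_sub_triangle (x y z : C) : Cmod (x - z) <= Cmod (x - y) + Cmod (y - z).
Proof. apply Cmod_le_sum; ring. Qed.

Lemma Cmod_le_add (x y : C) : Cmod x <= Cmod (x - y) + Cmod y.
Proof. apply Cmod_le_sum; ring. Qed.

Lemma Cmod_le_0 (x : C) : Cmod x <= 0 -> x = 0.
Proof. intros H; apply Cmod_eq_0; pose proof (Cmod_ge_0 x); lra. Qed.

Lemma Cmod_pos (x : C) : x <> 0 -> 0 < Cmod x.
Proof. apply Cmod_gt_0. Qed.

Lemma C_sub_neq_0 (x y : C) : x <> y -> (x - y)%C <> 0.
Proof.
intros H E; apply H; replace x with ((x - y) + y)%C by ring; rewrite E; ring.
Qed.

Lemma C_sub_eq_0 (x y : C) : (x - y)%C = 0 -> x = y.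
Proof. intros E; replace x with ((x - y) + y)%C by ring; rewrite E; ring. Qed.

Lemma C_mult_integral (x y : C) : (x * y)%C = 0 -> x = 0 \/ y = 0.
Proof.
intros H; destruct (classic (x = 0)) as [|Hx]; [now left|right].
replace y with (/ x * (x * y))%C by (field; exact Hx); rewrite H; ring.
Qed.

(* [e] is the embedding of the domain into [C]: the identity for functions of a
   complex variable, [RtoC] for curves; both calculi are thus developed at once. *)
Definition cont_at {T : Type} (e : T -> C) (f : T -> C) (x : T) : Prop :=
  forall eps : R, 0 < eps -> exists delta : R, 0 < delta /\
    forall y : T, Cmod (e y - e x) < delta -> Cmod (f y - f x) < eps.

Definition deriv_at {T : Type} (e : T -> C) (f : T -> C) (x : T) (l : C) : Prop :=
  forall eps : R, 0 < eps -> exists delta : R, 0 < delta /\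
    forall y : T, Cmod (e y - e x) < delta ->
      Cmod (f y - f x - l * (e y - e x)) <= eps * Cmod (e y - e x).

Notation ccont := (cont_at (fun z : C => z)).
Notation cderiv := (deriv_at (fun z : C => z)).
Notation rcont := (cont_at RtoC).
Notation rderiv := (deriv_at RtoC).

(** * Epsilon-delta calculus *)

(** Error bounds may carry a fixed factor [K], and [eps] may be assumed at most 1, so that products
    of small terms are absorbed. The rules of calculus then need no tuning of epsilons. *)
Lemma cont_at_scaled {T} (e f : T -> C) x (K : R) :
  (forall eps, 0 < eps <= 1 -> exists delta, 0 < delta /\
    forall y, Cmod (e y - e x) < delta -> Cmod (f y - f x) <= K * eps) ->
  cont_at e f x.
Proof.
intros H eps He.
assert (HK : 0 < Rabs K + 1) by (pose proof (Rabs_pos K); lra).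
set (eps' := Rmin 1 (eps / (2 * (Rabs K + 1)))).
assert (He1 : 0 < eps / (2 * (Rabs K + 1))) by (apply Rdiv_lt_0_compat; lra).
assert (He' : 0 < eps' <= 1).
{ unfold eps'; split; [apply Rmin_glb_lt; lra | apply Rmin_l]. }
destruct (H eps' He') as [d [Hd Hb]]; exists d; split; [exact Hd|].
intros y Hy; eapply Rle_lt_trans; [now apply Hb|].
assert (eps' <= eps / (2 * (Rabs K + 1))) by apply Rmin_r.
apply Rle_lt_trans with ((Rabs K + 1) * (eps / (2 * (Rabs K + 1)))).
- pose proof (Rle_abs K); nra.
- replace ((Rabs K + 1) * (eps / (2 * (Rabs K + 1)))) with (eps / 2) by (field; lra); lra.
Qed.

Lemma deriv_at_scaled {T} (e f : T -> C) x l (K : R) :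
  (forall eps, 0 < eps <= 1 -> exists delta, 0 < delta /\
    forall y, Cmod (e y - e x) < delta ->
      Cmod (f y - f x - l * (e y - e x)) <= K * eps * Cmod (e y - e x)) ->
  deriv_at e f x l.
Proof.
intros H eps He.
assert (HK : 0 < Rabs K + 1) by (pose proof (Rabs_pos K); lra).
set (eps' := Rmin 1 (eps / (Rabs K + 1))).
assert (He1 : 0 < eps / (Rabs K + 1)) by (apply Rdiv_lt_0_compat; lra).
assert (He' : 0 < eps' <= 1).
{ unfold eps'; split; [apply Rmin_glb_lt; lra | apply Rmin_l]. }
destruct (H eps' He') as [d [Hd Hb]]; exists d; split; [exact Hd|].
intros y Hy; eapply Rle_trans; [now apply Hb|].
apply Rmult_le_compat_r; [apply Cmod_ge_0|].
assert (eps' <= eps / (Rabs K + 1)) by apply Rmin_r.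
apply Rle_trans with ((Rabs K + 1) * (eps / (Rabs K + 1))).
- pose proof (Rle_abs K); nra.
- right; field; lra.
Qed.

Lemma deriv_cont {T} (e f : T -> C) x l : deriv_at e f x l -> cont_at e f x.
Proof.
intros H; apply (cont_at_scaled e f x (1 + Cmod l)); intros eps He.
destruct (H 1 Rlt_0_1) as [d [Hd Hb]].
exists (Rmin d eps); split; [apply Rmin_glb_lt; lra|].
intros y Hy.
assert (Hy1 := Rlt_le_trans _ _ _ Hy (Rmin_l _ _)).
assert (Hy2 := Rlt_le_trans _ _ _ Hy (Rmin_r _ _)).
specialize (Hb y Hy1).
assert (H1 : Cmod (f y - f x) <=
  Cmod (f y - f x - l * (e y - e x)) + Cmod (l * (e y - e x))).
{ apply Cmod_le_sum; ring. }
rewrite Cmod_mult in H1.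
pose proof (Cmod_ge_0 l); pose proof (Cmod_ge_0 (e y - e x)); nra.
Qed.

Lemma deriv_ext_loc {T} (e f g : T -> C) x l (d : R) :
  0 < d -> (forall y, Cmod (e y - e x) < d -> f y = g y) ->
  deriv_at e f x l -> deriv_at e g x l.
Proof.
intros Hd He H eps Heps; destruct (H eps Heps) as [d' [Hd' Hb]].
exists (Rmin d d'); split; [apply Rmin_glb_lt; lra|].
intros y Hy.
rewrite <- (He y), <- (He x).
- apply Hb; eapply Rlt_le_trans; [apply Hy | apply Rmin_r].
- replace (e x - e x)%C with (RtoC 0) by ring; rewrite Cmod_0; lra.
- eapply Rlt_le_trans; [apply Hy | apply Rmin_l].
Qed.

Lemma deriv_ext {T} (e f g : T -> C) x l :
  (forall y, f y = g y) -> deriv_at e f x l -> deriv_at e g x l.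
Proof. intros H; apply (deriv_ext_loc e f g x l 1 Rlt_0_1); auto. Qed.

Lemma deriv_eq {T} (e f : T -> C) x l l' :
  l = l' -> deriv_at e f x l -> deriv_at e f x l'.
Proof. now intros ->. Qed.

Lemma deriv_const {T} (e : T -> C) c x : deriv_at e (fun _ => c) x 0.
Proof.
intros eps He; exists 1; split; [lra|]; intros y _.
replace (c - c - 0 * (e y - e x))%C with (RtoC 0) by ring; rewrite Cmod_0.
pose proof (Cmod_ge_0 (e y - e x)); nra.
Qed.

Lemma deriv_id {T} (e : T -> C) x : deriv_at e e x 1.
Proof.
intros eps He; exists 1; split; [lra|]; intros y _.
replace (e y - e x - 1 * (e y - e x))%C with (RtoC 0) by ring; rewrite Cmod_0.
pose proof (Cmod_ge_0 (e y - e x)); nra.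
Qed.

Lemma deriv_plus {T} (e f g : T -> C) x l m :
  deriv_at e f x l -> deriv_at e g x m ->
  deriv_at e (fun y => f y + g y)%C x (l + m).
Proof.
intros Hf Hg; apply (deriv_at_scaled _ _ _ _ 2); intros eps He.
destruct (Hf eps (proj1 He)) as [d1 [Hd1 H1]].
destruct (Hg eps (proj1 He)) as [d2 [Hd2 H2]].
exists (Rmin d1 d2); split; [apply Rmin_glb_lt; lra|]; intros y Hy.
specialize (H1 y (Rlt_le_trans _ _ _ Hy (Rmin_l _ _))).
specialize (H2 y (Rlt_le_trans _ _ _ Hy (Rmin_r _ _))).
eapply Rle_trans.
- apply (Cmod_le_sum _ (f y - f x - l * (e y - e x)) (g y - g x - m * (e y - e x))); ring.
- lra.
Qed.

Lemma deriv_mult {T} (e f g : T -> C) x l m :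
  deriv_at e f x l -> deriv_at e g x m ->
  deriv_at e (fun y => f y * g y)%C x (l * g x + f x * m).
Proof.
intros Hf Hg.
apply (deriv_at_scaled _ _ _ _ (Cmod (g x) + 1 + Cmod l + Cmod (f x))); intros eps He.
destruct (Hf eps (proj1 He)) as [d1 [Hd1 H1]].
destruct (Hg eps (proj1 He)) as [d2 [Hd2 H2]].
destruct (deriv_cont _ _ _ _ Hg eps (proj1 He)) as [d3 [Hd3 H3]].
exists (Rmin d1 (Rmin d2 d3)); split; [repeat apply Rmin_glb_lt; lra|]; intros y Hy.
specialize (H1 y (Rlt_le_trans _ _ _ Hy (Rmin_l _ _))).
assert (Hy' := Rlt_le_trans _ _ _ Hy (Rmin_r _ _)).
specialize (H2 y (Rlt_le_trans _ _ _ Hy' (Rmin_l _ _))).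
specialize (H3 y (Rlt_le_trans _ _ _ Hy' (Rmin_r _ _))).
set (h := (e y - e x)%C) in *.
assert (Hgy : Cmod (g y) <= Cmod (g x) + 1).
{ pose proof (Cmod_le_add (g y) (g x)); lra. }
eapply Rle_trans.
{ apply (Cmod_le_sum _ ((f y - f x - l * h) * g y)
    (l * h * (g y - g x) + f x * (g y - g x - m * h))); ring. }
eapply Rle_trans.
{ apply Rplus_le_compat_l, Cmod_triangle. }
rewrite !Cmod_mult.
pose proof (Cmod_ge_0 (f x)); pose proof (Cmod_ge_0 l); pose proof (Cmod_ge_0 h).
pose proof (Cmod_ge_0 (g y)).
assert (Cmod (f y - f x - l * h) * Cmod (g y) <= eps * Cmod h * (Cmod (g x) + 1)).
{ apply Rmult_le_compat; auto; apply Cmod_ge_0. }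
assert (Cmod l * Cmod h * Cmod (g y - g x) <= Cmod l * Cmod h * eps).
{ apply Rmult_le_compat_l; [nra | lra]. }
assert (Cmod (f x) * Cmod (g y - g x - m * h) <= Cmod (f x) * (eps * Cmod h)).
{ apply Rmult_le_compat_l; auto. }
lra.
Qed.

Lemma deriv_comp {T} (e f : T -> C) (F : C -> C) x l m :
  deriv_at e f x l -> cderiv F (f x) m ->
  deriv_at e (fun y => F (f y)) x (m * l).
Proof.
intros Hf HF.
apply (deriv_at_scaled _ _ _ _ (Cmod l + 1 + Cmod m)); intros eps He.
destruct (HF eps (proj1 He)) as [d1 [Hd1 H1]].
destruct (Hf eps (proj1 He)) as [d2 [Hd2 H2]].
destruct (deriv_cont _ _ _ _ Hf d1 Hd1) as [d3 [Hd3 H3]].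
exists (Rmin d2 d3); split; [repeat apply Rmin_glb_lt; lra|]; intros y Hy.
specialize (H2 y (Rlt_le_trans _ _ _ Hy (Rmin_l _ _))).
specialize (H3 y (Rlt_le_trans _ _ _ Hy (Rmin_r _ _))).
specialize (H1 (f y) H3).
set (h := (e y - e x)%C) in *.
assert (Hfy : Cmod (f y - f x) <= (Cmod l + 1) * Cmod h).
{ eapply Rle_trans.
  - apply (Cmod_le_sum _ (f y - f x - l * h) (l * h)); ring.
  - rewrite Cmod_mult; pose proof (Cmod_ge_0 h); nra. }
eapply Rle_trans.
{ apply (Cmod_le_sum _ (F (f y) - F (f x) - m * (f y - f x)) (m * (f y - f x - l * h))); ring. }
rewrite Cmod_mult.
pose proof (Cmod_ge_0 m); pose proof (Cmod_ge_0 h).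
assert (eps * Cmod (f y - f x) <= eps * ((Cmod l + 1) * Cmod h)) by nra.
assert (Cmod m * Cmod (f y - f x - l * h) <= Cmod m * (eps * Cmod h)).
{ apply Rmult_le_compat_l; auto. }
lra.
Qed.

Lemma deriv_Cinv (z : C) : z <> 0 -> cderiv (fun w => / w)%C z (- / (z * z)).
Proof.
intros Hz.
assert (Hm := Cmod_pos _ Hz).
apply (deriv_at_scaled _ _ _ _ (2 / (Cmod z * Cmod z * Cmod z))); intros eps He.
exists (Rmin (Cmod z / 2) eps); split; [apply Rmin_glb_lt; lra|]; intros w Hw.
assert (Hw1 := Rlt_le_trans _ _ _ Hw (Rmin_l _ _)).
assert (Hw2 := Rlt_le_trans _ _ _ Hw (Rmin_r _ _)).
assert (Hwm : Cmod z / 2 <= Cmod w).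
{ pose proof (Cmod_le_add z w); rewrite Cmod_sym in Hw1; lra. }
assert (Hw0 : w <> 0) by (apply Cmod_gt_0; lra).
replace (/ w - / z - - / (z * z) * (w - z))%C
  with ((w - z) * (w - z) / (z * z * w))%C by (field; auto).
rewrite Cmod_div by (repeat apply Cmult_neq_0; auto).
rewrite !Cmod_mult.
set (h := Cmod (w - z)) in *; assert (0 <= h) by apply Cmod_ge_0.
apply Rle_trans with (h * eps / (Cmod z * Cmod z * (Cmod z / 2))).
- apply Rmult_le_compat.
  + nra.
  + left; apply Rinv_0_lt_compat; repeat apply Rmult_lt_0_compat; lra.
  + nra.
  + apply Rinv_le_contravar; [repeat apply Rmult_lt_0_compat; lra|].
    apply Rmult_le_compat_l; nra.
- right; field; lra.
Qed.

Lemma deriv_inv {T} (e f : T -> C) x l :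
  f x <> 0 -> deriv_at e f x l ->
  deriv_at e (fun y => / f y)%C x (- / (f x * f x) * l).
Proof.
intros H0 H; apply (deriv_comp e f (fun w => / w)%C); auto; now apply deriv_Cinv.
Qed.

Lemma deriv_scal {T} (e f : T -> C) c x l :
  deriv_at e f x l -> deriv_at e (fun y => c * f y)%C x (c * l).
Proof.
intros H; eapply deriv_eq; [|apply deriv_mult; [apply deriv_const | apply H]]; cbv beta; ring.
Qed.

Lemma deriv_minus {T} (e f g : T -> C) x l m :
  deriv_at e f x l -> deriv_at e g x m ->
  deriv_at e (fun y => f y - g y)%C x (l - m).
Proof.
intros Hf Hg; apply (deriv_ext e (fun y => f y + (- (1)) * g y)%C); [intros; ring|].
eapply deriv_eq; [|apply deriv_plus; [apply Hf | apply deriv_scal, Hg]]; cbv beta; ring.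
Qed.

Lemma deriv_div {T} (e f g : T -> C) x l m :
  g x <> 0 -> deriv_at e f x l -> deriv_at e g x m ->
  deriv_at e (fun y => f y / g y)%C x ((l * g x - f x * m) / (g x * g x)).
Proof.
intros H0 Hf Hg; eapply deriv_eq.
2:{ apply deriv_mult; [apply Hf | apply deriv_inv; [exact H0 | apply Hg]]. }
cbv beta; field; exact H0.
Qed.

Lemma deriv_pow {T} (e f : T -> C) x l n :
  deriv_at e f x l -> exists m, deriv_at e (fun y => f y ^ n)%C x m.
Proof.
intros H; induction n as [|n [m IH]].
- exists 0; exact (deriv_const e 1 x).
- eexists; apply (deriv_mult e f (fun y => f y ^ n)%C); eauto.
Qed.

Lemma cont_const {T} (e : T -> C) c x : cont_at e (fun _ => c) x.
Proof. eapply deriv_cont, deriv_const. Qed.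

Lemma cont_comp {T} (e f : T -> C) (F : C -> C) x :
  cont_at e f x -> ccont F (f x) -> cont_at e (fun y => F (f y)) x.
Proof.
intros Hf HF eps He; destruct (HF eps He) as [d [Hd H1]].
destruct (Hf d Hd) as [d' [Hd' H2]]; exists d'; split; auto.
Qed.

Lemma cont_plus {T} (e f g : T -> C) x :
  cont_at e f x -> cont_at e g x -> cont_at e (fun y => f y + g y)%C x.
Proof.
intros Hf Hg; apply (cont_at_scaled _ _ _ 2); intros eps He.
destruct (Hf eps (proj1 He)) as [d1 [Hd1 H1]].
destruct (Hg eps (proj1 He)) as [d2 [Hd2 H2]].
exists (Rmin d1 d2); split; [apply Rmin_glb_lt; lra|]; intros y Hy.
specialize (H1 y (Rlt_le_trans _ _ _ Hy (Rmin_l _ _))).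
specialize (H2 y (Rlt_le_trans _ _ _ Hy (Rmin_r _ _))).
eapply Rle_trans.
- apply (Cmod_le_sum _ (f y - f x) (g y - g x)); ring.
- lra.
Qed.

Lemma cont_mult {T} (e f g : T -> C) x :
  cont_at e f x -> cont_at e g x -> cont_at e (fun y => f y * g y)%C x.
Proof.
intros Hf Hg; apply (cont_at_scaled _ _ _ (Cmod (g x) + 1 + Cmod (f x))); intros eps He.
destruct (Hf eps (proj1 He)) as [d1 [Hd1 H1]].
destruct (Hg eps (proj1 He)) as [d2 [Hd2 H2]].
exists (Rmin d1 d2); split; [apply Rmin_glb_lt; lra|]; intros y Hy.
specialize (H1 y (Rlt_le_trans _ _ _ Hy (Rmin_l _ _))).
specialize (H2 y (Rlt_le_trans _ _ _ Hy (Rmin_r _ _))).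
assert (Hgy : Cmod (g y) <= Cmod (g x) + 1).
{ pose proof (Cmod_le_add (g y) (g x)); lra. }
eapply Rle_trans.
{ apply (Cmod_le_sum _ ((f y - f x) * g y) (f x * (g y - g x))); ring. }
rewrite !Cmod_mult.
pose proof (Cmod_ge_0 (f x)); pose proof (Cmod_ge_0 (g y)).
assert (Cmod (f y - f x) * Cmod (g y) <= eps * (Cmod (g x) + 1)).
{ apply Rmult_le_compat; auto; try apply Cmod_ge_0; lra. }
assert (Cmod (f x) * Cmod (g y - g x) <= Cmod (f x) * eps).
{ apply Rmult_le_compat_l; lra. }
lra.
Qed.

Lemma cont_inv {T} (e f : T -> C) x :
  f x <> 0 -> cont_at e f x -> cont_at e (fun y => / f y)%C x.
Proof.
intros H0 H; apply (cont_comp e f (fun w => / w)%C); auto.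
eapply deriv_cont; now apply deriv_Cinv.
Qed.

Lemma cont_div {T} (e f g : T -> C) x :
  g x <> 0 -> cont_at e f x -> cont_at e g x -> cont_at e (fun y => f y / g y)%C x.
Proof. intros H0 Hf Hg; apply cont_mult; auto; now apply cont_inv. Qed.

Lemma cont_minus {T} (e f g : T -> C) x :
  cont_at e f x -> cont_at e g x -> cont_at e (fun y => f y - g y)%C x.
Proof.
intros Hf Hg; apply cont_plus; auto.
apply (cont_comp e g (fun w => - w)%C); auto.
intros eps He; exists eps; split; auto; intros y Hy.
replace (- y - - g x)%C with (- (y - g x))%C by ring; now rewrite Cmod_opp.
Qed.

Lemma cont_pow {T} (e f : T -> C) x n :
  cont_at e f x -> cont_at e (fun y => f y ^ n)%C x.
Proof.
intros H; induction n as [|n IH]; [exact (cont_const e 1 x)|].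
apply (cont_mult e f (fun y => f y ^ n)%C); auto.
Qed.

Lemma cont_ext_loc {T} (e f g : T -> C) x (d : R) :
  0 < d -> (forall y, Cmod (e y - e x) < d -> f y = g y) ->
  cont_at e f x -> cont_at e g x.
Proof.
intros Hd He H eps Heps; destruct (H eps Heps) as [d' [Hd' Hb]].
exists (Rmin d d'); split; [apply Rmin_glb_lt; lra|].
intros y Hy.
rewrite <- (He y), <- (He x).
- apply Hb; eapply Rlt_le_trans; [apply Hy | apply Rmin_r].
- replace (e x - e x)%C with (RtoC 0) by ring; rewrite Cmod_0; lra.
- eapply Rlt_le_trans; [apply Hy | apply Rmin_l].
Qed.

Lemma rderiv_line (a b : C) t : rderiv (fun t : R => a + t * b)%C t b.
Proof.
eapply deriv_eq; [|apply deriv_plus; [apply deriv_const |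
  apply (deriv_mult RtoC RtoC (fun _ => b)); [apply deriv_id | apply deriv_const]]].
cbv beta; ring.
Qed.

Lemma rcont_line (a b : C) t : rcont (fun t : R => a + t * b)%C t.
Proof. eapply deriv_cont, rderiv_line. Qed.

Lemma im_le_Cmod (c : C) : Rabs (Im c) <= Cmod c.
Proof. eapply Rle_trans; [apply Rmax_r | apply Rmax_Cmod]. Qed.

Lemma Cmod_RtoC_sub (s t : R) : Cmod (RtoC s - RtoC t) = Rabs (s - t).
Proof. now rewrite <- RtoC_minus, Cmod_R. Qed.

(** [L] is meant to be [Re] or [Im]. Additivity and |L z| <= |z| are what carries continuity over to
    real functions, whose Riemann integral is then used. *)
Lemma rcont_component (L : C -> R) (p : R -> C) (t : R) :
  (forall z w, L (z - w)%C = L z - L w) -> (forall z, Rabs (L z) <= Cmod z) ->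
  rcont p t -> continuous (fun s => L (p s)) t.
Proof.
intros HL HB H; apply filterlim_locally; intros eps.
destruct (H eps (cond_pos eps)) as [d [Hd Hb]].
exists (mkposreal d Hd); intros y Hy.
change (Rabs (L (p y) - L (p t)) < eps).
rewrite <- HL; eapply Rle_lt_trans; [apply HB|].
apply Hb; rewrite Cmod_RtoC_sub; exact Hy.
Qed.

Lemma rderiv_component (L : C -> R) (p : R -> C) (t : R) (l : C) :
  (forall z w, L (z - w)%C = L z - L w) -> (forall z, Rabs (L z) <= Cmod z) ->
  (forall z (x : R), L (z * x)%C = L z * x) ->
  rderiv p t l -> is_derive (fun s => L (p s)) t (L l).
Proof.
intros HL HB HS H; apply is_derive_Reals; intros eps He.
destruct (H (eps / 2)) as [d [Hd Hb]]; [lra|].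
exists (mkposreal d Hd); intros h Hh Hhd; simpl in Hhd.
specialize (Hb (t + h)); rewrite Cmod_RtoC_sub in Hb.
replace (t + h - t) with h in Hb by ring.
specialize (Hb Hhd).
replace (RtoC (t + h) - RtoC t)%C with (RtoC h) in Hb by (rewrite <- RtoC_minus; f_equal; ring).
apply (Rle_trans _ _ _ (HB _)) in Hb.
rewrite !HL, HS in Hb.
replace ((L (p (t + h)) - L (p t)) / h - L l) with ((L (p (t + h)) - L (p t) - L l * h) / h)
  by (field; exact Hh).
assert (0 < Rabs h) by now apply Rabs_pos_lt.
unfold Rdiv; rewrite Rabs_mult, Rabs_inv.
apply Rle_lt_trans with (eps / 2 * Rabs h * / Rabs h).
- apply Rmult_le_compat_r; [left; now apply Rinv_0_lt_compat | exact Hb].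
- rewrite Rmult_assoc, Rinv_r; lra.
Qed.

Lemma Re_sub (z w : C) : Re (z - w)%C = Re z - Re w. Proof. reflexivity. Qed.
Lemma Im_sub (z w : C) : Im (z - w)%C = Im z - Im w. Proof. reflexivity. Qed.
Lemma Re_mult_R (z : C) (x : R) : Re (z * x)%C = Re z * x.
Proof. destruct z; simpl; ring. Qed.
Lemma Im_mult_R (z : C) (x : R) : Im (z * x)%C = Im z * x.
Proof. destruct z; simpl; ring. Qed.

(** * Integrals over the unit interval *)

(** Continuity is two-sided even at 0 and 1: curves are defined on the whole line, so that one-sided
    limits never occur. *)
Definition cont01 (p : R -> C) : Prop := forall t, 0 <= t <= 1 -> rcont p t.

Lemma cont01_Re p t : cont01 p -> 0 <= t <= 1 -> continuous (fun s => Re (p s)) t.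
Proof. intros; apply (rcont_component Re); auto using Re_sub, re_le_Cmod. Qed.

Lemma cont01_Im p t : cont01 p -> 0 <= t <= 1 -> continuous (fun s => Im (p s)) t.
Proof. intros; apply (rcont_component Im); auto using Im_sub, im_le_Cmod. Qed.

Lemma ex_RInt_cont01 (f : R -> R) a b :
  (forall t, 0 <= t <= 1 -> continuous f t) -> 0 <= a <= 1 -> 0 <= b <= 1 -> ex_RInt f a b.
Proof.
intros H Ha Hb; apply (ex_RInt_continuous (V := R_CompleteNormedModule)); intros t Ht; apply H.
split; [eapply Rle_trans; [|apply Ht]; apply Rmin_glb; lra|].
eapply Rle_trans; [apply Ht|]; apply Rmax_lub; lra.
Qed.

Definition CInt (p : R -> C) : C :=
  (RInt (fun t => Re (p t)) 0 1, RInt (fun t => Im (p t)) 0 1).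

Lemma CInt_ext p q : (forall t, 0 <= t <= 1 -> p t = q t) -> CInt p = CInt q.
Proof.
intros H; unfold CInt; f_equal; apply RInt_ext; intros t Ht;
  rewrite Rmin_left, Rmax_right in Ht by lra; now rewrite H by lra.
Qed.

Lemma CInt_plus p q : cont01 p -> cont01 q ->
  CInt (fun t => p t + q t)%C = (CInt p + CInt q)%C.
Proof.
intros Hp Hq; unfold CInt; apply injective_projections; simpl.
- apply (RInt_plus (fun t => Re (p t)) (fun t => Re (q t)));
    apply ex_RInt_cont01; try lra; intros; now apply cont01_Re.
- apply (RInt_plus (fun t => Im (p t)) (fun t => Im (q t)));
    apply ex_RInt_cont01; try lra; intros; now apply cont01_Im.
Qed.

Lemma RInt_lin2 (f g : R -> R) (a b : R) :
  (forall t, 0 <= t <= 1 -> continuous f t) -> (forall t, 0 <= t <= 1 -> continuous g t) ->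
  RInt (fun t => a * f t + b * g t) 0 1 = a * RInt f 0 1 + b * RInt g 0 1.
Proof.
intros Hf Hg.
assert (Ef : ex_RInt f 0 1) by (apply ex_RInt_cont01; auto; lra).
assert (Eg : ex_RInt g 0 1) by (apply ex_RInt_cont01; auto; lra).
rewrite (RInt_plus (fun t => a * f t) (fun t => b * g t)).
- exact (f_equal2 Rplus (RInt_scal f 0 1 a Ef) (RInt_scal g 0 1 b Eg)).
- apply (ex_RInt_scal f 0 1 a Ef).
- apply (ex_RInt_scal g 0 1 b Eg).
Qed.

Lemma CInt_scal c p : cont01 p -> CInt (fun t => c * p t)%C = (c * CInt p)%C.
Proof.
intros Hp; unfold CInt; apply injective_projections; simpl.
- rewrite (RInt_ext _ (fun t => Re c * Re (p t) + - Im c * Im (p t))).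
  2:{ intros t _; unfold Re, Im; simpl; ring. }
  rewrite (RInt_lin2 (fun t => Re (p t)) (fun t => Im (p t))); intros;
    auto using cont01_Re, cont01_Im; unfold Re, Im; simpl; ring.
- rewrite (RInt_ext _ (fun t => Re c * Im (p t) + Im c * Re (p t))).
  2:{ intros t _; unfold Re, Im; simpl; ring. }
  rewrite (RInt_lin2 (fun t => Im (p t)) (fun t => Re (p t))); intros;
    auto using cont01_Re, cont01_Im; unfold Re, Im; simpl; ring.
Qed.

Lemma CInt_minus p q : cont01 p -> cont01 q ->
  CInt (fun t => p t - q t)%C = (CInt p - CInt q)%C.
Proof.
intros Hp Hq.
rewrite (CInt_ext _ (fun t => p t + (- (1)) * q t)%C) by (intros; ring).
rewrite CInt_plus, CInt_scal; auto; [ring|].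
intros t Ht; apply (cont_mult RtoC (fun _ => - (1))%C); [apply cont_const | auto].
Qed.

(* Multiply by the conjugate of the integral to reduce to the real case. *)
Lemma CInt_bound p M : cont01 p -> (forall t, 0 <= t <= 1 -> Cmod (p t) <= M) ->
  Cmod (CInt p) <= M.
Proof.
intros Hp HM.
assert (HM0 : 0 <= M).
{ eapply Rle_trans; [apply Cmod_ge_0 | apply (HM 0); lra]. }
destruct (Req_dec (Cmod (CInt p)) 0) as [E|E]; [lra|].
set (I := CInt p) in *.
assert (HI : 0 < Cmod I) by (pose proof (Cmod_ge_0 I); lra).
assert (K : Cmod I * Cmod I <= Cmod I * M).
{ assert (Hc : forall t, 0 <= t <= 1 ->
    continuous (fun t => Re I * Re (p t) + Im I * Im (p t)) t).
  { intros t Ht; apply (continuous_plus (fun t => Re I * Re (p t)) (fun t => Im I * Im (p t))).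
    - apply (continuous_scal_r (Re I) (fun t => Re (p t))); now apply cont01_Re.
    - apply (continuous_scal_r (Im I) (fun t => Im (p t))); now apply cont01_Im. }
  replace (Cmod I * Cmod I) with (RInt (fun t => Re I * Re (p t) + Im I * Im (p t)) 0 1).
  - replace (Cmod I * M) with (RInt (fun _ : R => Cmod I * M) 0 1).
    + apply RInt_le; [lra | apply ex_RInt_cont01; auto; lra | apply ex_RInt_const|].
      intros t Ht.
      apply Rle_trans with (Re (Cconj I * p t)%C).
      { right; unfold Re, Im; simpl; ring. }
      eapply Rle_trans; [apply Rle_abs|]; eapply Rle_trans; [apply re_le_Cmod|].
      rewrite Cmod_mult, Cmod_conj.
      apply Rmult_le_compat_l; [lra|]; apply HM; lra.
    + rewrite RInt_const; unfold scal; simpl; unfold mult; simpl; ring.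
  - rewrite (RInt_lin2 (fun t => Re (p t)) (fun t => Im (p t)));
      auto using cont01_Re, cont01_Im.
    change (Re I * Re I + Im I * Im I = Cmod I * Cmod I).
    generalize (Cmod2_alt I); simpl; lra. }
apply Rmult_le_reg_l with (Cmod I); lra.
Qed.

Lemma CInt_FTC (F p : R -> C) :
  (forall t, 0 <= t <= 1 -> rderiv F t (p t)) -> cont01 p ->
  CInt p = (F 1%R - F 0%R)%C.
Proof.
intros HF Hp; unfold CInt; apply injective_projections.
- apply is_RInt_unique.
  apply (is_RInt_derive (fun t => Re (F t)) (fun t => Re (p t)));
    intros t Ht; rewrite Rmin_left, Rmax_right in Ht by lra.
  + apply rderiv_component; auto using Re_sub, re_le_Cmod, Re_mult_R.
  + now apply cont01_Re.
- apply is_RInt_unique.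
  apply (is_RInt_derive (fun t => Im (F t)) (fun t => Im (p t)));
    intros t Ht; rewrite Rmin_left, Rmax_right in Ht by lra.
  + apply rderiv_component; auto using Im_sub, im_le_Cmod, Im_mult_R.
  + now apply cont01_Im.
Qed.

(** An affine substitution on each half of [0,1]. It yields the subdivision of a segment at its
    midpoint, on which the bisection of triangles rests. *)
Lemma RInt_halves (f : R -> R) : (forall t, 0 <= t <= 1 -> continuous f t) ->
  RInt f 0 1 = / 2 * RInt (fun t => f (/ 2 * t + 0)) 0 1 + / 2 * RInt (fun t => f (/ 2 * t + / 2)) 0 1.
Proof.
intros Hf.
assert (A : forall v, 0 <= v <= / 2 ->
  / 2 * RInt (fun t => f (/ 2 * t + v)) 0 1 = RInt f v (v + / 2)).
{ intros v Hv.
  assert (E : ex_RInt f (/ 2 * 0 + v) (/ 2 * 1 + v)) by (apply ex_RInt_cont01; auto; lra).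
  replace (RInt f v (v + / 2)) with (RInt f (/ 2 * 0 + v) (/ 2 * 1 + v)) by (f_equal; ring).
  rewrite <- (RInt_comp_lin f (/ 2) v 0 1 E).
  symmetry; apply (RInt_scal (fun t => f (/ 2 * t + v)) 0 1 (/ 2)).
  apply (ex_RInt_continuous (V := R_CompleteNormedModule)); intros t Ht; rewrite Rmin_left, Rmax_right in Ht by lra.
  apply (continuous_comp (fun t => / 2 * t + v) f); [|apply Hf; lra].
  apply (ex_derive_continuous (V := R_NormedModule) (fun t => / 2 * t + v)).
  auto_derive; exact I. }
rewrite !A by lra.
replace (0 + / 2) with (/ 2) by ring; replace (/ 2 + / 2) with 1 by field.
symmetry; apply (RInt_Chasles f 0 (/ 2) 1); apply ex_RInt_cont01; auto; lra.
Qed.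

Lemma CInt_halves p : cont01 p ->
  CInt p = ((CInt (fun t => p (/ 2 * t + 0)%R) + CInt (fun t => p (/ 2 * t + / 2)%R)) / 2)%C.
Proof.
intros Hp; unfold CInt; apply injective_projections; simpl.
- rewrite (RInt_halves (fun t => Re (p t))) by (intros; now apply cont01_Re); field.
- rewrite (RInt_halves (fun t => Im (p t))) by (intros; now apply cont01_Im); field.
Qed.

Lemma CInt_rev p : cont01 p -> CInt (fun t => p (1 - t)%R) = CInt p.
Proof.
assert (A : forall f : R -> R, (forall t, 0 <= t <= 1 -> continuous f t) ->
  RInt (fun t => f (1 - t)) 0 1 = RInt f 0 1).
{ intros f Hf.
  assert (E : ex_RInt f (- (1) * 0 + 1) (- (1) * 1 + 1)) by (apply ex_RInt_cont01; auto; lra).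
  pose proof (RInt_comp_lin f (- (1)) 1 0 1 E) as H.
  replace (- (1) * 0 + 1) with 1 in H by ring; replace (- (1) * 1 + 1) with 0 in H by ring.
  rewrite <- (opp_RInt_swap f 1 0) by (apply ex_RInt_cont01; auto; lra).
  rewrite <- H.
  rewrite <- (RInt_opp (V := R_CompleteNormedModule)).
  - apply RInt_ext; intros t _; unfold opp, scal; simpl; unfold mult; simpl.
    replace (- (1) * t + 1) with (1 - t) by ring; ring.
  - apply (ex_RInt_comp_lin f (- (1)) 1 0 1 E). }
intros Hp; unfold CInt; apply injective_projections; simpl.
- apply (A (fun t => Re (p t))); intros; now apply cont01_Re.
- apply (A (fun t => Im (p t))); intros; now apply cont01_Im.
Qed.

Lemma CInt_const c : CInt (fun _ => c) = c.
Proof.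
rewrite (CInt_FTC (fun t : R => 0 + t * c)%C).
- ring.
- intros; apply rderiv_line.
- intros t _; apply cont_const.
Qed.

(** * Convergence of complex sequences *)

Definition C_cv (u : nat -> C) (l : C) : Prop :=
  forall eps : R, 0 < eps -> exists N : nat, forall n, (N <= n)%nat -> Cmod (u n - l) < eps.

Lemma Cmod_le_components (z : C) : Cmod z <= Rabs (Re z) + Rabs (Im z).
Proof.
replace z with (RtoC (Re z) + Ci * RtoC (Im z))%C at 1.
- eapply Rle_trans; [apply Cmod_triangle|].
  rewrite Cmod_mult, !Cmod_R, Cmod_Ci; lra.
- destruct z; unfold Ci, Re, Im; apply injective_projections; simpl; ring.
Qed.

Lemma C_complete (u : nat -> C) :
  (forall eps : R, 0 < eps -> exists N : nat, forall n m,
     (N <= n)%nat -> (N <= m)%nat -> Cmod (u n - u m) < eps) ->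
  exists l, C_cv u l.
Proof.
intros H.
assert (A : forall L : C -> R, (forall z w, L (z - w)%C = L z - L w) ->
  (forall z, Rabs (L z) <= Cmod z) -> {l : R | Un_cv (fun n => L (u n)) l}).
{ intros L HL HB; apply Rcomplete.R_complete; intros eps He.
  destruct (H eps He) as [N HN]; exists N; intros n m Hn Hm.
  unfold Rdist; rewrite <- HL; eapply Rle_lt_trans; [apply HB | now apply HN]. }
destruct (A Re Re_sub re_le_Cmod) as [x Hx].
destruct (A Im Im_sub im_le_Cmod) as [y Hy].
exists (x, y); intros eps He.
destruct (Hx (eps / 2)) as [N1 H1]; [lra|].
destruct (Hy (eps / 2)) as [N2 H2]; [lra|].
exists (N1 + N2)%nat; intros n Hn.
eapply Rle_lt_trans; [apply Cmod_le_components|].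
specialize (H1 n ltac:(lia)); specialize (H2 n ltac:(lia)).
unfold Rdist in H1, H2.
rewrite Re_sub, Im_sub; unfold Re at 2, Im at 2; simpl; lra.
Qed.

Lemma pow_half_small (K eps : R) : 0 <= K -> 0 < eps ->
  exists N : nat, forall n, (N <= n)%nat -> K * (/ 2) ^ n < eps.
Proof.
intros HK He.
destruct (pow_lt_1_zero (/ 2) ltac:(rewrite Rabs_pos_eq; lra) (eps / (K + 1))) as [N HN].
{ apply Rdiv_lt_0_compat; lra. }
exists N; intros n Hn; specialize (HN n Hn).
assert (Hp : 0 < (/ 2) ^ n) by (apply pow_lt; lra).
rewrite Rabs_pos_eq in HN by lra.
apply Rle_lt_trans with ((K + 1) * (/ 2) ^ n); [nra|].
apply Rmult_lt_reg_r with (/ (K + 1)); [apply Rinv_0_lt_compat; lra|].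
replace ((K + 1) * (/ 2) ^ n * / (K + 1)) with ((/ 2) ^ n) by (field; lra); exact HN.
Qed.

(** * Goursat's theorem and primitives *)

Definition convex (X : C -> Prop) : Prop :=
  forall x y (t : R), X x -> X y -> 0 <= t <= 1 -> X (x + t * (y - x))%C.

Definition seq_closed (X : C -> Prop) : Prop :=
  forall u l, (forall n : nat, X (u n)) -> C_cv u l -> X l.

Lemma Cmod_convex (x y c : C) (t rho : R) :
  Cmod (x - c) <= rho -> Cmod (y - c) <= rho -> 0 <= t <= 1 ->
  Cmod (x + t * (y - x) - c) <= rho.
Proof.
intros Hx Hy Ht.
eapply Rle_trans.
{ apply (Cmod_le_sum _ (RtoC (1 - t) * (x - c)) (RtoC t * (y - c))).
  rewrite RtoC_minus; ring. }
rewrite !Cmod_mult, !Cmod_R, !Rabs_pos_eq by lra; nra.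
Qed.

Lemma convex_ball c R0 : convex (fun z => Cmod (z - c) < R0).
Proof.
intros x y t Hx Hy Ht.
eapply Rle_lt_trans.
- apply (Cmod_convex x y c t (Rmax (Cmod (x - c)) (Cmod (y - c)))); auto; [apply Rmax_l | apply Rmax_r].
- now apply Rmax_lub_lt.
Qed.

Lemma RtoC_half : RtoC (/ 2) = (/ 2)%C.
Proof. apply RtoC_inv; lra. Qed.

Lemma convex_mid X a b : convex X -> X a -> X b -> X ((a + b) / 2)%C.
Proof.
intros HX Ha Hb.
replace ((a + b) / 2)%C with (a + RtoC (/ 2) * (b - a))%C.
- apply HX; auto; lra.
- rewrite RtoC_half; field.
Qed.

Definition seg (f : C -> C) (a b : C) : C :=
  ((b - a) * CInt (fun t => f (a + t * (b - a))%C))%C.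

Definition tri (f : C -> C) (a b c : C) : C := (seg f a b + seg f b c + seg f c a)%C.

Lemma seg_cont01 X f a b : convex X -> (forall z, X z -> ccont f z) -> X a -> X b ->
  cont01 (fun t => f (a + t * (b - a))%C).
Proof.
intros HX Hf Ha Hb t Ht.
apply (cont_comp RtoC (fun t : R => a + t * (b - a))%C f).
- apply rcont_line.
- apply Hf, HX; auto.
Qed.

Lemma seg_rev X f a b : convex X -> (forall z, X z -> ccont f z) -> X a -> X b ->
  seg f b a = (- seg f a b)%C.
Proof.
intros HX Hf Ha Hb; unfold seg.
rewrite <- (CInt_rev (fun t => f (a + t * (b - a))%C)) by (now apply (seg_cont01 X)).
rewrite (CInt_ext (fun t => f (b + t * (a - b))%C) (fun t => f (a + RtoC (1 - t)%R * (b - a))%C)).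
- ring.
- intros t _; f_equal; rewrite RtoC_minus; ring.
Qed.

Lemma seg_mid X f a b : convex X -> (forall z, X z -> ccont f z) -> X a -> X b ->
  seg f a b = (seg f a ((a + b) / 2) + seg f ((a + b) / 2) b)%C.
Proof.
intros HX Hf Ha Hb; unfold seg.
rewrite (CInt_halves (fun t => f (a + t * (b - a))%C)) by (now apply (seg_cont01 X)).
rewrite (CInt_ext (fun t => f (a + RtoC (/ 2 * t + 0)%R * (b - a))%C)
  (fun t => f (a + t * ((a + b) / 2 - a))%C)).
2:{ intros t _; f_equal; rewrite RtoC_plus, RtoC_mult, RtoC_half; field. }
rewrite (CInt_ext (fun t => f (a + RtoC (/ 2 * t + / 2)%R * (b - a))%C)
  (fun t => f ((a + b) / 2 + t * (b - (a + b) / 2))%C)).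
2:{ intros t _; f_equal; rewrite RtoC_plus, RtoC_mult, RtoC_half; field. }
field.
Qed.

Lemma seg_FTC X f F a b : convex X -> (forall z, X z -> ccont f z) ->
  (forall z, X z -> cderiv F z (f z)) -> X a -> X b -> seg f a b = (F b - F a)%C.
Proof.
intros HX Hf HF Ha Hb; unfold seg.
assert (Hc := seg_cont01 X f a b HX Hf Ha Hb).
rewrite <- CInt_scal by exact Hc.
rewrite (CInt_FTC (fun t : R => F (a + t * (b - a))%C)).
- f_equal; [f_equal; ring | do 2 f_equal; ring].
- intros t Ht; eapply deriv_eq.
  2:{ apply (deriv_comp RtoC (fun t : R => a + t * (b - a))%C F).
      - apply rderiv_line.
      - apply HF, HX; auto. }
  cbv beta; ring.
- intros t Ht; apply (cont_mult RtoC (fun _ => b - a)%C); [apply cont_const | now apply Hc].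
Qed.

Lemma seg_minus X f g a b : convex X -> (forall z, X z -> ccont f z) ->
  (forall z, X z -> ccont g z) -> X a -> X b ->
  seg (fun z => f z - g z)%C a b = (seg f a b - seg g a b)%C.
Proof.
intros HX Hf Hg Ha Hb; unfold seg.
rewrite (CInt_minus (fun t => f (a + t * (b - a))%C) (fun t => g (a + t * (b - a))%C)).
- ring.
- now apply (seg_cont01 X).
- now apply (seg_cont01 X).
Qed.

Lemma seg_bound X f a b M : convex X -> (forall z, X z -> ccont f z) -> X a -> X b ->
  (forall t : R, 0 <= t <= 1 -> Cmod (f (a + t * (b - a))%C) <= M) ->
  Cmod (seg f a b) <= Cmod (b - a) * M.
Proof.
intros HX Hf Ha Hb HM; unfold seg; rewrite Cmod_mult.
apply Rmult_le_compat_l; [apply Cmod_ge_0|].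
apply CInt_bound; auto; now apply (seg_cont01 X).
Qed.

Lemma tri_split X f a b c : convex X -> (forall z, X z -> ccont f z) -> X a -> X b -> X c ->
  tri f a b c =
  (tri f a ((a + b) / 2) ((c + a) / 2) + tri f ((a + b) / 2) b ((b + c) / 2) +
   tri f ((c + a) / 2) ((b + c) / 2) c + tri f ((a + b) / 2) ((b + c) / 2) ((c + a) / 2))%C.
Proof.
intros HX Hf Ha Hb Hc; unfold tri.
pose proof (convex_mid X a b HX Ha Hb); pose proof (convex_mid X b c HX Hb Hc).
pose proof (convex_mid X c a HX Hc Ha).
rewrite (seg_mid X f a b), (seg_mid X f b c), (seg_mid X f c a) by auto.
rewrite (seg_rev X f ((a + b) / 2) ((c + a) / 2)) by auto.
rewrite (seg_rev X f ((a + b) / 2) ((b + c) / 2)) by auto.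
rewrite (seg_rev X f ((b + c) / 2) ((c + a) / 2)) by auto.
ring.
Qed.

Lemma Cmod_half (z : C) : Cmod (z / 2) = Cmod z / 2.
Proof.
rewrite Cmod_div.
- rewrite Cmod_R, Rabs_pos_eq; lra.
- intros E; apply (f_equal fst) in E; simpl in E; lra.
Qed.

Lemma Cmod_half_le (x y : C) d : Cmod y <= d -> x = (y / 2)%C -> Cmod x <= d / 2.
Proof. intros H ->; rewrite Cmod_half; lra. Qed.

Definition small_triangle (d : R) (T : C * C * C) : Prop :=
  let '(a, b, c) := T in Cmod (b - a) <= d /\ Cmod (c - b) <= d /\ Cmod (a - c) <= d.

Definition vertices_in (X : C -> Prop) (T : C * C * C) : Prop :=
  let '(a, b, c) := T in X a /\ X b /\ X c.

Definition triT (f : C -> C) (T : C * C * C) : C := let '(a, b, c) := T in tri f a b c.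

(** The integral over a triangle is the sum over its four midpoint triangles, so one of these
    carries at least a quarter of its modulus. The new triangle is chosen before [d] and hence
    depends on the old one alone; the bound on the displacement of the first vertex makes these
    vertices a Cauchy sequence. *)
Lemma triangle_bisect X f T : convex X -> (forall z, X z -> ccont f z) -> vertices_in X T ->
  exists T', vertices_in X T' /\ Cmod (triT f T) <= 4 * Cmod (triT f T') /\
    (forall d, small_triangle d T ->
       small_triangle (d / 2) T' /\ Cmod (fst (fst T') - fst (fst T)) <= d).
Proof.
destruct T as [[a b] c]; intros HX Hf [Ha [Hb Hc]].
assert (Hab := convex_mid X a b HX Ha Hb).
assert (Hbc := convex_mid X b c HX Hb Hc).
assert (Hca := convex_mid X c a HX Hc Ha).
pose proof (tri_split X f a b c HX Hf Ha Hb Hc) as E.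
assert (H4 : Cmod (tri f a b c) <= Cmod (tri f a ((a + b) / 2) ((c + a) / 2)) +
  Cmod (tri f ((a + b) / 2) b ((b + c) / 2)) + Cmod (tri f ((c + a) / 2) ((b + c) / 2) c) +
  Cmod (tri f ((a + b) / 2) ((b + c) / 2) ((c + a) / 2))).
{ rewrite E; do 3 (eapply Rle_trans; [apply Cmod_triangle|]; apply Rplus_le_compat_r).
  lra. }
assert (Hmid : forall x y z : C, ((x + y) / 2 - (z + y) / 2 = (x - z) / 2)%C) by (intros; field).
destruct (Rle_dec (Cmod (tri f a b c)) (4 * Cmod (tri f a ((a + b) / 2) ((c + a) / 2)))) as [C1|C1].
{ exists (a, (a + b) / 2, (c + a) / 2)%C; repeat split; auto;
    try (simpl in H; destruct H as [Sab [Sbc Sca]]).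
  - apply (Cmod_half_le _ (b - a)); auto; field.
  - apply (Cmod_half_le _ (c - b)); auto; field.
  - apply (Cmod_half_le _ (a - c)); auto; field.
  - simpl; replace (a - a)%C with (RtoC 0) by ring; rewrite Cmod_0.
    eapply Rle_trans; [apply Cmod_ge_0 | apply Sab]. }
destruct (Rle_dec (Cmod (tri f a b c)) (4 * Cmod (tri f ((a + b) / 2) b ((b + c) / 2)))) as [C2|C2].
{ exists ((a + b) / 2, b, (b + c) / 2)%C; repeat split; auto;
    try (simpl in H; destruct H as [Sab [Sbc Sca]]).
  - apply (Cmod_half_le _ (b - a)); auto; field.
  - apply (Cmod_half_le _ (c - b)); auto; field.
  - apply (Cmod_half_le _ (a - c)); auto; field.
  - simpl; assert (Cmod ((a + b) / 2 - a) <= d / 2) by (apply (Cmod_half_le _ (b - a)); auto; field).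
    pose proof (Cmod_ge_0 (b - a)); lra. }
destruct (Rle_dec (Cmod (tri f a b c)) (4 * Cmod (tri f ((c + a) / 2) ((b + c) / 2) c))) as [C3|C3].
{ exists ((c + a) / 2, (b + c) / 2, c)%C; repeat split; auto;
    try (simpl in H; destruct H as [Sab [Sbc Sca]]).
  - apply (Cmod_half_le _ (b - a)); auto; field.
  - apply (Cmod_half_le _ (c - b)); auto; field.
  - apply (Cmod_half_le _ (a - c)); auto; field.
  - simpl; assert (Cmod ((c + a) / 2 - a) <= d / 2).
    { apply (Cmod_half_le _ (c - a)); [rewrite Cmod_sym; auto | field]. }
    pose proof (Cmod_ge_0 (b - a)); lra. }
(* When the three corner triangles fail, [H4] leaves the middle one. *)
exists ((a + b) / 2, (b + c) / 2, (c + a) / 2)%C; repeat split; auto;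
  try (simpl in H; destruct H as [Sab [Sbc Sca]]).
- simpl; lra.
- apply (Cmod_half_le _ (c - a)); [rewrite Cmod_sym; auto | field].
- apply (Cmod_half_le _ (a - b)); [rewrite Cmod_sym; auto | field].
- apply (Cmod_half_le _ (b - c)); [rewrite Cmod_sym; auto | field].
- simpl; assert (Cmod ((a + b) / 2 - a) <= d / 2) by (apply (Cmod_half_le _ (b - a)); auto; field).
  pose proof (Cmod_ge_0 (b - a)); lra.
Qed.

(** The affine approximation [g] has a primitive, so its integral over the triangle vanishes and
    only the error f - g counts. Each of the 3 sides has length at most d, and the error on it is at
    most eps * 3d; hence the constant 9. *)
Lemma tri_affine_approx X f x l eps d a b c :
  convex X -> (forall z, X z -> ccont f z) -> X a -> X b -> X c -> X x ->
  0 <= eps -> small_triangle d (a, b, c) -> Cmod (a - x) <= 2 * d ->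
  (forall w, X w -> Cmod (w - x) <= 3 * d ->
     Cmod (f w - f x - l * (w - x)) <= eps * Cmod (w - x)) ->
  Cmod (tri f a b c) <= 9 * eps * (d * d).
Proof.
intros HX Hf Ha Hb Hc Hx He [Sab [Sbc Sca]] Hax Happ.
set (g := fun w => (f x + l * (w - x))%C).
set (F := fun w => (f x * (w - x) + l / 2 * ((w - x) * (w - x)))%C).
assert (Hder : forall w, cderiv (fun w => w - x)%C w 1).
{ intros w; eapply deriv_eq; [|apply deriv_minus; [apply deriv_id | apply deriv_const]].
  cbv beta; ring. }
assert (HF : forall w, cderiv F w (g w)).
{ intros w; unfold F, g; eapply deriv_eq.
  2:{ apply deriv_plus; apply deriv_scal; [apply Hder|].
      apply (deriv_mult _ (fun w => w - x)%C (fun w => w - x)%C); apply Hder. }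
  cbv beta; field. }
assert (Hg : forall w, ccont g w).
{ intros w; unfold g; apply (deriv_cont _ _ _ (0 + l * 1)).
  apply deriv_plus; [apply deriv_const | apply deriv_scal, Hder]. }
assert (Hfg : forall w, X w -> ccont (fun w => f w - g w)%C w).
{ intros w Hw; apply cont_minus; auto. }
assert (Hseg : forall u v, X u -> X v -> Cmod (u - x) <= 3 * d -> Cmod (v - x) <= 3 * d ->
  Cmod (v - u) <= d -> Cmod (seg (fun w => f w - g w)%C u v) <= d * (eps * (3 * d))).
{ intros u v Hu Hv Hux Hvx Huv.
  assert (0 <= d) by (pose proof (Cmod_ge_0 (v - u)); lra).
  eapply Rle_trans; [apply (seg_bound X _ u v (eps * (3 * d)))|]; auto.
  - intros t Ht.
    assert (Hw : X (u + t * (v - u))%C) by (apply HX; auto).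
    assert (Hwx : Cmod (u + t * (v - u) - x) <= 3 * d) by (apply Cmod_convex; auto).
    unfold g; eapply Rle_trans; [|eapply Rle_trans; [apply (Happ _ Hw Hwx)|]].
    + right; f_equal; ring.
    + apply Rmult_le_compat_l; auto.
  - apply Rmult_le_compat_r; [|exact Huv]. apply Rmult_le_pos; lra. }
assert (E : tri f a b c = tri (fun w => f w - g w)%C a b c).
{ unfold tri; rewrite !(seg_minus X f g) by auto.
  rewrite (seg_FTC X g F a b), (seg_FTC X g F b c), (seg_FTC X g F c a) by auto.
  ring. }
rewrite E; unfold tri.
assert (Hd : 0 <= d) by (pose proof (Cmod_ge_0 (b - a)); lra).
assert (Hbx : Cmod (b - x) <= 3 * d) by (pose proof (Cmod_sub_triangle b a x); lra).
assert (Hcx : Cmod (c - x) <= 3 * d).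
{ pose proof (Cmod_sub_triangle c a x); rewrite (Cmod_sym a c) in Sca; lra. }
assert (Hax' : Cmod (a - x) <= 3 * d) by lra.
pose proof (Hseg a b Ha Hb Hax' Hbx Sab); pose proof (Hseg b c Hb Hc Hbx Hcx Sbc).
pose proof (Hseg c a Hc Ha Hcx Hax' Sca).
eapply Rle_trans; [apply Cmod_triangle|].
eapply Rle_trans; [apply Rplus_le_compat_r, Cmod_triangle|]; lra.
Qed.

(** Bisection costs a factor 4 per step, while the integral over a triangle of size d * 2^-n is eps
    * O(4^-n): the powers cancel and eps remains. Closedness of [X] puts the common limit of the
    triangles into the region where [f] is differentiable. *)
Lemma goursat X f a b c : convex X -> seq_closed X ->
  (forall z, X z -> exists l, cderiv f z l) -> X a -> X b -> X c -> tri f a b c = 0.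
Proof.
intros HX HXc Hf Ha Hb Hc.
assert (Hfc : forall z, X z -> ccont f z).
{ intros z Hz; destruct (Hf z Hz) as [l Hl]; now apply deriv_cont in Hl. }
set (P := fun T T' => vertices_in X T' /\ Cmod (triT f T) <= 4 * Cmod (triT f T') /\
    (forall d, small_triangle d T ->
       small_triangle (d / 2) T' /\ Cmod (fst (fst T') - fst (fst T)) <= d)).
set (next := fun T => epsilon (inhabits T) (P T)).
assert (Hnext : forall T, vertices_in X T -> P T (next T)).
{ intros T HT; apply epsilon_spec; now apply triangle_bisect. }
set (T := fun n => Nat.iter n next (a, b, c)).
assert (HT : forall n, vertices_in X (T n)).
{ induction n as [|n IH]; [now repeat split | apply (Hnext _ IH)]. }
set (d := Cmod (b - a) + Cmod (c - b) + Cmod (a - c)).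
pose proof (Cmod_ge_0 (b - a)); pose proof (Cmod_ge_0 (c - b)); pose proof (Cmod_ge_0 (a - c)).
assert (Hd : 0 <= d) by (unfold d; lra).
assert (Hh : forall n, 0 < (/ 2) ^ n) by (intros; apply pow_lt; lra).
assert (HS : forall n, small_triangle (d * (/ 2) ^ n) (T n)).
{ induction n as [|n IH].
  - simpl; unfold d; repeat split; lra.
  - destruct (Hnext _ (HT n)) as [_ [_ K]]; destruct (K _ IH) as [K1 _].
    replace (d * (/ 2) ^ S n) with (d * (/ 2) ^ n / 2) by (simpl; field); exact K1. }
assert (HI : forall n, Cmod (tri f a b c) <= 4 ^ n * Cmod (triT f (T n))).
{ induction n as [|n IH]; [simpl; lra|].
  destruct (Hnext _ (HT n)) as [_ [K _]].
  eapply Rle_trans; [exact IH|].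
  change (triT f (T (S n))) with (triT f (next (T n))).
  assert (0 < 4 ^ n) by (apply pow_lt; lra); simpl; nra. }
set (u := fun n => fst (fst (T n))).
(* Sum of the displacements d * 2^-i for n <= i < n + k. *)
assert (Hu : forall n k, Cmod (u (n + k)%nat - u n) <= 2 * d * ((/ 2) ^ n - (/ 2) ^ (n + k))).
{ intros n; induction k as [|k IH].
  - rewrite Nat.add_0_r; replace (u n - u n)%C with (RtoC 0) by ring; rewrite Cmod_0; lra.
  - destruct (Hnext _ (HT (n + k)%nat)) as [_ [_ K]]; destruct (K _ (HS (n + k)%nat)) as [_ K1].
    rewrite Nat.add_succ_r.
    eapply Rle_trans; [apply (Cmod_sub_triangle _ (u (n + k)%nat))|].
    change (u (S (n + k))) with (fst (fst (next (T (n + k)%nat)))).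
    change (Cmod (fst (fst (next (T (n + k)%nat))) - u (n + k)%nat) <= d * (/ 2) ^ (n + k)) in K1.
    simpl pow; lra. }
assert (Hu' : forall n m, (n <= m)%nat -> Cmod (u m - u n) <= 2 * d * (/ 2) ^ n).
{ intros n m Hnm; replace m with (n + (m - n))%nat by lia.
  eapply Rle_trans; [apply Hu|]; pose proof (Hh (n + (m - n))%nat); nra. }
destruct (C_complete u) as [x Hx].
{ intros eps He; destruct (pow_half_small (2 * d) (eps / 2)) as [N HN]; [lra | lra |].
  exists N; intros n m Hn Hm.
  eapply Rle_lt_trans; [apply (Cmod_sub_triangle _ (u N))|].
  rewrite (Cmod_sym (u N)).
  pose proof (Hu' N n Hn); pose proof (Hu' N m Hm); pose proof (HN N (le_n N)); lra. }
assert (HXu : forall n, X (u n)).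
{ intros n; pose proof (HT n) as K; unfold u; destruct (T n) as [[? ?] ?]; apply K. }
assert (HXx : X x) by (apply (HXc u); auto).
assert (Hux : forall n, Cmod (u n - x) <= 2 * (d * (/ 2) ^ n)).
{ intros n; apply le_epsilon; intros eps He.
  destruct (Hx eps He) as [N HN].
  pose proof (HN (n + N)%nat ltac:(lia)); pose proof (Hu' n (n + N)%nat ltac:(lia)).
  pose proof (Cmod_sub_triangle (u n) (u (n + N)%nat) x) as Htr.
  rewrite (Cmod_sym (u n) (u (n + N)%nat)) in Htr; lra. }
destruct (Hf x HXx) as [l Hl].
apply Cmod_le_0, le_epsilon; intros e0 He0; rewrite Rplus_0_l.
(* The summand 1 covers the degenerate triangle with [d = 0]. *)
set (eps := e0 / (9 * (d * d) + 1)).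
assert (Hdd : 0 < 9 * (d * d) + 1) by nra.
assert (Heps : 0 < eps) by (now apply Rdiv_lt_0_compat).
destruct (Hl eps Heps) as [dl [Hdl Hb']].
destruct (pow_half_small (3 * d) dl) as [N HN]; [lra | lra |].
specialize (HN N (le_n N)).
eapply Rle_trans; [apply (HI N)|].
assert (K : Cmod (triT f (T N)) <= 9 * eps * (d * (/ 2) ^ N * (d * (/ 2) ^ N))).
{ pose proof (HT N) as HTN; pose proof (HS N) as HSN; pose proof (Hux N) as HuN.
  unfold u in HuN; destruct (T N) as [[a' b'] c']; destruct HTN as [Ha' [Hb'' Hc']].
  simpl in HuN.
  apply (tri_affine_approx X f x l eps (d * (/ 2) ^ N)); auto; [lra|].
  intros w _ Hw; apply Hb'; lra. }
apply Rle_trans with (4 ^ N * (9 * eps * (d * (/ 2) ^ N * (d * (/ 2) ^ N)))).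
{ apply Rmult_le_compat_l; [apply pow_le; lra | exact K]. }
replace (4 ^ N * (9 * eps * (d * (/ 2) ^ N * (d * (/ 2) ^ N)))) with
  (9 * eps * (d * d) * (4 ^ N * ((/ 2) ^ N * (/ 2) ^ N))) by ring.
rewrite <- !Rpow_mult_distr; replace (4 * (/ 2 * / 2)) with 1 by field; rewrite pow1.
apply Rle_trans with (eps * (9 * (d * d) + 1)); [nra|].
unfold eps; right; field; lra.
Qed.

(** The real part of (w - p) times the conjugate of u is the Euclidean inner product of w - p and u,
    so the set is a half plane. For s > 0 it does not contain p. *)
Lemma half_plane_closed (p u : C) (s : R) :
  seq_closed (fun w => s <= Re ((w - p) * Cconj u)%C).
Proof.
intros v l Hv Hl; apply Rnot_lt_le; intros Hlt.
destruct (Hl ((s - Re ((l - p) * Cconj u)%C) / (Cmod u + 1))) as [N HN].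
{ apply Rdiv_lt_0_compat; pose proof (Cmod_ge_0 u); lra. }
specialize (HN N (le_n N)); specialize (Hv N).
set (D := s - Re ((l - p) * Cconj u)%C) in *.
assert (H : D <= Cmod (v N - l) * Cmod u).
{ apply Rle_trans with (Re ((v N - l) * Cconj u)%C).
  - unfold D; replace ((v N - l) * Cconj u)%C with ((v N - p) * Cconj u - (l - p) * Cconj u)%C by ring.
    rewrite Re_sub; lra.
  - eapply Rle_trans; [apply Rle_abs|]; eapply Rle_trans; [apply re_le_Cmod|].
    rewrite Cmod_mult, Cmod_conj; lra. }
pose proof (Cmod_ge_0 u) as Hu.
assert (Cmod (v N - l) * (Cmod u + 1) < D).
{ apply Rlt_le_trans with (D / (Cmod u + 1) * (Cmod u + 1)).
  - apply Rmult_lt_compat_r; lra.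
  - right; field; lra. }
pose proof (Cmod_ge_0 (v N - l)); nra.
Qed.

Lemma half_plane_convex (p u : C) (s : R) :
  convex (fun w => s <= Re ((w - p) * Cconj u)%C).
Proof.
intros x y t Hx Hy Ht.
replace ((x + t * (y - x) - p) * Cconj u)%C
  with ((x - p) * Cconj u * RtoC (1 - t) - (- ((y - p) * Cconj u)) * t)%C
  by (rewrite RtoC_minus; ring).
rewrite Re_sub, Re_mult_R, Re_mult_R.
replace (Re (- ((y - p) * Cconj u))%C) with (- Re ((y - p) * Cconj u)%C) by reflexivity.
nra.
Qed.

Lemma closed_ball_closed (c : C) (rho : R) : seq_closed (fun w => Cmod (w - c) <= rho).
Proof.
intros v l Hv Hl; apply le_epsilon; intros eps He.
destruct (Hl eps He) as [N HN]; specialize (HN N (le_n N)); specialize (Hv N).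
rewrite Cmod_sym in HN.
pose proof (Cmod_sub_triangle l (v N) c); lra.
Qed.

Lemma Re_conj_self (u : C) : Re (u * Cconj u)%C = Cmod u * Cmod u.
Proof.
rewrite <- Cmod2_conj; simpl; ring_simplify.
unfold Re; simpl; ring.
Qed.

Lemma Cmod_RtoC_pos (x : R) : 0 <= x -> Cmod (RtoC x) = x.
Proof. intros; rewrite Cmod_R, Rabs_pos_eq; lra. Qed.

(* The triangle is reduced to triangles shrinking to the exceptional point [p]; the
   trapezoids cut off lie in half planes that avoid [p]. *)
Lemma tri_center f c rho p z z' :
  Cmod (p - c) <= rho -> Cmod (z - c) <= rho -> Cmod (z' - c) <= rho ->
  (forall w, Cmod (w - c) <= rho -> ccont f w) ->
  (forall w, Cmod (w - c) <= rho -> w <> p -> exists l, cderiv f w l) ->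
  z <> p -> Cmod (z' - z) <= Cmod (z - p) / 2 ->
  tri f p z z' = 0.
Proof.
intros Hp Hz Hz' Hfc Hfd Hzp Hzz.
set (B := fun w : C => Cmod (w - c) <= rho).
assert (HB : convex B) by (intros x y t Hx Hy Ht; now apply Cmod_convex).
set (h := fun n : nat => (/ 2) ^ n).
assert (Hh : forall n, 0 < h n <= 1).
{ intros n; unfold h; split; [apply pow_lt; lra|].
  rewrite <- (pow1 n); apply pow_incr; lra. }
set (m := fun (y : C) n => (p + h n * (y - p))%C).
assert (Hm : forall y n, B y -> B (m y n)).
{ intros y n Hy; apply HB; auto; pose proof (Hh n); lra. }
assert (Hmid : forall y n, ((p + m y n) / 2 = m y (S n))%C).
{ intros y n; unfold m, h; simpl pow; rewrite RtoC_mult, RtoC_half; field. }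
assert (Hmid' : forall y n, ((m y n + p) / 2 = m y (S n))%C).
{ intros y n; rewrite <- Hmid; f_equal; ring. }
set (u := (z - p)%C).
assert (Hu : 0 < Cmod u) by (apply Cmod_pos, C_sub_neq_0, Hzp).
set (s := Cmod u * Cmod u).
assert (Hdot : forall y n, Re ((m y n - p) * Cconj u)%C = Re ((y - p) * Cconj u)%C * h n).
{ intros y n; rewrite <- Re_mult_R; f_equal; unfold m; ring. }
assert (Hdz : Re ((z - p) * Cconj u)%C = s) by apply Re_conj_self.
(* As |z' - z| is at most half of |z - p|, the point z' stays on the side of p where z lies. *)
assert (Hdz' : s / 2 <= Re ((z' - p) * Cconj u)%C).
{ replace ((z' - p) * Cconj u)%C with ((z - p) * Cconj u - (z - z') * Cconj u)%C by ring.
  rewrite Re_sub, Hdz.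
  assert (Re ((z - z') * Cconj u)%C <= Cmod (z' - z) * Cmod u).
  { eapply Rle_trans; [apply Rle_abs|]; eapply Rle_trans; [apply re_le_Cmod|].
    rewrite Cmod_mult, Cmod_conj, Cmod_sym; lra. }
  assert (Cmod (z' - z) * Cmod u <= s / 2).
  { unfold s; apply Rle_trans with (Cmod u / 2 * Cmod u); [|lra].
    apply Rmult_le_compat_r; [lra | exact Hzz]. }
  lra. }
assert (Hstep : forall n, tri f p (m z n) (m z' n) = tri f p (m z (S n)) (m z' (S n))).
{ intros n.
  (* The level s * h n / 4 is dictated by the lowest vertex [m z' (S n)], whose inner product with u
     is at least (s / 2) * (h n / 2). *)
  set (X := fun w => B w /\ s * h n / 4 <= Re ((w - p) * Cconj u)%C).
  assert (HX : convex X).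
  { intros x y t [Hx1 Hx2] [Hy1 Hy2] Ht; split; [now apply HB|].
    now apply half_plane_convex. }
  assert (HXc : seq_closed X).
  { intros v l Hv Hl; split.
    - apply (closed_ball_closed c rho v); [intros k; apply Hv | exact Hl].
    - apply (half_plane_closed p u _ v); [intros k; apply Hv | exact Hl]. }
  assert (Hs : 0 < s * h n).
  { apply Rmult_lt_0_compat; [|apply Hh]. unfold s; nra. }
  assert (HXd : forall w, X w -> exists l, cderiv f w l).
  { intros w [Hw1 Hw2]; apply Hfd; auto; intros ->.
    replace ((p - p) * Cconj u)%C with (RtoC 0) in Hw2 by ring; simpl in Hw2; lra. }
  assert (HSn : h (S n) = h n / 2) by (unfold h; simpl; field).
  assert (X1 : X (m z n)) by (split; [auto | rewrite Hdot, Hdz; lra]).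
  assert (X2 : X (m z (S n))).
  { split; [auto | rewrite Hdot, Hdz, HSn; lra]. }
  assert (X3 : X (m z' n)).
  { split; [auto|]; rewrite Hdot; pose proof (Hh n); nra. }
  assert (X4 : X (m z' (S n))).
  { split; [auto|]; rewrite Hdot, HSn; pose proof (Hh n); nra. }
  pose proof (goursat X f (m z (S n)) (m z n) (m z' n) HX HXc HXd X2 X1 X3) as G1.
  pose proof (goursat X f (m z (S n)) (m z' n) (m z' (S n)) HX HXc HXd X2 X3 X4) as G2.
  (* The two triangles [G1] and [G2] fill the trapezoid between the levels n and n + 1. *)
  rewrite <- (Cplus_0_r (tri f p (m z (S n)) (m z' (S n)))), <- G1.
  rewrite <- (Cplus_0_r (_ + tri f (m z (S n)) (m z n) (m z' n))%C), <- G2.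
  unfold tri.
  rewrite (seg_mid B f p (m z n)), (seg_mid B f (m z' n) p), Hmid, Hmid' by auto.
  rewrite (seg_rev B f (m z (S n)) (m z' n)) by auto.
  rewrite (seg_rev B f (m z (S n)) (m z' (S n))) by auto.
  ring. }
assert (Hall : forall n, tri f p z z' = tri f p (m z n) (m z' n)).
{ induction n as [|n IH].
  - unfold m, h; simpl; f_equal; ring.
  - now rewrite IH. }
destruct (Hfc p Hp 1 Rlt_0_1) as [d [Hd Hfp]].
set (M := Cmod (f p) + 1).
assert (HM : 0 < M) by (unfold M; pose proof (Cmod_ge_0 (f p)); lra).
set (A := Cmod (z - p) + Cmod (z' - p)).
assert (HA : 0 <= A) by (unfold A; pose proof (Cmod_ge_0 (z - p)); pose proof (Cmod_ge_0 (z' - p)); lra).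
apply Cmod_le_0, le_epsilon; intros eps He; rewrite Rplus_0_l.
destruct (pow_half_small A (Rmin d (eps / (8 * M)))) as [N HN]; auto.
{ apply Rmin_glb_lt; auto; apply Rdiv_lt_0_compat; lra. }
specialize (HN N (le_n N)); fold (h N) in HN.
assert (HN1 := Rlt_le_trans _ _ _ HN (Rmin_l _ _)).
assert (HN2 := Rlt_le_trans _ _ _ HN (Rmin_r _ _)).
assert (Hmp : forall y, Cmod (y - p) <= A -> Cmod (m y N - p) <= A * h N).
{ intros y Hy; replace (m y N - p)%C with (h N * (y - p))%C by (unfold m; ring).
  rewrite Cmod_mult, Cmod_RtoC_pos; pose proof (Hh N); nra. }
assert (Hz1 : Cmod (m z N - p) <= A * h N).
{ apply Hmp; unfold A; pose proof (Cmod_ge_0 (z' - p)); lra. }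
assert (Hz2 : Cmod (m z' N - p) <= A * h N).
{ apply Hmp; unfold A; pose proof (Cmod_ge_0 (z - p)); lra. }
assert (Hz0 : Cmod (p - p) <= A * h N).
{ replace (p - p)%C with (RtoC 0) by ring; rewrite Cmod_0; pose proof (Hh N); nra. }
assert (Hseg : forall x y, B x -> B y -> Cmod (x - p) <= A * h N -> Cmod (y - p) <= A * h N ->
  Cmod (seg f x y) <= 2 * (A * h N) * M).
{ intros x y Hx Hy Hxp Hyp.
  eapply Rle_trans; [apply (seg_bound B f x y M); auto|].
  - intros t Ht.
    assert (Hw : Cmod (x + t * (y - x) - p) <= A * h N) by (apply Cmod_convex; auto).
    specialize (Hfp (x + t * (y - x))%C ltac:(lra)).
    pose proof (Cmod_le_add (f (x + t * (y - x))%C) (f p)); unfold M; lra.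
  - apply Rmult_le_compat_r; [lra|].
    pose proof (Cmod_sub_triangle y p x); rewrite (Cmod_sym p x) in H; lra. }
rewrite (Hall N); unfold tri.
eapply Rle_trans; [apply Cmod_triangle|].
eapply Rle_trans; [apply Rplus_le_compat_r, Cmod_triangle|].
pose proof (Hseg p (m z N) Hp (Hm z N Hz) Hz0 Hz1).
pose proof (Hseg (m z N) (m z' N) (Hm z N Hz) (Hm z' N Hz') Hz1 Hz2).
pose proof (Hseg (m z' N) p (Hm z' N Hz') Hp Hz2 Hz0).
assert (A * h N * (8 * M) <= eps).
{ apply Rle_trans with (eps / (8 * M) * (8 * M)).
  - apply Rmult_le_compat_r; [lra | left; exact HN2].
  - right; field; lra. }
nra.
Qed.

Lemma seg_approx X f z w eps : convex X -> (forall y, X y -> ccont f y) -> X z -> X w ->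
  (forall y, Cmod (y - z) <= Cmod (w - z) -> Cmod (f y - f z) <= eps) ->
  Cmod (seg f z w - f z * (w - z)) <= eps * Cmod (w - z).
Proof.
intros HX Hf Hz Hw Hd.
assert (E : seg (fun _ => f z) z w = (f z * (w - z))%C).
{ unfold seg; rewrite CInt_const; ring. }
rewrite <- E, <- (seg_minus X f (fun _ => f z)); auto; [|intros; apply cont_const].
rewrite Rmult_comm.
apply (seg_bound X (fun y => f y - f z)%C); auto.
- intros y Hy; apply cont_minus; auto using cont_const.
- intros t Ht; apply Hd.
  replace (z + t * (w - z) - z)%C with (t * (w - z))%C by ring.
  rewrite Cmod_mult, Cmod_RtoC_pos by lra; pose proof (Cmod_ge_0 (w - z)); nra.
Qed.

(** One point [p] is allowed where [f] is merely continuous, as is the case for a difference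
    quotient in the proof of Cauchy's formula. The primitive is based at this very point, so that
    only triangles with vertex [p] have to be considered. *)
Theorem seg_primitive (f : C -> C) (c p : C) (R0 : R) :
  Cmod (p - c) < R0 ->
  (forall z, Cmod (z - c) < R0 -> ccont f z) ->
  (forall z, Cmod (z - c) < R0 -> z <> p -> exists l, cderiv f z l) ->
  forall z, Cmod (z - c) < R0 -> cderiv (seg f p) z (f z).
Proof.
intros Hp Hfc Hfd z Hz.
set (B := fun w : C => Cmod (w - c) < R0).
assert (HB : convex B) by apply convex_ball.
set (rho := Rmax (Cmod (p - c)) ((Cmod (z - c) + R0) / 2)).
assert (Hrho : rho < R0) by (apply Rmax_lub_lt; lra).
assert (Hr1 : Cmod (p - c) <= rho) by apply Rmax_l.
assert (Hr2 : (Cmod (z - c) + R0) / 2 <= rho) by apply Rmax_r.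
assert (Hloc : exists d, 0 < d /\ forall w, Cmod (w - z) < d ->
  Cmod (w - c) <= rho /\ (seg f p w - seg f p z = seg f z w)%C).
{ destruct (classic (z = p)) as [->|Hzp].
  - exists ((R0 - Cmod (p - c)) / 2); split; [lra|]; intros w Hw; split.
    + pose proof (Cmod_sub_triangle w p c); lra.
    + replace (seg f p p) with (RtoC 0); [ring | unfold seg; ring].
  - assert (0 < Cmod (z - p)) by (apply Cmod_pos, C_sub_neq_0, Hzp).
    exists (Rmin (Cmod (z - p) / 2) ((R0 - Cmod (z - c)) / 2)); split.
    { apply Rmin_glb_lt; lra. }
    intros w Hw.
    assert (Hw1 := Rlt_le_trans _ _ _ Hw (Rmin_l _ _)).
    assert (Hw2 := Rlt_le_trans _ _ _ Hw (Rmin_r _ _)).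
    assert (Hwc : Cmod (w - c) <= rho) by (pose proof (Cmod_sub_triangle w z c); lra).
    split; [exact Hwc|].
    assert (T : tri f p z w = 0).
    { apply (tri_center f c rho); auto; try lra; intros v Hv; [apply Hfc | apply Hfd]; lra. }
    unfold tri in T.
    rewrite (seg_rev B f p w) in T by (unfold B; auto; lra).
    replace (seg f p w) with (seg f p z + seg f z w - (seg f p z + seg f z w + - seg f p w))%C by ring.
    rewrite T; ring. }
destruct Hloc as [d [Hd Hloc]].
intros eps He; destruct (Hfc z Hz eps He) as [d' [Hd' Hc]].
exists (Rmin d d'); split; [apply Rmin_glb_lt; lra|]; intros w Hw.
assert (Hw1 := Rlt_le_trans _ _ _ Hw (Rmin_l _ _)).
assert (Hw2 := Rlt_le_trans _ _ _ Hw (Rmin_r _ _)).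
destruct (Hloc w Hw1) as [Hwc ->].
apply (seg_approx B); auto; [unfold B; lra|].
intros y Hy; left; apply Hc; lra.
Qed.

(** * Cauchy's formula and its consequences *)

Definition cexp (z : C) : C := (exp (Re z) * cos (Im z), exp (Re z) * sin (Im z)).

Lemma cexp_plus z w : cexp (z + w) = (cexp z * cexp w)%C.
Proof.
unfold cexp; destruct z as [a b], w as [x y]; unfold Re, Im; simpl.
rewrite exp_plus, cos_plus, sin_plus.
apply injective_projections; simpl; ring.
Qed.

Lemma cexp_0 : cexp 0 = 1.
Proof. unfold cexp; simpl; rewrite exp_0, cos_0, sin_0; apply injective_projections; simpl; ring. Qed.

Lemma Cmod_cexp z : Cmod (cexp z) = exp (Re z).
Proof.
unfold Cmod, cexp; simpl fst; simpl snd.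
replace ((exp (Re z) * cos (Im z)) ^ 2 + (exp (Re z) * sin (Im z)) ^ 2) with (exp (Re z) ^ 2).
- apply sqrt_pow2; left; apply exp_pos.
- pose proof (sin2_cos2 (Im z)) as H; unfold Rsqr in H; simpl; nra.
Qed.

Lemma derivable_at_0 (f : R -> R) (l : R) : derivable_pt_lim f 0 l ->
  forall eps, 0 < eps -> exists d, 0 < d /\
    forall h, Rabs h < d -> Rabs (f h - f 0 - l * h) <= eps * Rabs h.
Proof.
intros H eps He; destruct (H eps He) as [[d Hd] Hb]; exists d; split; [exact Hd|].
intros h Hh; destruct (Req_dec h 0) as [->|H0].
- replace (f 0 - f 0 - l * 0) with 0 by ring; rewrite Rabs_R0; lra.
- specialize (Hb h H0 Hh); rewrite Rplus_0_l in Hb.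
  replace (f h - f 0 - l * h) with (((f h - f 0) / h - l) * h) by (field; exact H0).
  rewrite Rabs_mult; apply Rmult_le_compat_r; [apply Rabs_pos | lra].
Qed.

(** The addition formula reduces the claim to the point 0, where it follows from the real
    derivatives of exp, cos and sin. The constant 6 collects 3 * eps from the real part and 3 * eps
    from the imaginary part. *)
Lemma cderiv_cexp z : cderiv cexp z (cexp z).
Proof.
assert (H0 : cderiv cexp 0 1).
{ apply (deriv_at_scaled _ _ _ _ 6); intros eps [He He1].
  destruct (derivable_at_0 exp 1) with (eps := eps) as [d1 [Hd1 H1]]; auto.
  { rewrite <- exp_0; apply derivable_pt_lim_exp. }
  destruct (derivable_at_0 cos 0) with (eps := eps) as [d2 [Hd2 H2]]; auto.
  { replace 0 with (- sin 0) at 2 by (rewrite sin_0; ring); apply derivable_pt_lim_cos. }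
  destruct (derivable_at_0 sin 1) with (eps := eps) as [d3 [Hd3 H3]]; auto.
  { rewrite <- cos_0; apply derivable_pt_lim_sin. }
  (* The bound eps / 2 handles the product [x * sin y], which is not the error term of a
     derivative. *)
  exists (Rmin (eps / 2) (Rmin d1 (Rmin d2 d3))).
  split; [repeat apply Rmin_glb_lt; lra|].
  intros w Hw; replace (w - 0)%C with w in * by ring.
  rewrite cexp_0; destruct w as [x y].
  assert (Hx : Rabs x <= Cmod (x, y)) by apply (re_le_Cmod (x, y)).
  assert (Hy : Rabs y <= Cmod (x, y)) by apply (im_le_Cmod (x, y)).
  set (N := Cmod (x, y)) in *.
  assert (Hw0 := Rlt_le_trans _ _ _ Hw (Rmin_l _ _)).
  assert (Hw' := Rlt_le_trans _ _ _ Hw (Rmin_r _ _)).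
  assert (Hw1 := Rlt_le_trans _ _ _ Hw' (Rmin_l _ _)).
  assert (Hw'' := Rlt_le_trans _ _ _ Hw' (Rmin_r _ _)).
  assert (Hw2 := Rlt_le_trans _ _ _ Hw'' (Rmin_l _ _)).
  assert (Hw3 := Rlt_le_trans _ _ _ Hw'' (Rmin_r _ _)).
  specialize (H1 x ltac:(lra)); specialize (H2 y ltac:(lra)); specialize (H3 y ltac:(lra)).
  rewrite exp_0 in H1; rewrite cos_0 in H2; rewrite sin_0 in H3.
  eapply Rle_trans; [apply Cmod_le_components|].
  replace (Re (cexp (x, y) - 1 - 1 * (x, y))%C) with
    ((exp x - 1 - 1 * x) * cos y + (1 + x) * (cos y - 1 - 0 * y))
    by (unfold cexp, Re, Im; simpl; ring).
  replace (Im (cexp (x, y) - 1 - 1 * (x, y))%C) with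
    ((exp x - 1 - 1 * x) * sin y + (sin y - 0 - 1 * y) + x * sin y)
    by (unfold cexp, Re, Im; simpl; ring).
  assert (Hc : Rabs (cos y) <= 1) by (apply Rabs_le, COS_bound).
  assert (Hs : Rabs (sin y) <= 1) by (apply Rabs_le, SIN_bound).
  assert (HN : 0 <= N) by apply Cmod_ge_0.
  set (E := exp x - 1 - 1 * x) in *; set (Cy := cos y - 1 - 0 * y) in *.
  set (Sy := sin y - 0 - 1 * y) in *.
  assert (HE : Rabs E <= eps * N) by (eapply Rle_trans; [apply H1 | nra]).
  assert (HC : Rabs Cy <= eps * N) by (eapply Rle_trans; [apply H2 | nra]).
  assert (HS : Rabs Sy <= eps * N) by (eapply Rle_trans; [apply H3 | nra]).
  assert (Hsy : Rabs (sin y) <= 2 * N).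
  { replace (sin y) with (Sy + y) by (unfold Sy; ring).
    eapply Rle_trans; [apply Rabs_triang|]; nra. }
  assert (K1 : Rabs (E * cos y) <= eps * N).
  { rewrite Rabs_mult; pose proof (Rabs_pos E); pose proof (Rabs_pos (cos y)); nra. }
  assert (K2 : Rabs (E * sin y) <= eps * N).
  { rewrite Rabs_mult; pose proof (Rabs_pos E); pose proof (Rabs_pos (sin y)); nra. }
  assert (K3 : Rabs ((1 + x) * Cy) <= 2 * (eps * N)).
  { rewrite Rabs_mult; apply Rmult_le_compat; try apply Rabs_pos; auto.
    eapply Rle_trans; [apply Rabs_triang|]; rewrite Rabs_R1; lra. }
  assert (K4 : Rabs (x * sin y) <= eps * N).
  { rewrite Rabs_mult; apply Rle_trans with (eps / 2 * (2 * N)); [|lra].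
    apply Rmult_le_compat; try apply Rabs_pos; auto; lra. }
  pose proof (Rabs_triang (E * cos y) ((1 + x) * Cy)).
  pose proof (Rabs_triang (E * sin y + Sy) (x * sin y)).
  pose proof (Rabs_triang (E * sin y) Sy).
  nra. }
apply (deriv_ext _ (fun w => cexp z * cexp (w - z))%C).
{ intros w; rewrite <- cexp_plus; f_equal; ring. }
eapply deriv_eq.
2:{ apply deriv_scal, (deriv_comp _ (fun w => w - z)%C cexp).
    - apply deriv_minus; [apply deriv_id | apply deriv_const].
    - replace (z - z)%C with (RtoC 0) by ring; apply H0. }
ring.
Qed.

Definition circle (c : C) (r : R) (t : R) : C := (c + r * cexp (Ci * RtoC (2 * PI * t)))%C.

Lemma circle_cmod c r t : 0 <= r -> Cmod (circle c r t - c) = r.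
Proof.
intros Hr; unfold circle.
replace (c + r * cexp (Ci * RtoC (2 * PI * t)) - c)%C
  with (r * cexp (Ci * RtoC (2 * PI * t)))%C by ring.
rewrite Cmod_mult, Cmod_cexp, Cmod_RtoC_pos by exact Hr.
replace (Re (Ci * RtoC (2 * PI * t))%C) with 0 by (unfold Re; simpl; ring).
rewrite exp_0; ring.
Qed.

Lemma circle_closed c r : circle c r 1 = circle c r 0.
Proof.
unfold circle; do 2 f_equal; unfold cexp.
replace (Re (Ci * RtoC (2 * PI * 1))%C) with 0 by (unfold Re; simpl; ring).
replace (Im (Ci * RtoC (2 * PI * 1))%C) with (2 * PI) by (unfold Im; simpl; ring).
replace (Re (Ci * RtoC (2 * PI * 0))%C) with 0 by (unfold Re; simpl; ring).
replace (Im (Ci * RtoC (2 * PI * 0))%C) with 0 by (unfold Im; simpl; ring).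
now rewrite cos_2PI, sin_2PI, cos_0, sin_0.
Qed.

Definition two_pi_i : C := (Ci * RtoC (2 * PI))%C.

Lemma two_pi_i_neq_0 : two_pi_i <> 0.
Proof.
unfold two_pi_i; intros E; apply (f_equal snd) in E; simpl in E.
pose proof PI_RGT_0; lra.
Qed.

Lemma circle_deriv c r t : rderiv (circle c r) t (two_pi_i * (circle c r t - c)).
Proof.
unfold circle; eapply deriv_eq.
2:{ apply deriv_plus; [apply deriv_const|]; apply deriv_scal.
    apply (deriv_comp RtoC (fun t : R => Ci * RtoC (2 * PI * t))%C cexp); [|apply cderiv_cexp].
    apply deriv_scal.
    apply (deriv_ext _ (fun t : R => RtoC (2 * PI) * t)%C).
    { intros s; now rewrite <- RtoC_mult. }
    apply deriv_scal, (deriv_id RtoC). }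
unfold two_pi_i; ring.
Qed.

Lemma circle_cont c r t : rcont (circle c r) t.
Proof. eapply deriv_cont, circle_deriv. Qed.

(* [cav phi c r] is 1/(2 pi i) times the integral of [phi] over the circle of
   centre [c] and radius [r]. *)
Definition cav (phi : C -> C) (c : C) (r : R) : C :=
  CInt (fun t => phi (circle c r t) * (circle c r t - c))%C.

Definition circle_cont01 (phi : C -> C) c r : Prop := cont01 (fun t => phi (circle c r t)).

Lemma cav_cont01 phi c r : circle_cont01 phi c r ->
  cont01 (fun t => phi (circle c r t) * (circle c r t - c))%C.
Proof.
intros H t Ht; apply (cont_mult RtoC (fun t => phi (circle c r t))); auto.
apply (cont_minus RtoC (circle c r) (fun _ => c)); [apply circle_cont | apply cont_const].
Qed.

Lemma cav_ext phi psi c r : 0 <= r -> (forall z, Cmod (z - c) = r -> phi z = psi z) ->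
  cav phi c r = cav psi c r.
Proof. intros Hr H; apply CInt_ext; intros t _; now rewrite H by now apply circle_cmod. Qed.

Lemma cav_minus phi psi c r : circle_cont01 phi c r -> circle_cont01 psi c r ->
  cav (fun z => phi z - psi z)%C c r = (cav phi c r - cav psi c r)%C.
Proof.
intros H1 H2; unfold cav; rewrite <- CInt_minus by now apply cav_cont01.
apply CInt_ext; intros; ring.
Qed.

Lemma cav_scal k phi c r : circle_cont01 phi c r ->
  cav (fun z => k * phi z)%C c r = (k * cav phi c r)%C.
Proof.
intros H1; unfold cav; rewrite <- CInt_scal by now apply cav_cont01.
apply CInt_ext; intros; ring.
Qed.

Lemma cav_bound phi c r M : 0 <= r -> circle_cont01 phi c r ->
  (forall z, Cmod (z - c) = r -> Cmod (phi z) <= M) -> Cmod (cav phi c r) <= M * r.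
Proof.
intros Hr Hc HM; apply CInt_bound; [now apply cav_cont01|].
intros t _; rewrite Cmod_mult, circle_cmod by exact Hr.
apply Rmult_le_compat_r; auto; apply HM; now apply circle_cmod.
Qed.

(** Along the circle [F] has derivative [two_pi_i] times the integrand, and the circle is a closed
    curve. *)
Lemma cav_primitive F phi c r : 0 <= r -> circle_cont01 phi c r ->
  (forall z, Cmod (z - c) = r -> cderiv F z (phi z)) -> cav phi c r = 0.
Proof.
intros Hr Hc HF.
assert (E : (two_pi_i * cav phi c r)%C = 0).
{ unfold cav; rewrite <- CInt_scal by now apply cav_cont01.
  rewrite (CInt_FTC (fun t => F (circle c r t))).
  - rewrite circle_closed; ring.
  - intros t _; eapply deriv_eq.
    2:{ apply (deriv_comp RtoC (circle c r) F); [apply circle_deriv|].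
        apply HF; now apply circle_cmod. }
    ring.
  - intros t Ht; apply (cont_mult RtoC (fun _ => two_pi_i)); [apply cont_const|].
    now apply (cav_cont01 phi). }
apply C_mult_integral in E; destruct E as [E|E]; auto.
now apply two_pi_i_neq_0 in E.
Qed.

Lemma cav_center c r : 0 < r -> cav (fun z => / (z - c))%C c r = 1.
Proof.
intros Hr; unfold cav; rewrite (CInt_ext _ (fun _ => RtoC 1)); [apply CInt_const|].
intros t _; field; apply Cmod_gt_0; rewrite circle_cmod; lra.
Qed.

Lemma circle_cont01_of_cont phi c r : 0 <= r ->
  (forall z, Cmod (z - c) = r -> ccont phi z) -> circle_cont01 phi c r.
Proof.
intros Hr H t _; apply (cont_comp RtoC (circle c r) phi); [apply circle_cont|].
apply H; now apply circle_cmod.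
Qed.

Lemma cont01_bounded p : cont01 p -> exists M, 0 <= M /\ forall t, 0 <= t <= 1 -> Cmod (p t) <= M.
Proof.
intros Hp; destruct (continuity_ab_maj (fun t => Cmod (p t)) 0 1) as [t0 [H0 _]]; [lra| |].
- intros t Ht eps He; destruct (Hp t Ht eps He) as [d [Hd Hb]].
  exists d; split; [exact Hd|]; intros s [_ Hs]; simpl in Hs |- *; unfold Rdist in *.
  rewrite <- Cmod_RtoC_sub in Hs; specialize (Hb s Hs).
  apply Rabs_def1.
  + pose proof (Cmod_le_add (p s) (p t)); lra.
  + rewrite Cmod_sym in Hb; pose proof (Cmod_le_add (p t) (p s)); lra.
- exists (Cmod (p t0)); split; [apply Cmod_ge_0 | exact H0].
Qed.

(** Differentiation under the integral sign. A quadratic error bound for the kernel, uniform on the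
    circle, together with boundedness of [phi] there, does the work of a convergence theorem. *)
Lemma cav_kernel_deriv (phi k' : C -> C) (k : C -> C -> C) c r z d B :
  0 <= r -> 0 < d -> circle_cont01 phi c r ->
  (forall z', Cmod (z' - z) < d -> circle_cont01 (fun y => phi y * k y z')%C c r) ->
  circle_cont01 (fun y => phi y * k' y)%C c r ->
  (forall y z', Cmod (y - c) = r -> Cmod (z' - z) < d ->
     Cmod (k y z' - k y z - k' y * (z' - z)) <= B * (Cmod (z' - z) * Cmod (z' - z))) ->
  cderiv (fun z' => cav (fun y => phi y * k y z')%C c r) z (cav (fun y => phi y * k' y)%C c r).
Proof.
intros Hr Hd Hphi Hk Hk' Hest.
destruct (cont01_bounded _ Hphi) as [M [HM0 HM]].
assert (HMc : forall t, 0 <= t <= 1 -> Cmod (phi (circle c r t)) <= M) by auto.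
apply (deriv_at_scaled _ _ _ _ (M * Rabs B * r)); intros eps [He _].
exists (Rmin d eps); split; [apply Rmin_glb_lt; lra|]; intros z' Hz'.
assert (Hz1 := Rlt_le_trans _ _ _ Hz' (Rmin_l _ _)).
assert (Hz2 := Rlt_le_trans _ _ _ Hz' (Rmin_r _ _)).
assert (Hzz : Cmod (z - z) < d).
{ replace (z - z)%C with (RtoC 0) by ring; rewrite Cmod_0; exact Hd. }
assert (Hm : circle_cont01 (fun y => (z' - z) * (phi y * k' y))%C c r).
{ intros t Ht; apply (cont_mult RtoC (fun _ => z' - z)%C); [apply cont_const | now apply Hk']. }
assert (Hm2 : circle_cont01 (fun y => phi y * k y z' - phi y * k y z)%C c r).
{ intros t Ht; apply cont_minus; [now apply (Hk z') | now apply (Hk z)]. }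
rewrite <- (cav_minus (fun y => phi y * k y z')%C (fun y => phi y * k y z)%C) by auto.
rewrite Cmult_comm, <- cav_scal by auto.
rewrite <- cav_minus by auto.
unfold cav.
apply CInt_bound.
{ apply (cav_cont01 (fun y => phi y * k y z' - phi y * k y z - (z' - z) * (phi y * k' y))%C).
  intros t Ht; apply cont_minus; [now apply Hm2 | now apply Hm]. }
intros t Ht; rewrite Cmod_mult, circle_cmod by exact Hr.
set (y := circle c r t).
replace (phi y * k y z' - phi y * k y z - (z' - z) * (phi y * k' y))%C
  with (phi y * (k y z' - k y z - k' y * (z' - z)))%C by ring.
rewrite Cmod_mult.
assert (K := Hest y z' (circle_cmod c r t Hr) Hz1).
pose proof (Cmod_ge_0 (z' - z)) as Hh.
assert (K' : Cmod (k y z' - k y z - k' y * (z' - z)) <= Rabs B * (eps * Cmod (z' - z))).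
{ eapply Rle_trans; [exact K|]; apply Rle_trans with (Rabs B * (Cmod (z' - z) * Cmod (z' - z))).
  - apply Rmult_le_compat_r; [nra | apply Rle_abs].
  - apply Rmult_le_compat_l; [apply Rabs_pos | nra]. }
replace (M * Rabs B * r * eps * Cmod (z' - z)) with (M * (Rabs B * (eps * Cmod (z' - z))) * r) by ring.
apply Rmult_le_compat_r; [exact Hr|].
apply Rmult_le_compat; try apply Cmod_ge_0; [exact (HMc t Ht) | exact K'].
Qed.

Lemma Cmod_inv_le z d : 0 < d -> d <= Cmod z -> Cmod (/ z) <= / d.
Proof.
intros Hd Hz; rewrite Cmod_inv by (apply Cmod_gt_0; lra).
apply Rinv_le_contravar; lra.
Qed.

Lemma circle_away c r z y : Cmod (y - c) = r -> r - Cmod (z - c) <= Cmod (y - z).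
Proof. intros H; pose proof (Cmod_sub_triangle y z c); lra. Qed.

Lemma circle_neq c r z y : Cmod (y - c) = r -> Cmod (z - c) < r -> (y - z)%C <> 0.
Proof. intros H Hz; apply Cmod_gt_0; pose proof (circle_away c r z y H); lra. Qed.

(** All Cauchy kernels are written as powers of / (y - z), including the first power, so that a
    single continuity statement serves for the formula and for its derivatives. *)
Lemma circle_cont01_kernel phi c r z n : 0 <= r -> Cmod (z - c) < r -> circle_cont01 phi c r ->
  circle_cont01 (fun y => phi y * (/ (y - z)) ^ n)%C c r.
Proof.
intros Hr Hz Hphi t Ht; apply (cont_mult RtoC (fun t => phi (circle c r t))); [now apply Hphi|].
apply (cont_pow RtoC (fun t => / (circle c r t - z))%C).
apply (cont_inv RtoC (fun t => circle c r t - z)%C).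
- apply (circle_neq c r); auto; now apply circle_cmod.
- apply (cont_minus RtoC (circle c r) (fun _ => z)); [apply circle_cont | apply cont_const].
Qed.

Lemma cav_ball_margin c r z z' : Cmod (z - c) < r -> Cmod (z' - z) < (r - Cmod (z - c)) / 2 ->
  Cmod (z' - c) < r /\ forall y, Cmod (y - c) = r ->
    (r - Cmod (z - c)) / 2 <= Cmod (y - z) /\ (r - Cmod (z - c)) / 2 <= Cmod (y - z').
Proof.
intros Hz Hz'.
pose proof (Cmod_sub_triangle z' z c).
split; [lra|]; intros y Hy.
pose proof (circle_away c r z y Hy); pose proof (circle_away c r z' y Hy); lra.
Qed.

Lemma cauchy_kernel_deriv phi c r z : 0 <= r -> Cmod (z - c) < r -> circle_cont01 phi c r ->
  cderiv (fun z' => cav (fun y => phi y * (/ (y - z')) ^ 1)%C c r) z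
    (cav (fun y => phi y * (/ (y - z)) ^ 2)%C c r).
Proof.
intros Hr Hz Hphi.
set (d := (r - Cmod (z - c)) / 2); assert (Hd : 0 < d) by (unfold d; lra).
apply (cav_kernel_deriv phi (fun y => (/ (y - z)) ^ 2)%C (fun y z' => (/ (y - z')) ^ 1)%C
  c r z d (/ d * / d * / d)); auto.
- intros z' Hz'; apply circle_cont01_kernel; auto; apply (cav_ball_margin c r z z'); auto.
- apply circle_cont01_kernel; auto.
- intros y z' Hy Hz'; destruct (cav_ball_margin c r z z' Hz Hz') as [Hz'' Hm].
  destruct (Hm y Hy) as [H1 H2]; fold d in H1, H2.
  assert (N1 := circle_neq c r z y Hy Hz); assert (N2 := circle_neq c r z' y Hy Hz'').
  replace ((/ (y - z')) ^ 1 - (/ (y - z)) ^ 1 - (/ (y - z)) ^ 2 * (z' - z))%C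
    with ((z' - z) * (z' - z) * (/ (y - z) * / (y - z) * / (y - z')))%C
    by (simpl; field; auto).
  rewrite !Cmod_mult, Rmult_comm; apply Rmult_le_compat_r.
  { pose proof (Cmod_ge_0 (z' - z)); nra. }
  assert (A1 := Cmod_inv_le _ _ Hd H1); assert (A2 := Cmod_inv_le _ _ Hd H2).
  repeat apply Rmult_le_compat; auto; try apply Cmod_ge_0.
  apply Rmult_le_pos; apply Cmod_ge_0.
Qed.

Lemma cauchy_kernel_deriv2 phi c r z : 0 <= r -> Cmod (z - c) < r -> circle_cont01 phi c r ->
  cderiv (fun z' => cav (fun y => phi y * (/ (y - z')) ^ 2)%C c r) z
    (cav (fun y => phi y * (2 * (/ (y - z)) ^ 3))%C c r).
Proof.
intros Hr Hz Hphi.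
set (d := (r - Cmod (z - c)) / 2); assert (Hd : 0 < d) by (unfold d; lra).
apply (cav_kernel_deriv phi (fun y => 2 * (/ (y - z)) ^ 3)%C (fun y z' => (/ (y - z')) ^ 2)%C
  c r z d (3 * (/ d * / d * (/ d * / d)))); auto.
- intros z' Hz'; apply circle_cont01_kernel; auto; apply (cav_ball_margin c r z z'); auto.
- intros t Ht; apply (cont_ext_loc RtoC
    (fun t => 2 * (phi (circle c r t) * (/ (circle c r t - z)) ^ 3))%C _ t 1 Rlt_0_1).
  { intros; ring. }
  apply (cont_mult RtoC (fun _ => RtoC 2)); [apply cont_const|].
  now apply (circle_cont01_kernel phi c r z 3).
- intros y z' Hy Hz'; destruct (cav_ball_margin c r z z' Hz Hz') as [Hz'' Hm].
  destruct (Hm y Hy) as [H1 H2]; fold d in H1, H2.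
  assert (N1 := circle_neq c r z y Hy Hz); assert (N2 := circle_neq c r z' y Hy Hz'').
  set (u := (/ (y - z))%C); set (v := (/ (y - z'))%C).
  replace (v ^ 2 - u ^ 2 - 2 * u ^ 3 * (z' - z))%C
    with ((z' - z) * (z' - z) * (u * u * (v * v) + 2 * (u * u * (u * v))))%C
    by (unfold u, v; simpl; field; auto).
  rewrite Cmod_mult, (Rmult_comm (Cmod _)), Cmod_mult; apply Rmult_le_compat_r.
  { pose proof (Cmod_ge_0 (z' - z)); nra. }
  assert (A1 : Cmod u <= / d) by exact (Cmod_inv_le _ _ Hd H1).
  assert (A2 : Cmod v <= / d) by exact (Cmod_inv_le _ _ Hd H2).
  eapply Rle_trans; [apply Cmod_triangle|].
  rewrite !Cmod_mult, Cmod_RtoC_pos by lra.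
  pose proof (Cmod_ge_0 u); pose proof (Cmod_ge_0 v).
  assert (Cmod u * Cmod u * (Cmod v * Cmod v) <= / d * / d * (/ d * / d)).
  { repeat apply Rmult_le_compat; auto; apply Rmult_le_pos; auto. }
  assert (Cmod u * Cmod u * (Cmod u * Cmod v) <= / d * / d * (/ d * / d)).
  { repeat apply Rmult_le_compat; auto; apply Rmult_le_pos; auto. }
  lra.
Qed.

Lemma deriv_zero_const (G : C -> C) c R0 z :
  (forall w, Cmod (w - c) < R0 -> cderiv G w 0) -> Cmod (z - c) < R0 -> G z = G c.
Proof.
intros H Hz; apply C_sub_eq_0.
assert (H0 : 0 < R0) by (pose proof (Cmod_ge_0 (z - c)); lra).
transitivity (CInt (fun _ => RtoC 0)); [|apply CInt_const].
symmetry; rewrite (CInt_FTC (fun t : R => G (c + t * (z - c))%C)).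
- replace (c + 1%R * (z - c))%C with z by ring.
  now replace (c + 0%R * (z - c))%C with c by ring.
- intros t Ht; eapply deriv_eq.
  2:{ apply (deriv_comp RtoC (fun t : R => c + t * (z - c))%C G); [apply rderiv_line|].
      apply H, convex_ball; auto; replace (c - c)%C with (RtoC 0) by ring.
      now rewrite Cmod_0. }
  ring.
- intros t _; apply cont_const.
Qed.

Lemma Cmod_center_lt c r : 0 < r -> Cmod (c - c) < r.
Proof. intros; replace (c - c)%C with (RtoC 0) by ring; now rewrite Cmod_0. Qed.

(** The derivative in z is the integral of 1/(y - z)^2, which vanishes because -1/(y - z) is a
    primitive in y. Hence the value at the centre is taken throughout the disc. *)
Lemma cav_winding c r z : Cmod (z - c) < r -> cav (fun y => 1 * (/ (y - z)) ^ 1)%C c r = 1.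
Proof.
intros Hz; assert (Hr : 0 < r) by (pose proof (Cmod_ge_0 (z - c)); lra).
assert (H1 : circle_cont01 (fun _ => RtoC 1) c r) by (intros t _; apply cont_const).
rewrite (deriv_zero_const (fun z => cav (fun y => 1 * (/ (y - z)) ^ 1)%C c r) c r z); auto.
- transitivity (cav (fun y => / (y - c))%C c r); [|now apply cav_center].
  apply cav_ext; [lra|]; intros; simpl; ring.
- intros w Hw; eapply deriv_eq; [|apply (cauchy_kernel_deriv (fun _ => RtoC 1)); auto; lra].
  apply (cav_primitive (fun y => - (1) * / (y - w))%C); [lra| |].
  + apply (circle_cont01_kernel (fun _ => RtoC 1)); auto; lra.
  + intros y Hy; assert (N := circle_neq c r w y Hy Hw).
    eapply deriv_eq.
    2:{ apply deriv_scal, (deriv_inv _ (fun y => y - w)%C); [exact N|].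
        apply deriv_minus; [apply deriv_id | apply deriv_const]. }
    cbv beta; simpl; field; exact N.
Qed.

Definition holo (f : C -> C) (c : C) (R0 : R) : Prop :=
  forall z, Cmod (z - c) < R0 -> exists l, cderiv f z l.

Lemma holo_cont f c R0 z : holo f c R0 -> Cmod (z - c) < R0 -> ccont f z.
Proof. intros H Hz; destruct (H z Hz) as [l Hl]; now apply deriv_cont in Hl. Qed.

Lemma holo_circle f c R0 r : holo f c R0 -> 0 <= r < R0 -> circle_cont01 f c r.
Proof.
intros H Hr; apply circle_cont01_of_cont; [lra|]; intros z Hz.
apply (holo_cont f c R0); auto; lra.
Qed.

Lemma cderiv_unique f z l m : cderiv f z l -> cderiv f z m -> l = m.
Proof.
intros Hl Hm; apply C_sub_eq_0, Cmod_le_0, le_epsilon; intros eps He; rewrite Rplus_0_l.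
destruct (Hl (eps / 2)) as [d1 [Hd1 H1]]; [lra|].
destruct (Hm (eps / 2)) as [d2 [Hd2 H2]]; [lra|].
set (h := Rmin d1 d2 / 2).
assert (Hh : 0 < h) by (unfold h; pose proof (Rmin_glb_lt d1 d2 0 Hd1 Hd2); lra).
assert (Hh1 : h < d1) by (unfold h in *; pose proof (Rmin_l d1 d2); lra).
assert (Hh2 : h < d2) by (unfold h in *; pose proof (Rmin_r d1 d2); lra).
specialize (H1 (z + RtoC h)%C); specialize (H2 (z + RtoC h)%C).
replace (z + RtoC h - z)%C with (RtoC h) in * by ring.
rewrite Cmod_RtoC_pos in * by lra.
specialize (H1 Hh1); specialize (H2 Hh2).
assert (Cmod ((l - m) * h) <= eps * h).
{ eapply Rle_trans.
  - apply (Cmod_le_sum _ (f (z + h) - f z - m * h) (- (f (z + h) - f z - l * h)))%C; ring.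
  - rewrite Cmod_opp; lra. }
rewrite Cmod_mult, Cmod_RtoC_pos in H by lra.
apply Rmult_le_reg_r with h; lra.
Qed.

Lemma quotient_deriv f z y l : y <> z -> cderiv f y l ->
  exists m, cderiv (fun w => (f w - f z) / (w - z))%C y m.
Proof.
intros Hy Hl; eexists; apply deriv_div.
- now apply C_sub_neq_0.
- apply deriv_minus; [apply Hl | apply deriv_const].
- apply deriv_minus; [apply deriv_id | apply deriv_const].
Qed.

(** [l] fills the removable singularity at [z]; it is meant to be the derivative of [f] there. *)
Definition quotient (f : C -> C) (z l : C) (w : C) : C :=
  if excluded_middle_informative (w = z) then l else ((f w - f z) / (w - z))%C.

Lemma quotient_at f z l : quotient f z l z = l.
Proof. unfold quotient; destruct excluded_middle_informative; congruence. Qed.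

Lemma quotient_off f z l w : w <> z -> quotient f z l w = ((f w - f z) / (w - z))%C.
Proof. unfold quotient; destruct excluded_middle_informative; congruence. Qed.

Lemma quotient_spec f z l w : (f w - f z = (w - z) * quotient f z l w)%C.
Proof.
destruct (classic (w = z)) as [->|H]; [ring|].
rewrite quotient_off by exact H; field; now apply C_sub_neq_0.
Qed.

Lemma quotient_deriv_off f z l y m : y <> z -> cderiv f y m ->
  exists k, cderiv (quotient f z l) y k.
Proof.
intros Hy Hm; destruct (quotient_deriv f z y m Hy Hm) as [k Hk]; exists k.
apply (deriv_ext_loc _ (fun w => (f w - f z) / (w - z))%C _ y k (Cmod (y - z))); auto.
- now apply Cmod_pos, C_sub_neq_0.
- intros w Hw; rewrite quotient_off; auto; intros ->; rewrite Cmod_sym in Hw; lra.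
Qed.

Lemma quotient_cont_at f z l : cderiv f z l -> ccont (quotient f z l) z.
Proof.
intros Hl; apply (cont_at_scaled _ _ _ 1); intros eps [He _].
destruct (Hl eps He) as [d [Hd Hb]]; exists d; split; [exact Hd|]; intros y Hy.
rewrite quotient_at; destruct (classic (y = z)) as [->|H].
- rewrite quotient_at; replace (l - l)%C with (RtoC 0) by ring; rewrite Cmod_0; lra.
- rewrite quotient_off by exact H.
  assert (N := C_sub_neq_0 _ _ H); assert (Np := Cmod_pos _ N).
  replace ((f y - f z) / (y - z) - l)%C with ((f y - f z - l * (y - z)) / (y - z))%C
    by (field; exact N).
  rewrite Cmod_div by exact N; rewrite Rmult_1_l.
  apply Rmult_le_reg_r with (Cmod (y - z)); [exact Np|].
  unfold Rdiv; rewrite Rmult_assoc, Rinv_l, Rmult_1_r by lra; now apply Hb.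
Qed.

(** The difference quotient of [f] at z is continuous at z and differentiable elsewhere, so it has a
    primitive and its integral over the circle is 0. Splitting the quotient leaves f z times the
    integral of 1/(y - z), computed in [cav_winding]. *)
Theorem cauchy_formula f c R0 r z : holo f c R0 -> r < R0 -> Cmod (z - c) < r ->
  cav (fun y => f y * (/ (y - z)) ^ 1)%C c r = f z.
Proof.
intros Hf Hr Hz; assert (Hr0 : 0 < r) by (pose proof (Cmod_ge_0 (z - c)); lra).
destruct (Hf z ltac:(lra)) as [l Hl].
set (Q := quotient f z l).
assert (Hfc : circle_cont01 f c r) by (apply (holo_circle f c R0); auto; lra).
assert (HQc : forall y, Cmod (y - c) < R0 -> ccont Q y).
{ intros y Hy; destruct (classic (y = z)) as [->|Hyz]; [now apply quotient_cont_at|].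
  destruct (Hf y Hy) as [m Hm]; destruct (quotient_deriv_off f z l y m Hyz Hm) as [k Hk].
  now apply deriv_cont in Hk. }
assert (HF : forall y, Cmod (y - c) < R0 -> cderiv (seg Q z) y (Q y)).
{ apply seg_primitive; [lra | exact HQc |].
  intros y Hy Hyz; destruct (Hf y Hy) as [m Hm]; now apply (quotient_deriv_off f z l y m). }
assert (E : cav Q c r = 0).
{ apply (cav_primitive (seg Q z)); [lra | | ].
  - apply circle_cont01_of_cont; [lra|]; intros y Hy; apply HQc; lra.
  - intros y Hy; apply HF; lra. }
rewrite (cav_ext Q (fun y => f y * (/ (y - z)) ^ 1 - f z * (1 * (/ (y - z)) ^ 1))%C) in E.
- rewrite cav_minus, cav_scal in E.
  + rewrite (cav_winding c r z Hz) in E.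
    transitivity (f z * 1)%C; [now apply C_sub_eq_0 | ring].
  + apply (circle_cont01_kernel (fun _ => RtoC 1)); auto; [lra|]; intros t _; apply cont_const.
  + apply circle_cont01_kernel; auto; lra.
  + intros t Ht; apply (cont_mult RtoC (fun _ => f z)); [apply cont_const|].
    apply (circle_cont01_kernel (fun _ => RtoC 1) c r z 1); auto; [lra|].
    intros s _; apply cont_const.
- lra.
- intros y Hy; assert (N := circle_neq c r z y Hy Hz).
  unfold Q; rewrite quotient_off.
  + unfold Cpow; field; exact N.
  + intros ->; apply N; ring.
Qed.

(** Cauchy's formula can be differentiated twice under the integral sign. *)
Lemma holo_deriv f c R0 : holo f c R0 ->
  exists df, (forall z, Cmod (z - c) < R0 -> cderiv f z (df z)) /\ holo df c R0.
Proof.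
intros Hf.
set (df := fun z => epsilon (inhabits (RtoC 0)) (fun l => cderiv f z l)).
assert (Hdf : forall z, Cmod (z - c) < R0 -> cderiv f z (df z)).
{ intros z Hz; apply (epsilon_spec (inhabits (RtoC 0)) (fun l => cderiv f z l)), Hf, Hz. }
exists df; split; [exact Hdf|]; intros z Hz.
set (r := (Cmod (z - c) + R0) / 2).
assert (Hr : 0 <= r) by (unfold r; pose proof (Cmod_ge_0 (z - c)); lra).
assert (Hrc : circle_cont01 f c r) by (apply (holo_circle f c R0); auto; unfold r in *; lra).
assert (Hzr : Cmod (z - c) < r) by (unfold r; lra).
eexists; eapply (deriv_ext_loc _ _ _ _ _ (r - Cmod (z - c))); [lra| |
  now apply (cauchy_kernel_deriv2 f c r z)].
intros w Hw.
assert (Hwc : Cmod (w - c) < r) by (pose proof (Cmod_sub_triangle w z c); lra).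
apply (cderiv_unique f w); [|apply Hdf; unfold r in *; lra].
apply (deriv_ext_loc _ (fun w => cav (fun y => f y * (/ (y - w)) ^ 1)%C c r) _ _ _ (r - Cmod (w - c))).
- lra.
- intros v Hv; apply (cauchy_formula f c R0); auto; [unfold r in *; lra|].
  pose proof (Cmod_sub_triangle v w c); lra.
- now apply cauchy_kernel_deriv.
Qed.

Definition entireC (f : C -> C) : Prop := forall z, exists l, cderiv f z l.

Lemma entireC_holo f c r : entireC f -> holo f c r.
Proof. intros H z _; apply H. Qed.

Lemma entireC_cont f z : entireC f -> ccont f z.
Proof. intros H; destruct (H z) as [l Hl]; now apply deriv_cont in Hl. Qed.

Lemma entireC_comp f h : entireC f -> entireC h -> entireC (fun z => f (h z)).
Proof.
intros Hf Hh z; destruct (Hh z) as [l Hl]; destruct (Hf (h z)) as [m Hm].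
eexists; now apply (deriv_comp _ h f _ l m).
Qed.

Lemma entireC_iter f n : entireC f -> entireC (Nat.iter n f).
Proof.
intros Hf; induction n as [|n IH].
- intros z; eexists; apply (deriv_id (fun z : C => z)).
- apply (entireC_comp f (Nat.iter n f)); auto.
Qed.

(** Near v the quotient is the Cauchy integral of f(y)/(y - v), since 1/(y - w) - 1/(y - v) = (w -
    v)/((y - w)(y - v)). It is thus differentiable at v as well. *)
Lemma quotient_entire f v l : entireC f -> cderiv f v l -> entireC (quotient f v l).
Proof.
intros Hf Hl z; destruct (classic (z = v)) as [->|Hz].
2:{ destruct (Hf z) as [m Hm]; now apply (quotient_deriv_off f v l z m). }
set (phi := fun y => (f y * / (y - v))%C).
assert (Hfc : circle_cont01 f v 1) by (apply (holo_circle f v 2); [now apply entireC_holo | lra]).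
assert (Hphi : circle_cont01 phi v 1).
{ intros t Ht; apply (cont_mult RtoC (fun t => f (circle v 1 t))); [now apply Hfc|].
  apply (cont_inv RtoC (fun t => circle v 1 t - v)%C).
  - apply (circle_neq v 1); [apply circle_cmod; lra | apply Cmod_center_lt; lra].
  - apply (cont_minus RtoC (circle v 1) (fun _ => v)); [apply circle_cont | apply cont_const]. }
assert (Hv : Cmod (v - v) < 1) by (apply Cmod_center_lt; lra).
assert (Hf1 : forall w, Cmod (w - v) < 1 -> cav (fun y => f y * (/ (y - w)) ^ 1)%C v 1 = f w).
{ intros w Hw; apply (cauchy_formula f v 2); [now apply entireC_holo | lra | exact Hw]. }
eexists; eapply (deriv_ext_loc _ _ _ _ _ 1); [lra| |
  apply (cauchy_kernel_deriv phi v 1 v); auto; lra].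
intros w Hw; destruct (classic (w = v)) as [->|Hwv].
- rewrite quotient_at; apply (cderiv_unique f v); [|exact Hl].
  eapply deriv_eq.
  2:{ apply (deriv_ext_loc _ (fun w => cav (fun y => f y * (/ (y - w)) ^ 1)%C v 1) _ _ _ 1);
      [lra | intros; now apply Hf1 | apply cauchy_kernel_deriv; auto; lra]. }
  apply cav_ext; [lra|]; intros y Hy; unfold phi, Cpow; field.
  apply (circle_neq v 1); auto.
- rewrite quotient_off by exact Hwv; rewrite <- (Hf1 w Hw), <- (Hf1 v Hv).
  rewrite <- cav_minus by (apply circle_cont01_kernel; auto; lra).
  unfold Cdiv; rewrite Cmult_comm, <- cav_scal.
  + apply cav_ext; [lra|]; intros y Hy; unfold phi, Cpow; field.
    repeat split; solve [now apply C_sub_neq_0 | apply (circle_neq v 1); auto].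
  + intros t Ht; apply cont_minus;
      apply (circle_cont01_kernel f v 1); auto; lra.
Qed.

Lemma divided_difference f v : entireC f ->
  exists Q, entireC Q /\ forall z, (f z - f v = (z - v) * Q z)%C.
Proof.
intros Hf; destruct (Hf v) as [l Hl]; exists (quotient f v l).
split; [now apply quotient_entire | apply quotient_spec].
Qed.

(** Difference of the Cauchy formulas at z and at c. This form of Cauchy's estimate serves for the
    vanishing order, the Liouville argument, the distortion bound and equicontinuity. *)
Lemma cauchy_lipschitz f c R0 r M z : holo f c R0 -> r < R0 -> Cmod (z - c) < r ->
  (forall y, Cmod (y - c) = r -> Cmod (f y) <= M) ->
  Cmod (f z - f c) <= M * Cmod (z - c) / (r - Cmod (z - c)).
Proof.
intros Hf Hr Hz HM.
assert (Hr0 : 0 < r) by (pose proof (Cmod_ge_0 (z - c)); lra).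
assert (Hfc : circle_cont01 f c r) by (apply (holo_circle f c R0); auto; lra).
assert (Hc : Cmod (c - c) < r) by (now apply Cmod_center_lt).
rewrite <- (cauchy_formula f c R0 r z), <- (cauchy_formula f c R0 r c) at 1 by auto.
assert (K : forall w, Cmod (w - c) < r -> circle_cont01 (fun y => f y * (/ (y - w)) ^ 1)%C c r).
{ intros w Hw; apply circle_cont01_kernel; auto; lra. }
rewrite <- cav_minus by auto.
replace (M * Cmod (z - c) / (r - Cmod (z - c)))
  with (M * (Cmod (z - c) * / (r - Cmod (z - c)) * / r) * r) by (field; lra).
apply cav_bound; [lra | |].
- intros t Ht; apply cont_minus; now apply K.
- intros y Hy.
  assert (N1 := circle_neq c r z y Hy Hz); assert (N2 := circle_neq c r c y Hy Hc).
  replace (f y * (/ (y - z)) ^ 1 - f y * (/ (y - c)) ^ 1)%C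
    with (f y * ((z - c) * / (y - z) * / (y - c)))%C by (unfold Cpow; field; auto).
  rewrite !Cmod_mult.
  assert (A1 : Cmod (/ (y - z)) <= / (r - Cmod (z - c))).
  { apply Cmod_inv_le; [lra | now apply circle_away]. }
  assert (A2 : Cmod (/ (y - c)) <= / r) by (apply Cmod_inv_le; lra).
  assert (0 <= Cmod (z - c)) by apply Cmod_ge_0.
  assert (0 <= Cmod (/ (y - z))) by apply Cmod_ge_0.
  apply Rmult_le_compat; auto using Cmod_ge_0.
  + repeat apply Rmult_le_pos; auto using Cmod_ge_0.
  + apply Rmult_le_compat; auto using Cmod_ge_0.
    * now apply Rmult_le_pos.
    * now apply Rmult_le_compat_l.
Qed.

Lemma max_modulus_center f c R0 r M : holo f c R0 -> 0 < r < R0 ->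
  (forall y, Cmod (y - c) = r -> Cmod (f y) <= M) -> Cmod (f c) <= M.
Proof.
intros Hf Hr HM.
assert (Hfc : circle_cont01 f c r) by (apply (holo_circle f c R0); auto; lra).
assert (Hc : Cmod (c - c) < r) by (apply Cmod_center_lt; lra).
rewrite <- (cauchy_formula f c R0 r c) by (auto; lra).
replace M with (M * / r * r) by (field; lra).
apply cav_bound; [lra | apply circle_cont01_kernel; auto; lra |].
intros y Hy; rewrite Cmod_mult; unfold Cpow; rewrite Cmult_1_r.
apply Rmult_le_compat; auto using Cmod_ge_0.
apply Cmod_inv_le; lra.
Qed.

(** * Compactness *)

Definition infinite (N : nat -> Prop) : Prop := forall n : nat, exists m, (n <= m)%nat /\ N m.

Lemma pigeonhole p (N : nat -> Prop) (col : nat -> nat -> Prop) : infinite N ->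
  (forall k, N k -> exists i, (i < p)%nat /\ col k i) ->
  exists i, infinite (fun k => N k /\ col k i).
Proof.
revert N; induction p as [|p IH]; intros N HN Hcol.
- destruct (HN 0%nat) as [m [_ Hm]]; destruct (Hcol m Hm) as [i [Hi _]]; lia.
- destruct (classic (infinite (fun k => N k /\ col k p))) as [H|H]; [now exists p|].
  apply not_all_ex_not in H; destruct H as [n0 Hn0].
  destruct (IH (fun k => N k /\ (n0 <= k)%nat)) as [i Hi].
  + intros n; destruct (HN (n + n0)%nat) as [m [Hm1 Hm2]]; exists m; repeat split; auto; lia.
  + intros k [Hk Hnk]; destruct (Hcol k Hk) as [i [Hi Hc]]; exists i; split; [|exact Hc].
    destruct (Nat.eq_dec i p) as [->|]; [|lia].
    exfalso; apply Hn0; exists k; auto.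
  + exists i; intros n; destruct (Hi n) as [m [Hm [[H1 _] H2]]]; exists m; auto.
Qed.

Lemma real_cell (t eps : R) p : 0 <= t < INR p * eps ->
  exists i, (i < p)%nat /\ INR i * eps <= t < INR (S i) * eps.
Proof.
induction p as [|p IH]; intros Ht; [simpl in Ht; lra|].
destruct (Rlt_dec t (INR p * eps)) as [H|H].
- destruct IH as [i [Hi Hc]]; [lra|]; exists i; split; [lia | exact Hc].
- exists p; split; [lia|]; lra.
Qed.

Lemma refine_real (N : nat -> Prop) (y : nat -> R) M eps : infinite N -> 0 < eps ->
  (forall k, N k -> Rabs (y k) <= M) ->
  exists N', infinite N' /\ (forall k, N' k -> N k) /\
    forall j k, N' j -> N' k -> Rabs (y j - y k) <= eps.
Proof.
intros HN He HM.
destruct (INR_unbounded ((2 * M + 1) / eps)) as [p Hp].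
assert (Hp' : 2 * M + 1 < INR p * eps).
{ apply Rmult_lt_reg_r with (/ eps); [now apply Rinv_0_lt_compat|].
  rewrite Rmult_assoc, Rinv_r, Rmult_1_r by lra; exact Hp. }
destruct (pigeonhole p N (fun k i => INR i * eps <= y k + M < INR (S i) * eps) HN) as [i Hi].
{ intros k Hk; apply real_cell; specialize (HM k Hk); apply Rabs_le_between in HM; lra. }
eexists; split; [exact Hi|]; split; [tauto|].
intros j k [_ Hj] [_ Hk]; rewrite S_INR in *; apply Rabs_le; lra.
Qed.

Lemma refine_complex (N : nat -> Prop) (x : nat -> C) M eps : infinite N -> 0 < eps ->
  (forall k, N k -> Cmod (x k) <= M) ->
  exists N', infinite N' /\ (forall k, N' k -> N k) /\
    forall j k, N' j -> N' k -> Cmod (x j - x k) <= eps.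
Proof.
intros HN He HM.
destruct (refine_real N (fun k => Re (x k)) M (eps / 2)) as [N1 [I1 [S1 C1]]]; auto; [lra| |].
{ intros k Hk; eapply Rle_trans; [apply re_le_Cmod | auto]. }
destruct (refine_real N1 (fun k => Im (x k)) M (eps / 2)) as [N2 [I2 [S2 C2]]]; auto; [lra| |].
{ intros k Hk; eapply Rle_trans; [apply im_le_Cmod | auto]. }
exists N2; split; [exact I2|]; split; [auto|]; intros j k Hj Hk.
eapply Rle_trans; [apply Cmod_le_components|]; rewrite Re_sub, Im_sub.
specialize (C1 j k (S2 j Hj) (S2 k Hk)); specialize (C2 j k Hj Hk); lra.
Qed.

(** [D eps j k] stands for closeness of the j-th and k-th term up to [eps]: of points for
    Bolzano-Weierstrass, of functions on a disc for Montel. Nested infinite index sets of tolerance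
    2^-n are chosen, and the n-th index is taken from the n-th set. *)
Lemma diagonal (D : R -> nat -> nat -> Prop) :
  (forall N eps, infinite N -> 0 < eps -> exists N', infinite N' /\ (forall k, N' k -> N k) /\
     forall j k, N' j -> N' k -> D eps j k) ->
  (forall e1 e2 j k, e1 <= e2 -> D e1 j k -> D e2 j k) ->
  exists phi : nat -> nat, (forall k, (phi k < phi (S k))%nat) /\
    forall eps, 0 < eps -> exists K, forall i j, (K <= i)%nat -> (K <= j)%nat -> D eps (phi i) (phi j).
Proof.
intros Href Hmon.
set (P := fun (N : nat -> Prop) eps (N' : nat -> Prop) => infinite N' /\ (forall k, N' k -> N k) /\
     forall j k, N' j -> N' k -> D eps j k).
set (next := fun N eps => epsilon (inhabits N) (P N eps)).
assert (Hnext : forall N eps, infinite N -> 0 < eps -> P N eps (next N eps)).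
{ intros N eps HN He; apply epsilon_spec; now apply Href. }
assert (Hh : forall n, 0 < (/ 2) ^ n) by (intros; apply pow_lt; lra).
set (Ns := fix Ns n := match n with
  | O => next (fun _ => True) 1
  | S n => next (Ns n) ((/ 2) ^ S n) end).
assert (H0 : infinite (fun _ => True)) by (intros n; exists n; auto).
assert (HNs : forall n, infinite (Ns n) /\ forall j k, Ns n j -> Ns n k -> D ((/ 2) ^ n) j k).
{ induction n as [|n [IH _]].
  - destruct (Hnext _ 1 H0 Rlt_0_1) as [A [_ B]]; split; [exact A | simpl; exact B].
  - destruct (Hnext _ ((/ 2) ^ S n) IH (Hh _)) as [A [_ B]]; split; [exact A | exact B]. }
assert (Hsub : forall n k, Ns (S n) k -> Ns n k).
{ intros n k Hk; destruct (Hnext (Ns n) ((/ 2) ^ S n) (proj1 (HNs n)) (Hh _)) as [_ [A _]]; auto. }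
assert (Hsub' : forall n m k, (n <= m)%nat -> Ns m k -> Ns n k).
{ intros n m k Hnm; induction Hnm; auto. }
set (pick := fun n lb => epsilon (inhabits 0%nat) (fun m => (lb <= m)%nat /\ Ns n m)).
assert (Hpick : forall n lb, (lb <= pick n lb)%nat /\ Ns n (pick n lb)).
{ intros n lb; apply (epsilon_spec (inhabits 0%nat) (fun m => (lb <= m)%nat /\ Ns n m)).
  apply (proj1 (HNs n)). }
set (phi := fix phi n := match n with O => pick 0%nat 0%nat | S n => pick (S n) (S (phi n)) end).
assert (Hphi : forall n, Ns n (phi n)) by (intros [|n]; apply Hpick).
exists phi; split.
- intros k; simpl; destruct (Hpick (S k) (S (phi k))); lia.
- intros eps He; destruct (pow_half_small 1 eps) as [K HK]; [lra | exact He |].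
  exists K; intros i j Hi Hj.
  apply (Hmon ((/ 2) ^ K)); [specialize (HK K (le_n K)); lra|].
  apply HNs; [now apply (Hsub' K i) | now apply (Hsub' K j)].
Qed.

Lemma strictly_increasing_ge (phi : nat -> nat) :
  (forall k, (phi k < phi (S k))%nat) -> forall k, (k <= phi k)%nat.
Proof. intros H; induction k as [|k IH]; [lia|]; specialize (H k); lia. Qed.

Lemma bolzano_weierstrass_C (x : nat -> C) M : (forall k, Cmod (x k) <= M) ->
  exists phi l, (forall k, (phi k < phi (S k))%nat) /\ C_cv (fun k => x (phi k)) l.
Proof.
intros HM.
destruct (diagonal (fun eps j k => Cmod (x j - x k) <= eps)) as [phi [Hphi HC]].
- intros N eps HN He; now apply (refine_complex N x M).
- intros; lra.
- exists phi; destruct (C_complete (fun k => x (phi k))) as [l Hl].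
  + intros eps He; destruct (HC (eps / 2)) as [K HK]; [lra|]; exists K; intros n m Hn Hm.
    specialize (HK n m Hn Hm); lra.
  + now exists l.
Qed.

Lemma cont_bounded_on_ball f c r : (forall z, ccont f z) ->
  exists M, 0 <= M /\ forall y, Cmod (y - c) <= r -> Cmod (f y) <= M.
Proof.
intros Hf; apply NNPP; intros Hno.
assert (H : forall n : nat, exists y, Cmod (y - c) <= r /\ INR n < Cmod (f y)).
{ intros n; apply NNPP; intros Hn; apply Hno; exists (INR n); split; [apply pos_INR|].
  intros y Hy; apply Rnot_lt_le; intros Hlt; apply Hn; now exists y. }
apply (choice (fun (n : nat) y => Cmod (y - c) <= r /\ INR n < Cmod (f y))) in H.
destruct H as [y Hy].
destruct (bolzano_weierstrass_C y (r + Cmod c)) as [phi [l [Hphi Hl]]].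
{ intros k; pose proof (Cmod_le_add (y k) c); destruct (Hy k); lra. }
destruct (Hf l 1 Rlt_0_1) as [d [Hd Hb]].
destruct (Hl d Hd) as [K HK].
destruct (INR_unbounded (Cmod (f l) + 1)) as [m Hm].
set (k := (K + m)%nat).
specialize (HK k ltac:(unfold k; lia)); specialize (Hb _ HK).
pose proof (Cmod_le_add (f (y (phi k))) (f l)).
destruct (Hy (phi k)) as [_ Hlt].
assert (INR m <= INR (phi k)).
{ apply le_INR; pose proof (strictly_increasing_ge phi Hphi k); unfold k in *; lia. }
lra.
Qed.

(** * Entire functions *)

(** This is the order of vanishing of f - f(p) at each point p, not the order of growth. It says
    quantitatively that no value of [f] is taken on a set with an accumulation point. *)
Definition finite_order (f : C -> C) : Prop :=
  forall p, exists (k : nat) (d c : R), 0 < d /\ 0 < c /\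
    forall z, Cmod (z - p) <= d -> c * Cmod (z - p) ^ k <= Cmod (f z - f p).

(** Dividing f - f(p) repeatedly by z - p gives entire functions [Q n]. If all vanished at p, then f
    - f(p) = (z - p)^n * Q n with |Q n| <= M/(2 rho)^n on the circle of radius 2 rho, and at
    distance rho from p the product would be at most M * 2^-n for all n. The first [Q n] with
    nonzero value at p gives the lower bound. *)
Lemma entire_finite_order f : entireC f -> (forall p, exists z, f z <> f p) -> finite_order f.
Proof.
intros Hf Hnc p.
set (dd := fun F : C -> C => epsilon (inhabits F)
  (fun Q => entireC Q /\ forall z, (F z - F p = (z - p) * Q z)%C)).
assert (Hdd : forall F, entireC F -> entireC (dd F) /\ forall z, (F z - F p = (z - p) * dd F z)%C).
{ intros F HF; apply (epsilon_spec (inhabits F)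
    (fun Q => entireC Q /\ forall z, (F z - F p = (z - p) * Q z)%C)).
  now apply divided_difference. }
set (Q := fun n => Nat.iter n dd (fun z => f z - f p)%C).
assert (HQ : forall n, entireC (Q n)).
{ induction n as [|n IH]; [|now apply Hdd].
  intros z; destruct (Hf z) as [l Hl]; eexists.
  apply deriv_minus; [apply Hl | apply deriv_const]. }
assert (HP : forall n, (forall m, (m < n)%nat -> Q m p = 0) ->
  forall z, (f z - f p = (z - p) ^ n * Q n z)%C).
{ induction n as [|n IH]; intros Hm z; [unfold Q; simpl; ring|].
  rewrite IH by (intros; apply Hm; lia).
  destruct (Hdd (Q n) (HQ n)) as [_ E]; specialize (E z).
  rewrite (Hm n) in E by lia.
  replace (Q n z) with (Q n z - 0)%C by ring; rewrite E; simpl; unfold Q; simpl; ring. }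
assert (Hex : exists n, Q n p <> 0).
{ apply NNPP; intros Hno.
  assert (H0 : forall n, Q n p = 0) by (intros n; apply NNPP; intros H; apply Hno; now exists n).
  destruct (Hnc p) as [z0 Hz0]; apply Hz0, C_sub_eq_0.
  set (rho := Cmod (z0 - p)).
  assert (Hrho : 0 < rho).
  { apply Cmod_pos, C_sub_neq_0; intros ->; now apply Hz0. }
  destruct (cont_bounded_on_ball (Q 0%nat) p (2 * rho)) as [M [HM0 HM]].
  { intros; apply entireC_cont, HQ. }
  apply Cmod_le_0, le_epsilon; intros eps He; rewrite Rplus_0_l.
  destruct (pow_half_small M eps HM0 He) as [N HN]; specialize (HN N (le_n N)).
  rewrite (HP N) by auto; rewrite Cmod_mult, Cmod_pow; fold rho.
  assert (Hp : 0 < (2 * rho) ^ N) by (apply pow_lt; lra).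
  (* With radius 2 rho and |z0 - p| = rho the Lipschitz factor is 1, and [Q N p = 0]: this acts as a
     maximum principle away from the centre. *)
  assert (K : Cmod (Q N z0 - Q N p) <= M / (2 * rho) ^ N * Cmod (z0 - p) / (2 * rho - Cmod (z0 - p))).
  { apply (cauchy_lipschitz (Q N) p (2 * rho + 1)); [now apply entireC_holo | lra | fold rho; lra |].
    intros y Hy.
    assert (E : (Q 0%nat y = (y - p) ^ N * Q N y)%C) by (unfold Q at 1; simpl; now apply HP).
    apply (f_equal Cmod) in E; rewrite Cmod_mult, Cmod_pow, Hy in E.
    specialize (HM y ltac:(lra)); rewrite E in HM.
    apply Rmult_le_reg_r with ((2 * rho) ^ N); [exact Hp|].
    unfold Rdiv; rewrite Rmult_assoc, Rinv_l, Rmult_1_r; lra. }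
  rewrite H0 in K; replace (Q N z0 - 0)%C with (Q N z0) in K by ring; fold rho in K.
  replace (M / (2 * rho) ^ N * rho / (2 * rho - rho)) with (M / (2 * rho) ^ N) in K by (field; lra).
  apply Rle_trans with (rho ^ N * (M / (2 * rho) ^ N)).
  { apply Rmult_le_compat_l; [apply pow_le; lra | exact K]. }
  rewrite Rpow_mult_distr; rewrite pow_inv in HN.
  assert (0 < rho ^ N) by (apply pow_lt; lra); assert (0 < 2 ^ N) by (apply pow_lt; lra).
  replace (rho ^ N * (M / (2 ^ N * rho ^ N))) with (M * / 2 ^ N) by (field; lra); lra. }
assert (Hleast : exists n, Q n p <> 0 /\ forall m, (m < n)%nat -> Q m p = 0).
{ destruct Hex as [n Hn]; revert Hn; induction n as [n IH] using lt_wf_ind; intros Hn.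
  destruct (classic (exists m, (m < n)%nat /\ Q m p <> 0)) as [[m [Hm1 Hm2]]|Hno].
  - now apply (IH m).
  - exists n; split; [exact Hn|]; intros m Hm; apply NNPP; intros H; apply Hno; now exists m. }
destruct Hleast as [n [Hn Hm]].
assert (Hnp := Cmod_pos _ Hn).
destruct (entireC_cont (Q n) p (HQ n) (Cmod (Q n p) / 2)) as [d [Hd Hb]]; [lra|].
exists n, (d / 2), (Cmod (Q n p) / 2); repeat split; [lra | lra |].
intros z Hz; rewrite (HP n Hm z), Cmod_mult, Cmod_pow, Rmult_comm.
apply Rmult_le_compat_l; [apply pow_le, Cmod_ge_0|].
specialize (Hb z ltac:(lra)); rewrite Cmod_sym in Hb.
pose proof (Cmod_le_add (Q n p) (Q n z)); lra.
Qed.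

(** Liouville's argument for (f(z) - f(0))/z, which is bounded on circles of arbitrarily large
    radius; not all large radii are required. *)
Lemma linear_growth_affine f C0 : entireC f -> 0 <= C0 ->
  (forall R1, exists r, R1 <= r /\ forall z, Cmod z = r -> Cmod (f z) <= C0 * r) ->
  exists b, forall z, (f z = f 0 + b * z)%C.
Proof.
intros Hf HC Hr; destruct (divided_difference f 0 Hf) as [Q [HQ E]].
exists (Q 0); intros z.
assert (EQ : Q z = Q 0).
{ apply C_sub_eq_0, Cmod_le_0, le_epsilon; intros eps He; rewrite Rplus_0_l.
  pose proof (Cmod_ge_0 z) as Hz; pose proof (Cmod_ge_0 (f 0)) as Hf0.
  set (M := C0 + Cmod (f 0)); assert (HM : 0 <= M) by (unfold M; lra).
  destruct (Hr (Cmod z + 1 + M * Cmod z / eps)) as [r [Hr1 Hr2]].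
  assert (Hq : 0 <= M * Cmod z / eps).
  { apply Rmult_le_pos; [nra | left; now apply Rinv_0_lt_compat]. }
  assert (Hzz : (z - 0)%C = z) by ring.
  pose proof (cauchy_lipschitz Q 0 (r + 1) r M z) as K; rewrite Hzz in K.
  eapply Rle_trans; [apply K|].
  - now apply entireC_holo.
  - lra.
  - lra.
  - intros y Hy; replace (y - 0)%C with y in Hy by ring.
    assert (Hy0 : y <> 0) by (apply Cmod_gt_0; lra).
    replace (Q y) with ((f y - f 0) / y)%C by (rewrite E; field; exact Hy0).
    rewrite Cmod_div, Hy by exact Hy0.
    apply Rmult_le_reg_r with r; [lra|].
    unfold Rdiv; rewrite Rmult_assoc, Rinv_l, Rmult_1_r by lra.
    eapply Rle_trans; [apply (Cmod_le_sum _ (f y) (- f 0)%C); ring|].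
    rewrite Cmod_opp; specialize (Hr2 y Hy); unfold M; nra.
  - apply Rmult_le_reg_r with (r - Cmod z); [lra|].
    unfold Rdiv; rewrite Rmult_assoc, Rinv_l, Rmult_1_r by lra.
    apply Rle_trans with (eps * (M * Cmod z / eps)); [right; field; lra|].
    apply Rmult_le_compat_l; lra. }
rewrite <- EQ; replace (f z) with (f 0 + (f z - f 0))%C by ring; rewrite E; ring.
Qed.

(** If f omitted a value a near f(p) on the unit disc around p, the maximum principle for 1/(f - a)
    would be violated: on a small circle |f - f(p)| >= 2 eta, hence |f - a| >= eta, whereas |f(p) -
    a| < eta. *)
Lemma open_at f p : entireC f -> finite_order f ->
  exists rho, 0 < rho /\ forall a, Cmod (a - f p) < rho -> exists z, Cmod (z - p) < 1 /\ f z = a.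
Proof.
intros Hf Ho; destruct (Ho p) as [k [d [c [Hd [Hc Hlow]]]]].
set (d' := Rmin d (/ 2)).
assert (Hd1 : d' <= d) by apply Rmin_l.
assert (Hd2 : d' <= / 2) by apply Rmin_r.
assert (Hd' : 0 < d') by (apply Rmin_glb_lt; lra).
set (eta := c * d' ^ k / 2).
assert (Heta : 0 < eta).
{ unfold eta; pose proof (pow_lt d' k Hd'); nra. }
exists eta; split; [exact Heta|]; intros a Ha.
apply NNPP; intros Hno.
assert (Hne : forall z, Cmod (z - p) < 1 -> (f z - a)%C <> 0).
{ intros z Hz; apply C_sub_neq_0; intros E; apply Hno; now exists z. }
assert (Hq : holo (fun z => / (f z - a))%C p 1).
{ intros z Hz; destruct (Hf z) as [l Hl]; eexists.
  apply (deriv_inv _ (fun z => f z - a)%C); [now apply Hne|].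
  apply deriv_minus; [apply Hl | apply deriv_const]. }
assert (K : Cmod (/ (f p - a)) <= / eta).
{ apply (max_modulus_center (fun z => / (f z - a))%C p 1 d'); auto; [lra|].
  intros y Hy; apply Cmod_inv_le; auto.
  specialize (Hlow y ltac:(lra)); rewrite Hy in Hlow.
  pose proof (Cmod_sub_triangle (f y) a (f p)); unfold eta in *; lra. }
assert (N : (f p - a)%C <> 0) by (apply Hne, Cmod_center_lt; lra).
rewrite Cmod_inv in K by exact N.
assert (Np := Cmod_pos _ N).
apply Rinv_le_contravar in K; [|now apply Rinv_0_lt_compat].
rewrite !Rinv_inv in K; rewrite Cmod_sym in K; lra.
Qed.

(** [L] is a primitive of v'/v, and exp(L - L(c))/v has derivative 0. Normalising at the centre
    avoids choosing a logarithm of v(c). *)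
Lemma log_branch v dv c R0 : 0 < R0 -> (forall z, Cmod (z - c) < R0 -> cderiv v z (dv z)) ->
  holo dv c R0 -> (forall z, Cmod (z - c) < R0 -> v z <> 0) ->
  exists L, (forall z, Cmod (z - c) < R0 -> cderiv L z (dv z / v z)) /\
    forall z, Cmod (z - c) < R0 -> cexp (L z - L c) = (v z / v c)%C.
Proof.
intros H0 Hv Hdv Hne.
assert (Hc : Cmod (c - c) < R0) by now apply Cmod_center_lt.
set (q := fun z => (dv z / v z)%C).
assert (Hq : holo q c R0).
{ intros z Hz; destruct (Hdv z Hz) as [l Hl]; eexists.
  apply deriv_div; [now apply Hne | apply Hl | now apply Hv]. }
exists (seg q c).
assert (HL : forall z, Cmod (z - c) < R0 -> cderiv (seg q c) z (q z)).
{ apply seg_primitive; auto. intros; now apply (holo_cont q c R0). }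
split; [exact HL|]; intros z Hz.
set (G := fun z => (cexp (seg q c z - seg q c c) / v z)%C).
assert (HG : G z = G c).
{ apply (deriv_zero_const G c R0); auto; intros w Hw.
  assert (N := Hne w Hw); eapply deriv_eq.
  2:{ apply deriv_div; [exact N | | now apply Hv].
      apply (deriv_comp _ (fun z => seg q c z - seg q c c)%C cexp); [|apply cderiv_cexp].
      apply deriv_minus; [now apply HL | apply deriv_const]. }
  unfold q; cbv beta; field; exact N. }
unfold G in HG.
replace (seg q c c - seg q c c)%C with (RtoC 0) in HG by ring; rewrite cexp_0 in HG.
assert (N := Hne z Hz); assert (Nc := Hne c Hc).
replace (cexp (seg q c z - seg q c c)) with (cexp (seg q c z - seg q c c) / v z * v z)%C
  by (field; exact N).
rewrite HG; field; exact Nc.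
Qed.

Lemma entireC_primitive f : entireC f -> exists F, forall z, cderiv F z (f z).
Proof.
intros Hf; exists (seg f 0); intros z.
apply (seg_primitive f 0 0 (Cmod z + 1)).
- replace (0 - 0)%C with (RtoC 0) by ring; rewrite Cmod_0; pose proof (Cmod_ge_0 z); lra.
- intros; now apply entireC_cont.
- intros; apply Hf.
- replace (z - 0)%C with z by ring; lra.
Qed.

(** * Hulls of images *)

(* [lam] is a logarithm of [w - a] along the curve [w], so that its increment is the
   integral of 1/(w - a), while [G w] is a primitive of (1 - P^k)/(w - a). *)
Lemma path_defect P G k a (w dw lam : R -> C) theta B :
  entireC P -> 0 <= theta ->
  (forall z, z <> a -> cderiv G z ((1 - P z ^ k) / (z - a))) ->
  (forall t, 0 <= t <= 1 -> rderiv w t (dw t)) -> cont01 dw ->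
  (forall t, 0 <= t <= 1 -> w t <> a) ->
  (forall t, 0 <= t <= 1 -> rderiv lam t (dw t / (w t - a))) ->
  (forall t, 0 <= t <= 1 -> Cmod (P (w t)) <= theta) ->
  (forall t, 0 <= t <= 1 -> Cmod (dw t / (w t - a)) <= B) ->
  Cmod (lam 1%R - lam 0%R - (G (w 1%R) - G (w 0%R))) <= theta ^ k * B.
Proof.
intros HP Hth HG Hw Hdw Hne Hlam Hth' HB.
replace (lam 1%R - lam 0%R - (G (w 1%R) - G (w 0%R)))%C
  with ((lam 1%R - G (w 1%R)) - (lam 0%R - G (w 0%R)))%C by ring.
assert (Hc : cont01 (fun t => P (w t) ^ k * (dw t / (w t - a)))%C).
{ intros t Ht; assert (Hwt := deriv_cont _ _ _ _ (Hw t Ht)).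
  apply cont_mult; [|apply cont_div].
  - apply (cont_pow RtoC (fun t => P (w t))), (cont_comp RtoC w P); [exact Hwt|].
    now apply entireC_cont.
  - now apply C_sub_neq_0, Hne.
  - now apply Hdw.
  - apply cont_minus; [exact Hwt | apply cont_const]. }
rewrite <- (CInt_FTC (fun t => lam t - G (w t))%C (fun t => P (w t) ^ k * (dw t / (w t - a)))%C).
- apply CInt_bound; [exact Hc|]; intros t Ht.
  rewrite Cmod_mult, Cmod_pow; apply Rmult_le_compat; auto using Cmod_ge_0.
  + apply pow_le, Cmod_ge_0.
  + apply pow_incr; split; auto using Cmod_ge_0.
- intros t Ht; eapply deriv_eq.
  2:{ apply deriv_minus; [now apply Hlam|].
      apply (deriv_comp RtoC w G); [now apply Hw | now apply HG, Hne]. }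
  field; now apply C_sub_neq_0, Hne.
- exact Hc.
Qed.

Lemma cont01_div_bounded (p q : R -> C) : cont01 p -> cont01 q ->
  (forall t, 0 <= t <= 1 -> q t <> 0) ->
  exists B, 0 <= B /\ forall t, 0 <= t <= 1 -> Cmod (p t / q t) <= B.
Proof.
intros Hp Hq Hne; apply (cont01_bounded (fun t => p t / q t)%C).
intros t Ht; apply cont_div; auto.
Qed.

(* With [s] the branch of sqrt((u - a)/(u z0 - a)) that is 1 at [z0], suppose that
   [s z] is close to -1.  Then the [u]-image of the segment from [z0] to [z],
   followed by a short arc back to [u z0], is a closed curve in {|P| <= M} which winds
   an odd number of times around [a].  As (1 - (P/P(a))^k)/(w - a) has an entire
   primitive, letting k tend to infinity makes the integral of 1/(w - a) along that
   curve vanish. *)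
Lemma sqrt_branch_avoids P a M (u du L : C -> C) z0 r rho z :
  entireC P -> M < Cmod (P a) ->
  (forall y, Cmod (y - z0) < r -> cderiv u y (du y)) -> holo du z0 r ->
  (forall y, Cmod (y - z0) < r -> u y <> a) ->
  (forall y, Cmod (y - z0) < r -> cderiv L y (du y / (u y - a))) ->
  (forall y, Cmod (y - z0) < r -> cexp (L y - L z0) = ((u y - a) / (u z0 - a))%C) ->
  (forall y, Cmod (y - z0) < r -> Cmod (P (u y)) <= M) ->
  0 < rho <= Cmod (u z0 - a) ->
  (forall w, Cmod (w - u z0) < rho -> Cmod (P w) <= M) ->
  Cmod (z - z0) < r ->
  ~ Cmod (cexp ((L z - L z0) / 2) + 1) < rho / (3 * Cmod (u z0 - a)).
Proof.
intros HP HM Hu Hdu Hne HL HLe HPu Hrho HPrho Hz Hlt.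
set (S := cexp ((L z - L z0) / 2)) in *.
set (d := Cmod (u z0 - a)) in *.
assert (Hr : 0 < r) by (pose proof (Cmod_ge_0 (z - z0)); lra).
assert (Hz0 : Cmod (z0 - z0) < r) by now apply Cmod_center_lt.
assert (N0 := C_sub_neq_0 _ _ (Hne z0 Hz0)).
assert (HS2 : ((u z0 - a) * (S * S) = u z - a)%C).
{ unfold S; rewrite <- cexp_plus.
  replace ((L z - L z0) / 2 + (L z - L z0) / 2)%C with (L z - L z0)%C by field.
  rewrite HLe by exact Hz; field; exact N0. }
assert (Hk3 : rho / (3 * d) <= / 3).
{ apply Rmult_le_reg_r with (3 * d); [lra|].
  unfold Rdiv; rewrite Rmult_assoc, Rinv_l by lra; lra. }
assert (HM0 : 0 <= M) by (eapply Rle_trans; [apply Cmod_ge_0 | apply (HPu z0 Hz0)]).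
assert (HPa : P a <> 0) by (apply Cmod_gt_0; lra).
(* Straight path from S to -1 in the plane of the square root; it stays in the unit disc around -1,
   where the logarithm [l] is available. *)
set (p := fun t : R => (S + t * (- (1) - S))%C).
assert (Hp1 : forall t, 0 <= t <= 1 -> Cmod (p t + 1) <= Cmod (S + 1)).
{ intros t Ht; replace (p t + 1)%C with (S + t * (- (1) - S) - (- (1)))%C by (unfold p; ring).
  apply Cmod_convex; auto.
  - right; f_equal; ring.
  - replace (- (1) - - (1))%C with (RtoC 0) by ring; rewrite Cmod_0; apply Cmod_ge_0. }
assert (Hp0 : forall t, 0 <= t <= 1 -> p t <> 0).
{ intros t Ht E; specialize (Hp1 t Ht); rewrite E in Hp1.
  replace (0 + 1)%C with (RtoC 1) in Hp1 by ring; rewrite Cmod_1 in Hp1; lra. }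
assert (Hdp : forall t, rderiv p t (- (1) - S)%C) by (intros; apply rderiv_line).
destruct (log_branch (fun w => w) (fun _ => RtoC 1) (- (1)) 1) as [l [Hl1 Hl2]]; [lra | | | |].
{ intros; apply (deriv_id (fun w : C => w)). }
{ intros w _; eexists; apply deriv_const. }
{ intros w Hw E; rewrite E in Hw.
  replace (0 - - (1))%C with (RtoC 1) in Hw by ring; rewrite Cmod_1 in Hw; lra. }
assert (Hpb : forall t, 0 <= t <= 1 -> Cmod (p t - - (1)) < 1).
{ intros t Ht; specialize (Hp1 t Ht); replace (p t - - (1))%C with (p t + 1)%C by ring; lra. }
set (w1 := fun t : R => u (z0 + t * (z - z0))%C).
set (dw1 := fun t : R => (du (z0 + t * (z - z0)) * (z - z0))%C).
(* The squares of the path [p] give the arc back: p = S corresponds to u z and p = -1 to u z0. Its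
   logarithm is 2 * l(p). *)
set (w2 := fun t : R => (a + (u z0 - a) * (p t * p t))%C).
set (dw2 := fun t : R => ((u z0 - a) * (2 * (p t * (- (1) - S))))%C).
assert (Hball : forall t, 0 <= t <= 1 -> Cmod (z0 + RtoC t * (z - z0) - z0) < r).
{ intros t Ht; now apply convex_ball. }
assert (Hw1 : forall t, 0 <= t <= 1 -> rderiv w1 t (dw1 t)).
{ intros t Ht; apply (deriv_comp RtoC (fun t : R => z0 + t * (z - z0))%C u); [apply rderiv_line|].
  now apply Hu, Hball. }
assert (Hdw1 : cont01 dw1).
{ intros t Ht; apply cont_mult; [|apply cont_const].
  apply (cont_comp RtoC (fun t : R => z0 + t * (z - z0))%C du); [apply rcont_line|].
  apply (holo_cont du z0 r); auto. }
assert (Hw2 : forall t, 0 <= t <= 1 -> rderiv w2 t (dw2 t)).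
{ intros t Ht; eapply deriv_eq.
  2:{ apply deriv_plus; [apply deriv_const|]; apply deriv_scal.
      apply (deriv_mult RtoC p p); apply Hdp. }
  unfold dw2; ring. }
assert (Hpc : forall t, rcont p t) by (intros; eapply deriv_cont, Hdp).
assert (Hdw2 : cont01 dw2).
{ intros t Ht; apply (cont_mult RtoC (fun _ => (u z0 - a)%C)); [apply cont_const|].
  apply (cont_mult RtoC (fun _ => RtoC 2)); [apply cont_const|].
  apply cont_mult; [apply Hpc | apply cont_const]. }
assert (Hn1 : forall t, 0 <= t <= 1 -> w1 t <> a) by (intros; now apply Hne, Hball).
assert (Hn2 : forall t, 0 <= t <= 1 -> w2 t <> a).
{ intros t Ht E.
  assert (E' : ((u z0 - a) * (p t * p t))%C = 0).
  { replace ((u z0 - a) * (p t * p t))%C with (w2 t - a)%C by (unfold w2; ring).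
    rewrite E; ring. }
  apply C_mult_integral in E'; destruct E' as [E'|E']; [now apply N0|].
  apply C_mult_integral in E'; destruct E'; now apply (Hp0 t Ht). }
assert (Hlam1 : forall t, 0 <= t <= 1 -> rderiv (fun t : R => L (z0 + t * (z - z0))%C) t (dw1 t / (w1 t - a))).
{ intros t Ht; eapply deriv_eq.
  2:{ apply (deriv_comp RtoC (fun t : R => z0 + t * (z - z0))%C L); [apply rderiv_line|].
      now apply HL, Hball. }
  unfold dw1, w1; field; now apply C_sub_neq_0, (Hn1 t). }
assert (Hlam2 : forall t, 0 <= t <= 1 -> rderiv (fun t : R => 2 * l (p t))%C t (dw2 t / (w2 t - a))).
{ intros t Ht; eapply deriv_eq.
  2:{ apply deriv_scal, (deriv_comp RtoC p l); [apply Hdp|].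
      now apply Hl1, Hpb. }
  assert (Np := Hp0 t Ht); assert (Nw := C_sub_neq_0 _ _ (Hn2 t Ht)); revert Nw.
  unfold dw2, w2; intros Nw; field; auto. }
set (theta := M / Cmod (P a)).
assert (Hth : 0 <= theta < 1).
{ unfold theta; split; [apply Rmult_le_pos; [lra | left; apply Rinv_0_lt_compat; lra]|].
  apply Rmult_lt_reg_r with (Cmod (P a)); [lra|].
  unfold Rdiv; rewrite Rmult_assoc, Rinv_l; lra. }
(* Normalised to be 1 at [a], [pn] is at most theta < 1 in modulus on the curve, so its powers tend
   to 0 there. *)
set (pn := fun w => (/ P a * P w)%C).
assert (Hpn : entireC pn).
{ intros w; destruct (HP w) as [m Hm]; eexists; exact (deriv_scal _ P _ w m Hm). }
assert (Hpnb : forall w, Cmod (P w) <= M -> Cmod (pn w) <= theta).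
{ intros w Hw; unfold pn, theta; rewrite Cmod_mult, Cmod_inv, Rmult_comm by exact HPa.
  apply Rmult_le_compat_r; [left; apply Rinv_0_lt_compat; lra | exact Hw]. }
assert (Hb1 : forall t, 0 <= t <= 1 -> Cmod (pn (w1 t)) <= theta) by (intros; now apply Hpnb, HPu, Hball).
(* As |p^2 - 1| = |p + 1| * |p - 1| <= 3 |p + 1|, the arc stays within [rho] of u z0; this is the
   origin of the threshold rho / (3 d). *)
assert (Hb2 : forall t, 0 <= t <= 1 -> Cmod (pn (w2 t)) <= theta).
{ intros t Ht; apply Hpnb, HPrho.
  replace (w2 t - u z0)%C with ((u z0 - a) * ((p t + 1) * (p t + 1 - 2)))%C by (unfold w2; ring).
  rewrite !Cmod_mult; fold d.
  assert (Cmod (p t + 1 - 2) <= 3).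
  { eapply Rle_trans; [apply (Cmod_le_sum _ (p t + 1) (- (2)))%C; ring|].
    rewrite Cmod_opp, Cmod_RtoC_pos by lra; specialize (Hp1 t Ht); lra. }
  specialize (Hp1 t Ht).
  pose proof (Cmod_ge_0 (p t + 1)); pose proof (Cmod_ge_0 (p t + 1 - 2)).
  assert (Cmod (p t + 1) * Cmod (p t + 1 - 2) <= Cmod (S + 1) * 3) by (apply Rmult_le_compat; auto).
  apply Rle_lt_trans with (d * (Cmod (S + 1) * 3)); [apply Rmult_le_compat_l; lra|].
  apply Rlt_le_trans with (d * (rho / (3 * d) * 3)); [|right; field; lra].
  apply Rmult_lt_compat_l; lra. }
assert (Hsubc : forall w : R -> C, cont01 w -> cont01 (fun t => w t - a)%C).
{ intros w Hw t Ht; apply cont_minus; [now apply Hw | apply cont_const]. }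
destruct (cont01_div_bounded dw1 (fun t => w1 t - a)%C) as [B1 [HB1 HB1']]; auto.
{ apply Hsubc; intros t Ht; eapply deriv_cont, Hw1; auto. }
{ intros; now apply C_sub_neq_0, Hn1. }
destruct (cont01_div_bounded dw2 (fun t => w2 t - a)%C) as [B2 [HB2 HB2']]; auto.
{ apply Hsubc; intros t Ht; eapply deriv_cont, Hw2; auto. }
{ intros; now apply C_sub_neq_0, Hn2. }
set (A := (L z - L z0 + (2 * l (- (1)) - 2 * l S))%C).
assert (HA : A = 0).
{ apply Cmod_le_0, le_epsilon; intros eps He; rewrite Rplus_0_l.
  (* [B1] and [B2] do not depend on k, so a large k makes the total defect theta^k * (B1 + B2)
     small. *)
  destruct (pow_lt_1_zero theta ltac:(rewrite Rabs_pos_eq; lra) (eps / (B1 + B2 + 1))) as [k Hk].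
  { apply Rdiv_lt_0_compat; lra. }
  specialize (Hk k (le_n k)); rewrite Rabs_pos_eq in Hk by (apply pow_le; lra).
  assert (HF : entireC (fun w => 1 - pn w ^ k)%C).
  { intros w; destruct (Hpn w) as [m Hm]; destruct (deriv_pow _ pn w m k Hm) as [m' Hm'].
    eexists; apply deriv_minus; [apply deriv_const | exact Hm']. }
  destruct (divided_difference _ a HF) as [Q [HQ EQ]].
  assert (Hpa : pn a = 1) by (unfold pn; field; exact HPa).
  assert (H1k : (RtoC 1 ^ k)%C = 1) by (now rewrite <- RtoC_pow, pow1).
  rewrite Hpa, H1k in EQ.
  destruct (entireC_primitive Q HQ) as [G HG].
  assert (HG' : forall w, w <> a -> cderiv G w ((1 - pn w ^ k) / (w - a))).
  { intros w Hw; eapply deriv_eq; [|apply HG].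
    replace (1 - pn w ^ k)%C with ((w - a) * Q w)%C by (rewrite <- EQ; ring).
    field; now apply C_sub_neq_0. }
  pose proof (path_defect pn G k a w1 dw1 (fun t : R => L (z0 + t * (z - z0))%C) theta B1
    Hpn (proj1 Hth) HG' Hw1 Hdw1 Hn1 Hlam1 Hb1 HB1') as D1.
  pose proof (path_defect pn G k a w2 dw2 (fun t : R => 2 * l (p t))%C theta B2
    Hpn (proj1 Hth) HG' Hw2 Hdw2 Hn2 Hlam2 Hb2 HB2') as D2.
  cbv beta in D1, D2.
  assert (E11 : w1 1 = u z) by (unfold w1; f_equal; ring).
  assert (E10 : w1 0 = u z0) by (unfold w1; f_equal; ring).
  assert (Ep0 : p 0 = S) by (unfold p; ring).
  assert (Ep1 : p 1 = (- (1))%C) by (unfold p; ring).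
  assert (E20 : w2 0 = u z) by (unfold w2; rewrite Ep0, HS2; ring).
  assert (E21 : w2 1 = u z0) by (unfold w2; rewrite Ep1; ring).
  rewrite E11, E10 in D1; rewrite E20, E21, Ep0, Ep1 in D2.
  replace (z0 + 1%R * (z - z0))%C with z in D1 by ring.
  replace (z0 + 0%R * (z - z0))%C with z0 in D1 by ring.
  eapply Rle_trans.
  { apply (Cmod_le_sum _ (L z - L z0 - (G (u z) - G (u z0)))
      (2 * l (- (1)) - 2 * l S - (G (u z0) - G (u z))))%C; unfold A; ring. }
  apply Rle_trans with (theta ^ k * (B1 + B2)); [lra|].
  apply Rle_trans with (eps / (B1 + B2 + 1) * (B1 + B2 + 1)); [|right; field; lra].
  apply Rmult_le_compat; try lra. apply pow_le; lra. }
(* Contradiction of signs: [A = 0] gives S * exp(l(-1) - l(S)) = exp(A/2) = 1, whereas exp(l(S) -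
   l(-1)) = -S makes the same product -1. *)
assert (HlS : (cexp (l S - l (- (1))) = - S)%C).
{ rewrite Hl2; [field|].
  replace (S - - (1))%C with (S + 1)%C by ring; lra. }
assert (E : (S * cexp (l (- (1)) - l S))%C = 1).
{ unfold S at 1; rewrite <- cexp_plus.
  replace ((L z - L z0) / 2 + (l (- (1)) - l S))%C with (A / 2)%C by (unfold A; field).
  rewrite HA; replace (0 / 2)%C with (RtoC 0) by field; apply cexp_0. }
assert (E' : (cexp (l (- (1)) - l S) * cexp (l S - l (- (1))))%C = 1).
{ rewrite <- cexp_plus; replace (l (- (1)) - l S + (l S - l (- (1))))%C with (RtoC 0) by ring.
  apply cexp_0. }
rewrite HlS in E'.
assert (E2 : RtoC 1 = (- (1))%C).
{ transitivity (cexp (l (- (1)) - l S) * - S)%C; [now symmetry|].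
  transitivity (- (S * cexp (l (- (1)) - l S)))%C; [ring | now rewrite E]. }
apply (f_equal fst) in E2; simpl in E2; lra.
Qed.

(** With d = |u z0 - a|, the branch S of sqrt((u - a)/(u z0 - a)) has distance at least kappa =
    rho/(3 d) from -1. So q = 1/(S + 1) is bounded by 1/kappa and q(z0) = 1/2; Cauchy's estimate on
    radius r/2 keeps |q| >= 1/4 when |z - z0| <= kappa * r/16. Then |S| <= 5 and |S|^2 <= 25.
    Neither [P] nor [M] enters the bound. *)
Lemma hull_distortion P a M u z0 r rho z :
  entireC P -> M < Cmod (P a) -> holo u z0 r -> 0 < r -> 0 < rho ->
  (forall y, Cmod (y - z0) < r -> Cmod (P (u y)) <= M) ->
  (forall w, Cmod (w - u z0) < rho -> Cmod (P w) <= M) ->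
  Cmod (z - z0) <= rho * r / (48 * Cmod (u z0 - a)) ->
  Cmod (u z - a) <= 25 * Cmod (u z0 - a).
Proof.
intros HP HM Hu Hr Hrho HPu HPr Hz.
assert (Hd : rho <= Cmod (u z0 - a)).
{ apply Rnot_lt_le; intros H; rewrite Cmod_sym in H; specialize (HPr a H); lra. }
set (d := Cmod (u z0 - a)) in *.
assert (Hz0 : Cmod (z0 - z0) < r) by now apply Cmod_center_lt.
assert (Hne : forall y, Cmod (y - z0) < r -> u y <> a).
{ intros y Hy E; specialize (HPu y Hy); rewrite E in HPu; lra. }
destruct (holo_deriv u z0 r Hu) as [du [Hdu Hdu2]].
destruct (log_branch (fun y => u y - a)%C du z0 r Hr) as [L [HL1 HL2]].
{ intros y Hy; eapply deriv_eq; [|apply deriv_minus; [now apply Hdu | apply deriv_const]]; ring. }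
{ exact Hdu2. }
{ intros y Hy; now apply C_sub_neq_0, Hne. }
set (S := fun y => cexp ((L y - L z0) / 2)).
set (kappa := rho / (3 * d)).
assert (Hk : 0 < kappa <= / 3).
{ split; [apply Rdiv_lt_0_compat; lra|].
  apply Rmult_le_reg_r with (3 * d); [lra|].
  unfold kappa, Rdiv; rewrite Rmult_assoc, Rinv_l by lra; lra. }
assert (Hav : forall y, Cmod (y - z0) < r -> kappa <= Cmod (S y + 1)).
{ intros y Hy; apply Rnot_lt_le.
  now apply (sqrt_branch_avoids P a M u du L z0 r rho y). }
assert (HSd : holo S z0 r).
{ intros y Hy; eexists.
  apply (deriv_ext _ (fun y => cexp (/ 2 * (L y - L z0)))); [intros; unfold S; f_equal; field|].
  apply (deriv_comp _ (fun y => / 2 * (L y - L z0))%C cexp).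
  - apply deriv_scal, deriv_minus; [now apply HL1 | apply deriv_const].
  - apply cderiv_cexp. }
set (q := fun y => (/ (S y + 1))%C).
assert (Hq : holo q z0 r).
{ intros y Hy; destruct (HSd y Hy) as [l Hl]; eexists.
  apply (deriv_inv _ (fun y => S y + 1)%C).
  - apply Cmod_gt_0; specialize (Hav y Hy); lra.
  - apply deriv_plus; [apply Hl | apply deriv_const]. }
assert (Hzk : Cmod (z - z0) <= kappa * r / 16).
{ replace (kappa * r / 16) with (rho * r / (48 * d)) by (unfold kappa; field; lra); exact Hz. }
assert (Hzr : Cmod (z - z0) <= r / 4) by nra.
assert (Hz' : Cmod (z - z0) < r) by lra.
assert (HS0 : S z0 = 1).
{ unfold S; replace ((L z0 - L z0) / 2)%C with (RtoC 0) by field; apply cexp_0. }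
assert (K : Cmod (q z - q z0) <= / 4).
{ eapply Rle_trans.
  { apply (cauchy_lipschitz q z0 r (r / 2) (/ kappa)); auto; try lra.
    intros y Hy; apply Cmod_inv_le; [lra | apply Hav; lra]. }
  apply Rmult_le_reg_r with (r / 2 - Cmod (z - z0)); [lra|].
  unfold Rdiv at 1; rewrite Rmult_assoc, Rinv_l, Rmult_1_r by lra.
  apply Rle_trans with (/ kappa * (kappa * r / 16)).
  - apply Rmult_le_compat_l; [left; apply Rinv_0_lt_compat; lra | exact Hzk].
  - replace (/ kappa * (kappa * r / 16)) with (r / 16) by (field; lra); lra. }
assert (Hq0 : q z0 = (/ 2)%C).
{ unfold q; rewrite HS0; field. }
assert (HqC : / 4 <= Cmod (q z)).
{ rewrite Cmod_sym in K; pose proof (Cmod_le_add (q z0) (q z)) as T.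
  rewrite Hq0 in T at 1; rewrite <- RtoC_half, Cmod_RtoC_pos in T by lra; lra. }
assert (N1 : (S z + 1)%C <> 0) by (apply Cmod_gt_0; specialize (Hav z Hz'); lra).
assert (HS4 : Cmod (S z + 1) <= 4).
{ unfold q in HqC; rewrite Cmod_inv in HqC by exact N1.
  apply Rinv_le_contravar in HqC; [|lra]; rewrite !Rinv_inv in HqC; exact HqC. }
assert (HS5 : Cmod (S z) <= 5).
{ pose proof (Cmod_sub_triangle (S z) (- (1))%C 0) as T.
  replace (S z - - (1))%C with (S z + 1)%C in T by ring.
  replace (S z - 0)%C with (S z) in T by ring.
  replace (- (1) - 0)%C with (- (1))%C in T by ring.
  rewrite Cmod_m1 in T; lra. }
assert (E : (u z - a = S z * S z * (u z0 - a))%C).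
{ unfold S; rewrite <- cexp_plus.
  replace ((L z - L z0) / 2 + (L z - L z0) / 2)%C with (L z - L z0)%C by field.
  rewrite HL2 by exact Hz'; field; now apply C_sub_neq_0, Hne. }
rewrite E, !Cmod_mult; fold d.
apply Rmult_le_compat_r; [lra|].
pose proof (Cmod_ge_0 (S z)); nra.
Qed.

(* Repeated halving of the distance to [b] stops since P is at most M near [b]. *)
Lemma minimal_escape P b M a0 rho0 : 0 < rho0 -> M < Cmod (P a0) ->
  (forall w, Cmod (w - b) < rho0 -> Cmod (P w) <= M) ->
  exists a, M < Cmod (P a) /\ Cmod (b - a) <= Cmod (b - a0) /\
    forall w, Cmod (w - b) < Cmod (b - a) / 2 -> Cmod (P w) <= M.
Proof.
intros Hr Ha0 Hin; apply NNPP; intros Hno.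
assert (H : forall n, exists a, M < Cmod (P a) /\ Cmod (b - a) <= Cmod (b - a0) * (/ 2) ^ n).
{ induction n as [|n [a [Ha1 Ha2]]].
  - exists a0; split; [exact Ha0 | simpl; lra].
  - apply NNPP; intros Hn; apply Hno; exists a; split; [exact Ha1|]; split.
    + eapply Rle_trans; [exact Ha2|].
      assert ((/ 2) ^ n <= 1) by (rewrite <- (pow1 n); apply pow_incr; lra).
      pose proof (Cmod_ge_0 (b - a0)); nra.
    + intros w Hw; apply Rnot_lt_le; intros Hlt; apply Hn; exists w; split; [exact Hlt|].
      rewrite Cmod_sym in Hw; simpl; lra. }
destruct (pow_half_small (Cmod (b - a0)) rho0) as [N HN]; [apply Cmod_ge_0 | exact Hr |].
specialize (HN N (le_n N)); destruct (H N) as [a [Ha1 Ha2]].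
specialize (Hin a ltac:(rewrite Cmod_sym; lra)); lra.
Qed.

(** Quantifying over all entire [P] expresses that [a] lies in the hull of the image of the disc. If
    this failed for arbitrarily large r, the distortion estimate around an almost nearest point
    outside the hull would give f linear growth on circles of radius r/96. *)
Lemma image_hull_growth f : entireC f -> finite_order f ->
  ~ (exists b, forall z, (f z = f 0 + b * z)%C) ->
  exists R0, 0 < R0 /\ forall r P M a, R0 <= r -> entireC P ->
    (forall z, Cmod z < r -> Cmod (P (f z)) <= M) -> Cmod a <= 2 * r -> Cmod (P a) <= M.
Proof.
intros Hf Ho Hna; apply NNPP; intros Hno; apply Hna.
destruct (open_at f 0 Hf Ho) as [rho0 [Hrho0 Hopen]].
(* With |b| <= r and |b - a| <= |b| + 2 r, one gets |f| <= 26 |b - a| + |b| <= 79 r on the circle of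
   radius r/96, and 79 * 96 = 7584. The factor 96 is 2 * 48, as the inner disc has radius |b -
   a|/2. *)
apply (linear_growth_affine f 7584 Hf); [lra|]; intros R1.
set (b := f 0) in *.
set (R0 := 1 + Cmod b + 96 * Rabs R1).
pose proof (Cmod_ge_0 b); pose proof (Rabs_pos R1); pose proof (Rle_abs R1).
assert (Hex : exists r P M a, R0 <= r /\ entireC P /\
  (forall z, Cmod z < r -> Cmod (P (f z)) <= M) /\ Cmod a <= 2 * r /\ M < Cmod (P a)).
{ apply NNPP; intros Hn; apply Hno; exists R0; split; [unfold R0; lra|].
  intros r P M a Hr HP HM Ha; apply Rnot_lt_le; intros Hlt; apply Hn.
  exists r, P, M, a; auto. }
destruct Hex as [r [P [M [a0 [Hr [HP [HM [Ha0 Hlt]]]]]]]].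
unfold R0 in Hr.
assert (Hz0 : forall z : C, (z - 0)%C = z) by (intros; ring).
destruct (minimal_escape P b M a0 rho0 Hrho0 Hlt) as [a [Ha [Hab Hin]]].
{ intros w Hw; destruct (Hopen w Hw) as [z [Hz <-]]; rewrite Hz0 in Hz; apply HM; lra. }
assert (Hd : 0 < Cmod (b - a)).
{ apply Cmod_pos, C_sub_neq_0; intros E.
  specialize (HM 0); rewrite Cmod_0 in HM; fold b in HM; rewrite E in HM.
  specialize (HM ltac:(lra)); lra. }
exists (r / 96); split; [lra|]; intros z Hz.
assert (K : Cmod (f z - a) <= 25 * Cmod (b - a)).
{ apply (hull_distortion P a M f 0 r (Cmod (b - a) / 2)); auto; try lra.
  - now apply entireC_holo.
  - intros y Hy; rewrite Hz0 in Hy; now apply HM.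
  - rewrite Hz0, Hz; fold b; right; field; lra. }
assert (Cmod (b - a0) <= Cmod b + Cmod a0).
{ rewrite <- (Cmod_opp a0); apply Cmod_triangle. }
pose proof (Cmod_le_add (f z) a).
assert (Cmod a <= Cmod b + Cmod (b - a)).
{ rewrite <- (Cmod_opp (b - a)); apply Cmod_le_sum; ring. }
lra.
Qed.

(** Taking P = f^k in the hypothesis turns a bound for f^(k+1) = f^k o f on the disc of radius r
    into the same bound for f^k on the disc of radius 2 r. *)
Lemma iterates_unbounded f R0 : entireC f -> 0 < R0 ->
  (forall r P M a, R0 <= r -> entireC P ->
    (forall z, Cmod z < r -> Cmod (P (f z)) <= M) -> Cmod a <= 2 * r -> Cmod (P a) <= M) ->
  forall k r M, R0 <= r -> (forall z, Cmod z < r -> Cmod (Nat.iter k f z) <= M) -> 2 ^ k * r <= M.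
Proof.
intros Hf HR H; induction k as [|k IH]; intros r M Hr HM.
- simpl in *; apply Rnot_lt_le; intros Hlt.
  assert (HM0 : 0 <= M) by (rewrite <- Cmod_0; apply HM; rewrite Cmod_0; lra).
  specialize (HM (RtoC ((M + r) / 2))); rewrite Cmod_RtoC_pos in HM by lra; lra.
- replace (2 ^ S k * r) with (2 ^ k * (2 * r)) by (simpl; ring).
  apply IH; [lra|]; intros z Hz; apply (H r (Nat.iter k f)); auto; [now apply entireC_iter| |lra].
  intros y Hy; rewrite <- Nat.iter_succ_r; now apply HM.
Qed.

Lemma iter_commute (f h : C -> C) : (forall z, f (h z) = h (f z)) ->
  forall k m z, Nat.iter k f (Nat.iter m h z) = Nat.iter m h (Nat.iter k f z).
Proof.
intros Hc; assert (H1 : forall m z, f (Nat.iter m h z) = Nat.iter m h (f z)).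
{ induction m as [|m IH]; intros z; simpl; [reflexivity | now rewrite Hc, IH]. }
induction k as [|k IH]; intros m z; simpl; [reflexivity | now rewrite IH, H1].
Qed.

(** Applied with f a generator and h an element of the semigroup. The distortion estimate is used
    with P an iterate of [f] and u an iterate of [h], and its constants depend only on r, [M0] and
    [R0]. *)
Lemma commuting_iterates_bounded f h z0 r M0 : entireC f -> entireC h -> finite_order f ->
  ~ (exists b, forall z, (f z = f 0 + b * z)%C) ->
  (forall z, f (h z) = h (f z)) -> 0 < r ->
  (forall m w, Cmod (w - Nat.iter m h z0) < r -> forall k, Cmod (Nat.iter k f w) <= M0) ->
  exists d B, 0 < d /\ forall m z, Cmod (z - z0) <= d -> Cmod (Nat.iter m h z) <= B.
Proof.
intros Hf Hh Ho Hna Hcom Hr HK.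
destruct (image_hull_growth f Hf Ho Hna) as [R0 [HR0 Hgrow]].
assert (Hit := iterates_unbounded f R0 Hf HR0 Hgrow).
assert (HM0 : 0 <= M0).
{ eapply Rle_trans; [apply Cmod_ge_0 | apply (HK 0%nat z0 ltac:(now apply Cmod_center_lt) 0%nat)]. }
set (D := M0 + R0).
(* [D] bounds the distance from h^m(z0) to the point [a] to be found in the disc of radius [R0]. *)
exists (r * r / (48 * D)), (25 * D + R0); split.
{ apply Rdiv_lt_0_compat; unfold D; nra. }
intros m z Hz.
destruct (cont_bounded_on_ball (Nat.iter m h) 0 M0) as [Mm [HMm Hb]].
{ intros; apply entireC_cont; now apply entireC_iter. }
assert (Hz0 : forall z : C, (z - 0)%C = z) by (intros; ring).
(* This bound depends on m; only the choice of k and a is affected, not the final estimate. *)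
set (M := Rmax Mm M0).
assert (HMl : Mm <= M) by apply Rmax_l.
assert (HMr : M0 <= M) by apply Rmax_r.
assert (Hex : exists k a, Cmod a < R0 /\ M < Cmod (Nat.iter k f a)).
{ destruct (pow_half_small (M + 1) R0) as [k Hk]; [lra | exact HR0 |].
  specialize (Hk k (le_n k)).
  assert (H2 : 0 < 2 ^ k) by (apply pow_lt; lra).
  assert (Hlt : M < 2 ^ k * R0).
  { apply Rle_lt_trans with (2 ^ k * ((M + 1) * (/ 2) ^ k)).
    - rewrite pow_inv; replace (2 ^ k * ((M + 1) * / 2 ^ k)) with (M + 1) by (field; lra); lra.
    - now apply Rmult_lt_compat_l. }
  apply NNPP; intros Hn.
  assert (2 ^ k * R0 <= M); [|lra].
  apply Hit; [lra|]; intros a Ha; apply Rnot_lt_le; intros Hl; apply Hn; now exists k, a. }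
destruct Hex as [k [a [Ha HPa]]].
set (c := Nat.iter m h z0).
assert (Hc : Cmod c <= M0) by apply (HK m c ltac:(now apply Cmod_center_lt) 0%nat).
assert (Hin : forall w, Cmod (w - c) < r -> Cmod (Nat.iter k f w) <= M).
{ intros w Hw; eapply Rle_trans; [now apply (HK m) | exact HMr]. }
assert (Hca : 0 < Cmod (c - a)).
{ apply Cmod_pos, C_sub_neq_0; intros E.
  specialize (Hin a); rewrite E in Hin; specialize (Hin (Cmod_center_lt a r Hr)); lra. }
assert (HD : Cmod (c - a) <= D).
{ unfold D; rewrite <- (Cmod_opp a) in Ha; pose proof (Cmod_triangle c (- a)).
  change (c - a)%C with (c + - a)%C; lra. }
assert (K : Cmod (Nat.iter m h z - a) <= 25 * Cmod (c - a)).
{ apply (hull_distortion (Nat.iter k f) a M (Nat.iter m h) z0 r r); auto.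
  - now apply entireC_iter.
  - now apply entireC_holo, entireC_iter.
  - intros y Hy; rewrite (iter_commute f h Hcom).
    eapply Rle_trans; [|exact HMl]; apply Hb; rewrite Hz0; now apply (HK 0%nat).
  - fold c; eapply Rle_trans; [exact Hz|].
    apply Rmult_le_compat_l; [nra|]; apply Rinv_le_contravar; lra. }
pose proof (Cmod_le_add (Nat.iter m h z) a); lra.
Qed.

(** * Singular values of compositions *)

(** The basic neighbourhoods behind [locally] are squares here; this passes to discs. *)
Lemma locally_Cmod (z : C) (V : C -> Prop) :
  locally z V <-> exists d, 0 < d /\ forall w, Cmod (w - z) < d -> V w.
Proof.
split.
- intros [eps H]; exists eps; split; [apply cond_pos|]; intros w Hw; apply H.
  split; (eapply Rle_lt_trans; [|exact Hw]).
  + exact (re_le_Cmod (w - z)).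
  + exact (im_le_Cmod (w - z)).
- intros [d [Hd H]]; exists (mkposreal (d / 2) (Rdiv_lt_0_compat _ _ Hd Rlt_0_2)).
  intros w [H1 H2]; apply H.
  eapply Rle_lt_trans; [apply Cmod_le_components|].
  change (Rabs (Re (w - z)%C) < d / 2) in H1; change (Rabs (Im (w - z)%C) < d / 2) in H2; lra.
Qed.

Lemma is_derive_cderiv (f : C -> C) (z l : C) : is_derive f z l <-> cderiv f z l.
Proof.
split.
- intros [_ H] eps He.
  destruct (H z (fun P HP => HP) (mkposreal eps He)) as [d Hd]; exists d; split; [apply cond_pos|].
  intros w Hw; specialize (Hd w Hw).
  change (Cmod (f w - f z - (w - z) * l) <= eps * Cmod (w - z)) in Hd.
  replace (l * (w - z))%C with ((w - z) * l)%C by ring; exact Hd.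
- intros H; split; [apply is_linear_scal_l|].
  intros x Hx eps.
  apply (is_filter_lim_locally_unique (V := AbsRing_NormedModule C_AbsRing) z x) in Hx; subst x.
  destruct (H eps (cond_pos eps)) as [d [Hd Hb]].
  exists (mkposreal d Hd); intros w Hw; specialize (Hb w Hw).
  change (Cmod (f w - f z - (w - z) * l) <= eps * Cmod (w - z)).
  replace ((w - z) * l)%C with (l * (w - z))%C by ring; exact Hb.
Qed.

Lemma entire_entireC f : entire f -> entireC f.
Proof. intros H z; destruct (H z) as [l Hl]; exists l; now apply is_derive_cderiv. Qed.

(** Transcendence enters in this form; it is the alternative to linear growth on large circles. *)
Lemma transcendental_not_affine f : transcendental_entire f ->
  ~ (exists b, forall z, (f z = f 0 + b * z)%C).
Proof.
intros [_ Hp] [b Hb]; apply Hp.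
exists 1%nat, (fun k => match k with O => f 0 | _ => b end); intros z.
rewrite sum_Sn, sum_O, Hb; simpl; unfold plus; simpl; ring.
Qed.

Lemma transcendental_finite_order f : transcendental_entire f -> finite_order f.
Proof.
intros Hf; apply entire_finite_order; [apply entire_entireC, Hf|].
intros p; apply NNPP; intros Hno; apply (transcendental_not_affine f Hf); exists 0; intros z.
assert (H : forall y, f y = f p) by (intros y; apply NNPP; intros H; apply Hno; now exists y).
rewrite (H z), (H 0); ring.
Qed.

Lemma finite_order_comp u v : entireC v -> finite_order u -> finite_order v ->
  finite_order (fun z => u (v z)).
Proof.
intros Hvc Hu Hv p; destruct (Hu (v p)) as [k1 [d1 [c1 [Hd1 [Hc1 H1]]]]].
destruct (Hv p) as [k2 [d2 [c2 [Hd2 [Hc2 H2]]]]].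
destruct (entireC_cont v p Hvc d1 Hd1) as [d3 [Hd3 H3]].
exists (k2 * k1)%nat, (Rmin d2 (d3 / 2)), (c1 * c2 ^ k1); repeat split.
- apply Rmin_glb_lt; lra.
- apply Rmult_lt_0_compat; auto; now apply pow_lt.
- intros z Hz; assert (Hz2 := Rle_trans _ _ _ Hz (Rmin_l _ _)).
  assert (Hz3 := Rle_trans _ _ _ Hz (Rmin_r _ _)).
  specialize (H3 z ltac:(lra)); specialize (H1 (v z) ltac:(lra)); specialize (H2 z Hz2).
  eapply Rle_trans; [|exact H1].
  rewrite Rmult_assoc; apply Rmult_le_compat_l; [lra|].
  rewrite pow_mult, <- Rpow_mult_distr; apply pow_incr; split; [|exact H2].
  apply Rmult_le_pos; [lra | apply pow_le, Cmod_ge_0].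
Qed.

(** The singular values before limit points are added; these are recovered later from closedness. *)
Definition singular_value (f : C -> C) (w : C) : Prop :=
  critical_value f w \/ asymptotic_value f w.

Lemma critical_value_comp u v w : entireC u -> entireC v ->
  critical_value (fun z => u (v z)) w ->
  critical_value u w \/ exists p, critical_value v p /\ u p = w.
Proof.
intros Hu Hv [z [Hz Hw]]; apply is_derive_cderiv in Hz.
destruct (Hv z) as [l Hl]; destruct (Hu (v z)) as [m Hm].
assert (E : (m * l)%C = 0).
{ apply (cderiv_unique (fun z => u (v z)) z); [now apply (deriv_comp _ v u) | exact Hz]. }
apply C_mult_integral in E; destruct E as [-> | ->].
- left; exists (v z); split; [now apply is_derive_cderiv | exact Hw].
- right; exists (v z); split; [|exact Hw]; exists z; split; [now apply is_derive_cderiv | reflexivity].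
Qed.

Lemma continuous_curve (h : R -> C) :
  (forall t, continuous h t) <-> (forall t, rcont h t).
Proof.
split; intros H t.
- intros eps He.
  destruct (H t (fun w => Cmod (w - h t) < eps)) as [d Hd].
  { apply locally_Cmod; exists eps; auto. }
  exists d; split; [apply cond_pos|]; intros s Hs; apply Hd.
  rewrite Cmod_RtoC_sub in Hs; exact Hs.
- intros V HV; apply locally_Cmod in HV; destruct HV as [e [He HV]].
  destruct (H t e He) as [d [Hd Hb]]; exists (mkposreal d Hd); intros s Hs.
  apply HV, Hb; rewrite Cmod_RtoC_sub; exact Hs.
Qed.

Lemma curve_lim (h : R -> C) (w : C) :
  filterlim h (Rbar_locally p_infty) (locally w) <->
  forall eps, 0 < eps -> exists T, forall t, T < t -> Cmod (h t - w) < eps.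
Proof.
split.
- intros H eps He; apply (H (fun y => Cmod (y - w) < eps)), locally_Cmod; exists eps; auto.
- intros H V HV; apply locally_Cmod in HV; destruct HV as [e [He HV]].
  destruct (H e He) as [T HT]; exists T; auto.
Qed.

Lemma rcont_Cmod (h : R -> C) (p : C) : (forall t, rcont h t) ->
  continuity (fun t => Cmod (h t - p)).
Proof.
intros H t eps He; destruct (H t eps He) as [d [Hd Hb]].
exists d; split; [exact Hd|]; intros s [_ Hs]; simpl in Hs |- *; unfold Rdist in *.
rewrite <- Cmod_RtoC_sub in Hs; specialize (Hb s Hs).
apply Rabs_def1.
- pose proof (Cmod_sub_triangle (h s) (h t) p); lra.
- rewrite Cmod_sym in Hb; pose proof (Cmod_sub_triangle (h t) (h s) p); lra.
Qed.

(* If the curve [v o gamma] does not tend to infinity, it accumulates at some [p]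
   with [u p = w]; as the [w]-points of [u] are isolated, the curve is eventually
   trapped in every small disc around [p]. *)
Lemma asymptotic_value_comp u v w : entireC u -> finite_order u -> entireC v ->
  asymptotic_value (fun z => u (v z)) w ->
  asymptotic_value u w \/ exists p, asymptotic_value v p /\ u p = w.
Proof.
intros Hu Ho Hv [gamma [Hc [Hinf Hlim]]].
set (h := fun t => v (gamma t)).
assert (Hh : forall t, rcont h t).
{ intros t; apply (cont_comp RtoC gamma v); [now apply continuous_curve | now apply entireC_cont]. }
assert (Hlim' : forall eps, 0 < eps -> exists T, forall t, T < t -> Cmod (u (h t) - w) < eps).
{ now apply (curve_lim (fun t => u (h t))). }
destruct (classic (forall B, exists T, forall t, T < t -> B < Cmod (h t))) as [HB|HB].
- left; exists h; split; [now apply continuous_curve|]; split; [|exact Hlim].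
  intros Q [B HQ]; destruct (HB B) as [T HT]; exists T; auto.
- right; apply not_all_ex_not in HB; destruct HB as [B HB].
  assert (Hts : forall n : nat, exists t, INR n < t /\ Cmod (h t) <= B).
  { intros n; apply NNPP; intros Hn; apply HB; exists (INR n); intros t Ht.
    apply Rnot_le_lt; intros Hle; apply Hn; now exists t. }
  apply (choice (fun (n : nat) t => INR n < t /\ Cmod (h t) <= B)) in Hts.
  destruct Hts as [ts Hts].
  destruct (bolzano_weierstrass_C (fun n => h (ts n)) B) as [phi [p [Hphi Hp]]].
  { intros; apply Hts. }
  assert (Hacc : forall eps T, 0 < eps -> exists t, T < t /\ Cmod (h t - p) < eps).
  { intros eps T He; destruct (Hp eps He) as [N HN].
    destruct (INR_unbounded T) as [m Hm].
    exists (ts (phi (N + m)%nat)); split; [|apply HN; lia].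
    destruct (Hts (phi (N + m)%nat)) as [H1 _].
    assert (INR m <= INR (phi (N + m)%nat)); [|lra].
    apply le_INR; pose proof (strictly_increasing_ge phi Hphi (N + m)); lia. }
  assert (Hup : u p = w).
  { apply C_sub_eq_0, Cmod_le_0, le_epsilon; intros eps He; rewrite Rplus_0_l.
    destruct (entireC_cont u p Hu (eps / 2)) as [d [Hd Hb]]; [lra|].
    destruct (Hlim' (eps / 2)) as [T HT]; [lra|].
    destruct (Hacc d T Hd) as [t [Ht1 Ht2]].
    specialize (HT t Ht1); specialize (Hb _ Ht2); rewrite Cmod_sym in Hb.
    pose proof (Cmod_sub_triangle (u p) (u (h t)) w); lra. }
  exists p; split; [|exact Hup].
  exists gamma; split; [exact Hc|]; split; [exact Hinf|].
  apply curve_lim; intros eps He.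
  destruct (Ho p) as [k [d [c [Hd [Hc' Hlow]]]]].
  set (e := Rmin eps d).
  assert (He1 : e <= eps) by apply Rmin_l.
  assert (He2 : e <= d) by apply Rmin_r.
  assert (He0 : 0 < e) by (apply Rmin_glb_lt; lra).
  destruct (Hlim' (c * e ^ k)) as [T HT].
  { apply Rmult_lt_0_compat; auto; now apply pow_lt. }
  destruct (Hacc e T He0) as [t0 [Ht0 Ht0']].
  exists t0; intros t Ht; apply Rnot_le_lt; intros Hge.
  change (eps <= Cmod (h t - p)) in Hge.
  (* On the circle of radius e around p, |u - w| is at least c * e^k, so after time T the curve
     cannot cross it; being inside at t0, it stays inside. *)
  destruct (IVT_gen (fun t => Cmod (h t - p)) t0 t e) as [s [Hs1 Hs2]].
  { now apply rcont_Cmod. }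
  { rewrite Rmin_left, Rmax_right by lra; lra. }
  rewrite Rmin_left, Rmax_right in Hs1 by lra.
  specialize (HT s ltac:(lra)); specialize (Hlow (h s) ltac:(lra)).
  rewrite Hs2, Hup in Hlow; lra.
Qed.

Lemma singular_value_comp u v w : entireC u -> finite_order u -> entireC v ->
  singular_value (fun z => u (v z)) w ->
  singular_value u w \/ exists p, singular_value v p /\ u p = w.
Proof.
intros Hu Ho Hv [H|H].
- apply critical_value_comp in H; auto; destruct H as [H|[p [H E]]].
  + left; now left.
  + right; exists p; split; [now left | exact E].
- apply asymptotic_value_comp in H; auto; destruct H as [H|[p [H E]]].
  + left; now right.
  + right; exists p; split; [now right | exact E].
Qed.

Lemma closure_Cmod S w : closure S w <-> forall d, 0 < d -> exists v, S v /\ Cmod (v - w) < d.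
Proof.
split.
- intros H d Hd; apply (H (fun v => Cmod (v - w) < d)), locally_Cmod; exists d; auto.
- intros H V HV; apply locally_Cmod in HV; destruct HV as [d [Hd HV]].
  destruct (H d Hd) as [v [Hv1 Hv2]]; exists v; auto.
Qed.

Definition closedC (E : C -> Prop) : Prop :=
  forall w, (forall d, 0 < d -> exists v, E v /\ Cmod (v - w) < d) -> E w.

Lemma closedC_closure S : closedC (closure S).
Proof.
intros w H; apply closure_Cmod; intros d Hd.
destruct (H (d / 2)) as [v [Hv Hvw]]; [lra|].
apply closure_Cmod with (d := d / 2) in Hv; [|lra]; destruct Hv as [y [Hy Hyv]].
exists y; split; [exact Hy|]; pose proof (Cmod_sub_triangle y v w); lra.
Qed.

Lemma closedC_union n (E : nat -> C -> Prop) : (forall j, (j < n)%nat -> closedC (E j)) ->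
  closedC (fun w => exists j, (j < n)%nat /\ E j w).
Proof.
induction n as [|n IH]; intros HE w Hw.
- destruct (Hw 1 Rlt_0_1) as [v [[j [Hj _]] _]]; lia.
- destruct (classic (E n w)) as [Hn|Hn]; [exists n; auto|].
  destruct (IH (fun j Hj => HE j (Nat.lt_lt_succ_r _ _ Hj)) w) as [j [Hj Hjw]].
  2:{ exists j; auto. }
  assert (Hsep : exists d, 0 < d /\ forall v, Cmod (v - w) < d -> ~ E n v).
  { apply NNPP; intros Hno; apply Hn, (HE n (Nat.lt_succ_diag_r n)); intros d Hd.
    apply NNPP; intros Hd'; apply Hno; exists d; split; [exact Hd|].
    intros v Hv HEv; apply Hd'; now exists v. }
  destruct Hsep as [d0 [Hd0 Hsep]].
  intros d Hd; destruct (Hw (Rmin d d0)) as [v [[j [Hj Hv]] Hvw]]; [now apply Rmin_glb_lt|].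
  assert (Hv1 := Rlt_le_trans _ _ _ Hvw (Rmin_l _ _)).
  assert (Hv2 := Rlt_le_trans _ _ _ Hvw (Rmin_r _ _)).
  exists v; split; [|exact Hv1]; exists j; split; [|exact Hv].
  destruct (Nat.eq_dec j n) as [->|]; [now apply Hsep in Hv|lia].
Qed.

Lemma Sing_closed f E : closedC E -> (forall w, singular_value f w -> E w) ->
  forall w, Sing f w -> E w.
Proof.
intros HE Hf w [H|H]; [now apply Hf|].
apply HE; intros d Hd.
destruct (H (fun v => Cmod (v - w) < d)) as [v [_ [Hv Hvw]]].
{ apply locally_Cmod; exists d; auto. }
exists v; split; [now apply Hf | exact Hvw].
Qed.

Lemma postsingular_subset f E : closedC E -> (forall w, singular_value f w -> E w) ->
  (forall w, E w -> E (f w)) -> forall w, postsingular f w -> E w.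
Proof.
intros HE Hs Hinv w Hw; apply HE; intros d Hd.
apply closure_Cmod with (d := d) in Hw; [|exact Hd].
destruct Hw as [v [[m [y [Hy ->]]] Hv]]; exists (Nat.iter m f y); split; [|exact Hv].
clear Hv; induction m as [|m IH]; [now apply (Sing_closed f E) | now apply Hinv].
Qed.

(** * Uniform bounds and normality *)

Lemma open_Cmod (U : C -> Prop) : open U <->
  forall z, U z -> exists d, 0 < d /\ forall w, Cmod (w - z) < d -> U w.
Proof. split; intros H z Hz; apply locally_Cmod, H, Hz. Qed.

Lemma open_disc c r : open (fun z => Cmod (z - c) < r).
Proof.
apply open_Cmod; intros z Hz; exists (r - Cmod (z - c)); split; [lra|]; intros w Hw.
pose proof (Cmod_sub_triangle w z c); lra.
Qed.

(** Passage from local to uniform constants: monotonicity in N lets the finitely many constants of a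
    subcover be replaced by their sum. *)
Lemma compact_uniform K (Phi : nat -> C -> Prop) : compact_set K ->
  (forall M N z, (M <= N)%nat -> Phi M z -> Phi N z) ->
  (forall z, K z -> exists N d, 0 < d /\ forall w, Cmod (w - z) < d -> Phi N w) ->
  exists N, forall z, K z -> Phi N z.
Proof.
intros HK Hmon Hloc.
destruct (HK (fun U => open U /\ exists N, forall w, U w -> Phi N w)) as [l [Hl1 Hl2]].
- intros U [HU _]; exact HU.
- intros z Hz; destruct (Hloc z Hz) as [N [d [Hd H]]].
  exists (fun w => Cmod (w - z) < d); split; [split; [apply open_disc | now exists N]|].
  now apply Cmod_center_lt.
- assert (HN : exists N, forall U, In U l -> forall w, U w -> Phi N w).
  { clear Hl2; induction l as [|U l IH]; [exists 0%nat; intros U []|].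
    destruct IH as [N1 H1]; [intros; apply Hl1; now right|].
    destruct (Hl1 U (or_introl eq_refl)) as [_ [N2 H2]].
    exists (N1 + N2)%nat; intros V [<-|HV] w Hw.
    - apply (Hmon N2); [lia | now apply H2].
    - apply (Hmon N1); [lia | now apply (H1 V)]. }
  destruct HN as [N HN]; exists N; intros z Hz; destruct (Hl2 z Hz) as [U [HU HUz]].
  now apply (HN U).
Qed.

Lemma compact_bounded K : compact_set K -> exists B, forall z, K z -> Cmod z <= B.
Proof.
intros HK; destruct (compact_uniform K (fun N z => Cmod z <= INR N) HK) as [N HN].
- intros M N z HMN Hz; eapply Rle_trans; [exact Hz | now apply le_INR].
- intros z _; destruct (INR_unbounded (Cmod z + 1)) as [N HN].
  exists N, 1; split; [lra|]; intros w Hw; pose proof (Cmod_le_add w z); lra.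
- now exists (INR N).
Qed.

Lemma invariant_iter (K : C -> Prop) (f : C -> C) : (forall z, K z -> K (f z)) ->
  forall m z, K z -> K (Nat.iter m f z).
Proof. intros H; induction m as [|m IH]; intros z Hz; simpl; auto. Qed.

(** Otherwise there are points tending to z and iterates unbounded along them; a convergent
    subsequence of these iterates leads to a contradiction, whether its limit is finite or
    infinite. *)
Lemma Fatou_locally_bounded f z B : entireC f -> Fatou f z ->
  (forall k, Cmod (Nat.iter k f z) <= B) ->
  exists d M, 0 < d /\ forall w, Cmod (w - z) < d -> forall k, Cmod (Nat.iter k f w) <= M.
Proof.
intros Hf [U [HU [HUz Hnorm]]] HB.
destruct (proj1 (open_Cmod U) HU z HUz) as [d0 [Hd0 HU0]].
apply NNPP; intros Hno.
assert (Hbad : forall j : nat, exists mw : nat * C,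
  Cmod (snd mw - z) < d0 * (/ 2) ^ j /\ INR j < Cmod (Nat.iter (fst mw) f (snd mw))).
{ intros j; apply NNPP; intros Hj; apply Hno.
  exists (d0 * (/ 2) ^ j), (INR j); split.
  { apply Rmult_lt_0_compat; auto; apply pow_lt; lra. }
  intros w Hw k; apply Rnot_lt_le; intros Hlt; apply Hj; now exists (k, w). }
apply (choice (fun (j : nat) (mw : nat * C) =>
  Cmod (snd mw - z) < d0 * (/ 2) ^ j /\ INR j < Cmod (Nat.iter (fst mw) f (snd mw)))) in Hbad.
destruct Hbad as [s Hs].
destruct (Hnorm (fun j => fst (s j))) as [phi [Hphi Hcases]].
pose proof (strictly_increasing_ge phi Hphi) as Hge.
destruct Hcases as [[l Hl]|Hinf].
- destruct (Hl z HUz) as [V [HV Hev]].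
  apply locally_Cmod in HV; destruct HV as [d1 [Hd1 HV]].
  destruct (Hev 1 Rlt_0_1) as [k0 Hk0].
  destruct (entireC_cont (Nat.iter (fst (s (phi k0))) f) z (entireC_iter f _ Hf) 1 Rlt_0_1)
    as [d2 [Hd2 Hc]].
  (* Nothing is known about the size of the limit [l], so the iterates are compared with the fixed
     one of index [k0]: two errors 1 through [l] and one from its continuity at z. *)
  set (A := Cmod (Nat.iter (fst (s (phi k0))) f z) + 3).
  destruct (INR_unbounded A) as [m Hm].
  destruct (pow_half_small d0 (Rmin d0 (Rmin d1 d2))) as [N HN]; [lra | repeat apply Rmin_glb_lt; lra|].
  set (k := (k0 + m + N)%nat).
  assert (Hk : (k <= phi k)%nat) by apply Hge.
  destruct (Hs (phi k)) as [Hw Hlt].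
  set (w := snd (s (phi k))) in *.
  specialize (HN (phi k) ltac:(unfold k in *; lia)).
  assert (Hwd := Rlt_trans _ _ _ Hw HN).
  assert (W0 := Rlt_le_trans _ _ _ Hwd (Rmin_l _ _)).
  assert (Hwd' := Rlt_le_trans _ _ _ Hwd (Rmin_r _ _)).
  assert (W1 := Rlt_le_trans _ _ _ Hwd' (Rmin_l _ _)).
  assert (W2 := Rlt_le_trans _ _ _ Hwd' (Rmin_r _ _)).
  pose proof (Hk0 k ltac:(unfold k; lia) w (HU0 w W0) (HV w W1)) as A1.
  pose proof (Hk0 k0 (le_n k0) w (HU0 w W0) (HV w W1)) as A2.
  specialize (Hc w W2).
  assert (INR m <= INR (phi k)) by (apply le_INR; unfold k in *; lia).
  pose proof (Cmod_sub_triangle (Nat.iter (fst (s (phi k))) f w) (l w) (Nat.iter (fst (s (phi k0))) f w)).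
  rewrite (Cmod_sym (l w)) in H0.
  pose proof (Cmod_le_add (Nat.iter (fst (s (phi k))) f w) (Nat.iter (fst (s (phi k0))) f w)).
  pose proof (Cmod_le_add (Nat.iter (fst (s (phi k0))) f w) (Nat.iter (fst (s (phi k0))) f z)).
  unfold A in Hm; lra.
(* An infinite limit is excluded at z itself, whose orbit is bounded by B. *)
- destruct (Hinf z HUz) as [V [HV Hev]].
  destruct (Hev B) as [k0 Hk0].
  apply locally_Cmod in HV; destruct HV as [d1 [Hd1 HV]].
  specialize (Hk0 k0 (le_n k0) z HUz (HV z (Cmod_center_lt z d1 Hd1))).
  specialize (HB (fst (s (phi k0)))); lra.
Qed.

(** One natural number N encodes both the radius 1/(N + 1) and the bound N, which makes the
    condition monotone and fit for [compact_uniform]. Invariance and compactness bound the orbits of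
    the postsingular points. *)
Lemma hyperbolic_uniform_bound f : entireC f -> hyperbolic f ->
  (forall z, postsingular f z -> postsingular f (f z)) ->
  exists r M, 0 < r /\ forall z, postsingular f z ->
    forall w, Cmod (w - z) < r -> forall k, Cmod (Nat.iter k f w) <= M.
Proof.
intros Hf [HK HF] Hinv.
destruct (compact_bounded _ HK) as [B HB].
destruct (compact_uniform (postsingular f) (fun N z => forall w, Cmod (w - z) < / (INR N + 1) ->
  forall k, Cmod (Nat.iter k f w) <= INR N) HK) as [N HN].
- intros M N z HMN H w Hw k.
  apply le_INR in HMN; pose proof (pos_INR M).
  apply Rle_trans with (INR M); [|exact HMN].
  apply H; eapply Rlt_le_trans; [exact Hw|]; apply Rinv_le_contravar; lra.
- intros z Hz; destruct (Fatou_locally_bounded f z B Hf (HF z Hz)) as [d [M [Hd H]]].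
  { intros k; apply HB; now apply (invariant_iter (postsingular f)). }
  destruct (INR_unbounded (Rmax M (2 / d))) as [N HN].
  exists N, (d / 2); split; [lra|]; intros w Hw y Hy k.
  assert (H1 : M < INR N) by (eapply Rle_lt_trans; [apply Rmax_l | exact HN]).
  assert (H2 : 2 / d < INR N) by (eapply Rle_lt_trans; [apply Rmax_r | exact HN]).
  apply Rle_trans with M; [|lra]; apply H.
  assert (/ (INR N + 1) < d / 2).
  { replace (d / 2) with (/ (2 / d)) by (field; lra).
    assert (0 < 2 / d) by (apply Rdiv_lt_0_compat; lra).
    apply Rinv_lt_contravar; [nra | lra]. }
  pose proof (Cmod_sub_triangle y w z); lra.
- exists (/ (INR N + 1)), (INR N); split; [apply Rinv_0_lt_compat; pose proof (pos_INR N); lra|].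
  exact HN.
Qed.

Lemma finite_net z r eta : 0 <= r -> 0 < eta ->
  exists l : list C, forall w, Cmod (w - z) <= r -> exists p, In p l /\ Cmod (w - p) <= eta.
Proof.
intros Hr He.
destruct (INR_unbounded ((2 * r + 1) / (eta / 2))) as [n Hn].
assert (Hn' : 2 * r + 1 < INR n * (eta / 2)).
{ apply Rmult_lt_reg_r with (/ (eta / 2)); [apply Rinv_0_lt_compat; lra|].
  rewrite Rmult_assoc, Rinv_r, Rmult_1_r by lra; exact Hn. }
set (x := fun i => INR i * (eta / 2) - r).
exists (map (fun ij : nat * nat => (z + (x (fst ij), x (snd ij)))%C) (list_prod (seq 0 n) (seq 0 n))).
intros w Hw.
pose proof (re_le_Cmod (w - z)) as Hre; pose proof (im_le_Cmod (w - z)) as Him.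
apply Rabs_le_between in Hre; apply Rabs_le_between in Him.
destruct (real_cell (Re (w - z) + r) (eta / 2) n) as [i [Hi Hi']]; [lra|].
destruct (real_cell (Im (w - z) + r) (eta / 2) n) as [j [Hj Hj']]; [lra|].
exists (z + (x i, x j))%C; split.
- apply in_map_iff; exists (i, j); split; [reflexivity|].
  apply in_prod; apply in_seq; lia.
- eapply Rle_trans; [apply Cmod_le_components|].
  replace (Re (w - (z + (x i, x j)))%C) with (Re (w - z)%C - x i) by (unfold Re; simpl; ring).
  replace (Im (w - (z + (x i, x j)))%C) with (Im (w - z)%C - x j) by (unfold Im; simpl; ring).
  rewrite S_INR in *; unfold x.
  rewrite !Rabs_pos_eq by lra; lra.
Qed.

Lemma refine_list (l : list C) (u : nat -> C -> C) z d B N eps : infinite N -> 0 < eps ->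
  (forall m w, Cmod (w - z) <= d -> Cmod (u m w) <= B) ->
  exists N', infinite N' /\ (forall k, N' k -> N k) /\
    forall p, In p l -> Cmod (p - z) <= d -> forall j k, N' j -> N' k -> Cmod (u j p - u k p) <= eps.
Proof.
intros HN He HB; revert N HN; induction l as [|p l IH]; intros N HN.
- exists N; repeat split; auto; intros p [].
- destruct (IH N HN) as [N1 [I1 [S1 C1]]].
  destruct (Rle_dec (Cmod (p - z)) d) as [Hp|Hp].
  + destruct (refine_complex N1 (fun k => u k p) B eps I1 He) as [N2 [I2 [S2 C2]]].
    { intros; now apply HB. }
    exists N2; split; [exact I2|]; split; [auto|].
    intros q [<-|Hq] Hqd j k Hj Hk; [now apply C2 | apply (C1 q); auto].
  + exists N1; split; [exact I1|]; split; [auto|].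
    intros q [<-|Hq] Hqd j k Hj Hk; [lra | apply (C1 q); auto].
Qed.

Lemma equicontinuous (u : C -> C) z d B w p : 0 < d -> 0 <= B -> entireC u ->
  (forall y, Cmod (y - z) <= d -> Cmod (u y) <= B) ->
  Cmod (w - z) <= d / 4 -> Cmod (w - p) <= d / 8 ->
  Cmod (u w - u p) <= B * Cmod (w - p) * (4 / d).
Proof.
intros Hd HB0 Hu HB Hw Hp.
assert (Hpz : Cmod (p - z) <= 3 * d / 8).
{ pose proof (Cmod_sub_triangle p w z); rewrite (Cmod_sym p w) in H; lra. }
eapply Rle_trans.
{ apply (cauchy_lipschitz u p d (d / 2) B); [now apply entireC_holo | lra | lra |].
  intros y Hy; apply HB; pose proof (Cmod_sub_triangle y p z); lra. }
unfold Rdiv at 1; apply Rmult_le_compat_l.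
- apply Rmult_le_pos; [exact HB0 | apply Cmod_ge_0].
- replace (4 / d) with (/ (d / 4)) by (field; lra); apply Rinv_le_contravar; lra.
Qed.

(** Cauchy's estimate makes the family equicontinuous, so closeness on a fine finite net gives
    closeness on the disc of radius d/4; [diagonal] then produces a uniformly Cauchy subsequence. *)
Lemma montel_bounded (u : nat -> C -> C) z d B : 0 < d -> (forall m, entireC (u m)) ->
  (forall m w, Cmod (w - z) <= d -> Cmod (u m w) <= B) ->
  normal_family (fun w => Cmod (w - z) < d / 4) u.
Proof.
intros Hd Hu HB s.
assert (HB0 : 0 <= B).
{ eapply Rle_trans; [apply Cmod_ge_0 | apply (HB 0%nat z)]; left; now apply Cmod_center_lt. }
destruct (diagonal (fun eps j k => forall w, Cmod (w - z) < d / 4 ->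
  Cmod (u (s j) w - u (s k) w) <= eps)) as [phi [Hphi HC]].
- intros N eps HN He.
  (* Chosen so that the Lipschitz bound B * eta * (4/d) is at most eps/3; B + 1 avoids division by
     0. *)
  set (eta := Rmin (d / 8) (eps * d / (12 * (B + 1)))).
  assert (Heta : 0 < eta).
  { apply Rmin_glb_lt; [lra|]; apply Rdiv_lt_0_compat; nra. }
  assert (Heta1 : eta <= d / 8) by apply Rmin_l.
  assert (Heta2 : eta <= eps * d / (12 * (B + 1))) by apply Rmin_r.
  destruct (finite_net z (d / 4) eta) as [l Hl]; [lra | exact Heta |].
  destruct (refine_list l (fun k => u (s k)) z d B N (eps / 3) HN) as [N' [I' [S' C']]]; [lra | |].
  { intros; now apply HB. }
  exists N'; split; [exact I'|]; split; [exact S'|].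
  intros j k Hj Hk w Hw; destruct (Hl w ltac:(lra)) as [p [Hpl Hp]].
  assert (Hpz : Cmod (p - z) <= d).
  { pose proof (Cmod_sub_triangle p w z); rewrite (Cmod_sym p w) in H; lra. }
  specialize (C' p Hpl Hpz j k Hj Hk).
  assert (HL : forall m, Cmod (u m w - u m p) <= eps / 3).
  { intros m; eapply Rle_trans; [apply (equicontinuous (u m) z d B); auto; lra|].
    apply Rle_trans with ((B + 1) * (eps * d / (12 * (B + 1))) * (4 / d)); [|right; field; lra].
    apply Rmult_le_compat_r; [left; apply Rdiv_lt_0_compat; lra|].
    apply Rmult_le_compat; try lra; apply Cmod_ge_0. }
  pose proof (HL (s j)) as L1; pose proof (HL (s k)) as L2; rewrite Cmod_sym in L2.
  pose proof (Cmod_sub_triangle (u (s j) w) (u (s j) p) (u (s k) w)).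
  pose proof (Cmod_sub_triangle (u (s j) p) (u (s k) p) (u (s k) w)); lra.
- intros e1 e2 j k He H w Hw; specialize (H w Hw); lra.
- exists phi; split; [exact Hphi|]; left.
  assert (Hlim : forall w, exists l, Cmod (w - z) < d / 4 -> C_cv (fun k => u (s (phi k)) w) l).
  { intros w; destruct (classic (Cmod (w - z) < d / 4)) as [Hw|Hw]; [|exists 0; tauto].
    destruct (C_complete (fun k => u (s (phi k)) w)) as [l Hl]; [|now exists l].
    intros eps He; destruct (HC (eps / 2)) as [K HK]; [lra|]; exists K; intros n m Hn Hm.
    specialize (HK n m Hn Hm w Hw); lra. }
  apply choice in Hlim; destruct Hlim as [l Hl]; exists l.
  intros y Hy; exists (fun _ => True); split; [now exists (mkposreal 1 Rlt_0_1)|].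
  intros eps He; destruct (HC (eps / 2)) as [K HK]; [lra|].
  exists K; intros n Hn w Hw _.
  destruct (Hl w Hw (eps / 2)) as [K2 HK2]; [lra|].
  specialize (HK2 (K + K2)%nat ltac:(lia)); specialize (HK n (K + K2)%nat Hn ltac:(lia) w Hw).
  pose proof (Cmod_sub_triangle (u (s (phi n)) w) (u (s (phi (K + K2)%nat)) w) (l w)); lra.
Qed.

(** * Compact unions, invariance of postsingular sets, and the conclusion *)

Lemma closed_subset_compact (K F : C -> Prop) : compact_set K -> closedC F ->
  (forall z, F z -> K z) -> compact_set F.
Proof.
intros HK HF Hsub cover Ho Hc.
destruct (HK (fun U => cover U \/ (open U /\ forall z, U z -> ~ F z))) as [l [Hl1 Hl2]].
- intros U [HU|[HU _]]; auto.
- intros z Hz; destruct (classic (F z)) as [HFz|HFz].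
  + destruct (Hc z HFz) as [U [HU HUz]]; exists U; auto.
  + exists (fun w => ~ F w); split; [right; split; auto|exact HFz].
    apply open_Cmod; intros w Hw; apply NNPP; intros Hno; apply Hw, HF; intros d Hd.
    apply NNPP; intros Hd'; apply Hno; exists d; split; [exact Hd|].
    intros v Hv HFv; apply Hd'; now exists v.
- assert (H : exists l', (forall U, In U l' -> cover U) /\
    forall z, F z -> (exists U, In U l /\ U z) -> exists U, In U l' /\ U z).
  { clear Hl2; induction l as [|U l IH].
    - exists nil; split; [intros U []|]; intros z _ [U [[] _]].
    - destruct IH as [l' [H1 H2]]; [intros; apply Hl1; now right|].
      destruct (Hl1 U (or_introl eq_refl)) as [HU|[_ HU]].
      + exists (U :: l'); split; [intros V [<-|HV]; auto|].
        intros z Hz [V [[<-|HV] HVz]]; [exists U; split; [now left | auto]|].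
        destruct (H2 z Hz (ex_intro _ V (conj HV HVz))) as [W [HW HWz]].
        exists W; split; [now right | auto].
      + exists l'; split; [exact H1|].
        intros z Hz [V [[<-|HV] HVz]]; [now apply HU in HVz|].
        apply H2; auto; now exists V. }
  destruct H as [l' [H1 H2]]; exists l'; split; auto.
Qed.

Lemma finite_union_compact n (K : nat -> C -> Prop) : (forall j, (j < n)%nat -> compact_set (K j)) ->
  compact_set (fun w => exists j, (j < n)%nat /\ K j w).
Proof.
induction n as [|n IH]; intros HK cover Ho Hc.
- exists nil; split; [intros U []|]; intros z [j [Hj _]]; lia.
- destruct (IH (fun j Hj => HK j (Nat.lt_lt_succ_r _ _ Hj)) cover Ho) as [l1 [A1 B1]].
  { intros z [j [Hj Hz]]; apply Hc; exists j; auto. }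
  destruct (HK n (Nat.lt_succ_diag_r n) cover Ho) as [l2 [A2 B2]].
  { intros z Hz; apply Hc; exists n; auto. }
  exists (l1 ++ l2); split.
  + intros U HU; apply in_app_or in HU; destruct HU; auto.
  + intros z [j [Hj Hz]]; destruct (Nat.eq_dec j n) as [->|Hn].
    * destruct (B2 z Hz) as [U [HU HUz]]; exists U; split; [apply in_or_app; now right | auto].
    * destruct (B1 z) as [U [HU HUz]]; [exists j; split; [lia | auto]|].
      exists U; split; [apply in_or_app; now left | auto].
Qed.

(** The iterate of [f] allowed in the hypothesis treats two cases together: m = 1 when h is f, and m
    = 0 when h maps the singular set of f into itself. Commutation extends this to forward orbits,
    continuity to their closure. *)
Lemma postsingular_invariant f h : entireC h -> (forall z, f (h z) = h (f z)) ->
  (forall w, Sing f w -> exists m y, Sing f y /\ h w = Nat.iter m f y) ->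
  forall w, postsingular f w -> postsingular f (h w).
Proof.
intros Hh Hcom HS w Hw; apply closure_Cmod; intros d Hd.
destruct (entireC_cont h w Hh d Hd) as [e [He Hb]].
apply closure_Cmod with (d := e) in Hw; [|exact He].
destruct Hw as [v [[m [y [Hy ->]]] Hv]].
exists (h (Nat.iter m f y)); split; [|now apply Hb].
destruct (HS y Hy) as [k [x [Hx E]]].
exists (m + k)%nat, x; split; [exact Hx|].
rewrite Nat.iter_add, <- E; symmetry.
exact (iter_commute f h Hcom m 1 y).
Qed.

Theorem theorem3p3 (n : nat) (g : nat -> C -> C)
  (n_pos : (1 <= n)%nat)
  (g_transcendental : forall i : nat, (i < n)%nat -> transcendental_entire (g i))
  (g_abelian : forall i j : nat, (i < n)%nat -> (j < n)%nat ->
     forall z : C, g i (g j z) = g j (g i z))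
  (g_bounded_type : forall i : nat, (i < n)%nat -> bounded_type (g i))
  (g_Sing : forall i j : nat, (i < n)%nat -> (j < n)%nat -> i <> j ->
     forall w : C, Sing (g j) w -> Sing (g j) (g i w))
  (g_hyperbolic : forall i : nat, (i < n)%nat -> hyperbolic (g i)) :
  hyperbolic_semigroup (semigroup n g).
Proof.
assert (Hent : forall i, (i < n)%nat -> entireC (g i)).
{ intros i Hi; apply entire_entireC, g_transcendental, Hi. }
assert (Hgen : forall i j, (i < n)%nat -> (j < n)%nat ->
  forall w, postsingular (g j) w -> postsingular (g j) (g i w)).
{ intros i j Hi Hj; apply postsingular_invariant; auto.
  intros w Hw; destruct (Nat.eq_dec i j) as [->|Hij].
  - now exists 1%nat, w.
  - exists 0%nat, (g i w); split; [now apply g_Sing | reflexivity]. }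
set (E := fun w => exists j, (j < n)%nat /\ postsingular (g j) w).
assert (HEc : closedC E).
{ apply closedC_union; intros; apply closedC_closure. }
(* Finite order is carried along because asymptotic values of u o v are located through isolated
   preimages under u. Invariance is kept for each P(g_j) separately, since the Fatou part works
   inside a single one. *)
assert (Hsemi : forall f, semigroup n g f -> entireC f /\ finite_order f /\
  (forall i, (i < n)%nat -> forall z, g i (f z) = f (g i z)) /\
  (forall j, (j < n)%nat -> forall w, postsingular (g j) w -> postsingular (g j) (f w)) /\
  (forall w, singular_value f w -> E w)).
{ intros f Hf; induction Hf as [i Hi | u v _ [U1 [U2 [U3 [U4 U5]]]] _ [V1 [V2 [V3 [V4 V5]]]]].
  - repeat split; auto.
    + now apply transcendental_finite_order, g_transcendental.
    + intros w Hw; exists i; split; [exact Hi|].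
      apply closure_Cmod; intros d Hd; exists w; split; [|now apply Cmod_center_lt].
      exists 0%nat, w; split; [now left | reflexivity].
  - repeat split.
    + now apply entireC_comp.
    + now apply finite_order_comp.
    + intros i Hi z; now rewrite U3, V3.
    + intros j Hj w Hw; now apply U4, V4.
    + intros w Hw; apply singular_value_comp in Hw; auto.
      destruct Hw as [Hw|[p [Hp <-]]]; [now apply U5|].
      destruct (V5 p Hp) as [j [Hj Hjp]]; exists j; split; [exact Hj | now apply U4]. }
intros f Hf; destruct (Hsemi f Hf) as [H1 [_ [H3 [H4 H5]]]].
assert (HPE : forall w, postsingular f w -> E w).
{ apply postsingular_subset; auto.
  intros w [j [Hj Hw]]; exists j; split; [exact Hj | now apply H4]. }
split.
- apply (closed_subset_compact E); auto; [|apply closedC_closure].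
  apply finite_union_compact; intros j Hj; now apply g_hyperbolic.
- intros z Hz; destruct (HPE z Hz) as [j [Hj Hjz]].
  (* The same r and M hold at all points of P(g_j), in particular along the whole f-orbit of z. *)
  destruct (hyperbolic_uniform_bound (g j)) as [r [M [Hr HM]]]; auto.
  destruct (commuting_iterates_bounded (g j) f z r M) as [d [B [Hd HB]]]; auto.
  + now apply transcendental_finite_order, g_transcendental.
  + now apply transcendental_not_affine, g_transcendental.
  + intros m w Hw; apply (HM (Nat.iter m f z)); auto.
    now apply (invariant_iter (postsingular (g j))); [apply H4|].
  + exists (fun w => Cmod (w - z) < d / 4); split; [apply open_disc|]; split.
    * apply Cmod_center_lt; lra.
    * apply (montel_bounded _ z d B Hd); auto; intros m; now apply entireC_iter.
Qed.
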